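(* Let $s_j=\sigma_j+it_j\in\mathbb{C}$ ($j=1,2,3$) with $\sigma_1\ge0$, $t_1\ge0$, $\sigma_3>0$, $t_3\ge2$, $\sigma_1+\sigma_3>\tfrac12$ and $\tfrac32<\sigma_1+\sigma_2+\sigma_3\le2$, with $s_1,s_2,\sigma_3$ fixed. Assume that as $t_3$ runs from $2$ to $T$ the point $(s_1,s_2,s_3)$ never lies on the hyperplanes $s_1+s_3=1$ or $s_1+s_2+s_3=2$. Then as $T\to\infty$, $$\int_2^T|\zeta_{AV,2}(s_1,s_2,s_3)|^2dt_3=\zeta_{AV,2}^{[2]}(s_1,s_2,2\sigma_3)T+\begin{cases}O(T^{2-2\sigma_1-2\sigma_3}\log T)&(\sigma_2\ge\tfrac12+\sigma_1+\sigma_3),\\ O(T^{5/2-\sigma_1-\sigma_2-\sigma_3})&(\sigma_2<\tfrac12+\sigma_1+\sigma_3,\ \tfrac32<\sigma_1+\sigma_2+\sigma_3<2),\\ O((T\log T)^{1/2})&(\sigma_2<\tfrac12+\sigma_1+\sigma_3,\ \sigma_1+\sigma_2+\sigma_3=2),\end{cases}$$ where the implied constants depend on $s_1,s_2$ and $\sigma_3$.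
   Context: Write $s_j=\sigma_j+it_j$ with $\sigma_j,t_j\in\mathbb{R}$; complex powers $n^{s}=e^{s\log n}$ use the real logarithm. The Apostol–Vu double zeta-function is $\zeta_{AV,2}(s_1,s_2,s_3)=\sum_{m=1}^\infty\sum_{n<m}m^{-s_1}n^{-s_2}(m+n)^{-s_3}$ (positive integers $n<m$), absolutely convergent for $\sigma_1+\sigma_3>1$, $\sigma_1+\sigma_2+\sigma_3>2$, and extended meromorphically to $\mathbb{C}^3$ (singularities only on $s_1+s_3=1-l$, $s_1+s_2+s_3=2-l$, $l\in\mathbb{Z}_{\ge0}$); $\zeta_{AV,2}$ denotes this continuation. Also $\zeta_{AV,2}^{[2]}(s_1,s_2,s_3)=\sum_{k=2}^\infty\left|\sum_{k/2<m\le k-1}m^{-s_1}(k-m)^{-s_2}\right|^2k^{-s_3}$. *)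

(* Defs.v *)
From Stdlib Require Import Reals.
From Coquelicot Require Import Coquelicot.
Open Scope R_scope.

Definition cpow (x : R) (s : C) : C :=
  (exp (Re s * ln x) * cos (Im s * ln x), exp (Re s * ln x) * sin (Im s * ln x)).

(* Inner sum over n with 1 <= n <= m-1 (empty for m <= 1) of
   m^{-s1} n^{-s2} (m+n)^{-s3}. *)
Definition AV2_term (s1 s2 s3 : C) (m : nat) : C :=
  sum_n_m (fun n : nat =>
    Cmult (Cmult (cpow (INR m) (Copp s1)) (cpow (INR n) (Copp s2)))
          (cpow (INR (m + n)) (Copp s3))) 1 (m - 1).

Definition AV2_conv_region (s1 s2 s3 : C) : Prop :=
  Re s1 + Re s3 > 1 /\ Re s1 + Re s2 + Re s3 > 2.

Definition AV2_regular (s1 s2 s3 : C) : Prop :=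
  forall l : nat,
    Cplus s1 s3 <> RtoC (1 - INR l) /\
    Cplus (Cplus s1 s2) s3 <> RtoC (2 - INR l).

Definition holo3_at (F : C -> C -> C -> C) (z1 z2 z3 : C) : Prop :=
  exists a1 a2 a3 : C,
    forall eps : R, 0 < eps -> exists delta : R, 0 < delta /\
      forall h1 h2 h3 : C,
        Cmod h1 < delta -> Cmod h2 < delta -> Cmod h3 < delta ->
        Cmod (Cminus (F (Cplus z1 h1) (Cplus z2 h2) (Cplus z3 h3))
                     (Cplus (F z1 z2 z3)
                        (Cplus (Cmult a1 h1) (Cplus (Cmult a2 h2) (Cmult a3 h3)))))
        <= eps * (Cmod h1 + Cmod h2 + Cmod h3).

(* Z is the meromorphic continuation of zeta_{AV,2}: holomorphic off the
   singular hyperplanes and equal to the double series on its region of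
   absolute convergence (unique by the identity theorem, since the regular
   set is open and connected). *)
Definition is_zetaAV2 (Z : C -> C -> C -> C) : Prop :=
  (forall s1 s2 s3, AV2_regular s1 s2 s3 -> holo3_at Z s1 s2 s3) /\
  (forall s1 s2 s3, AV2_conv_region s1 s2 s3 ->
     is_series (AV2_term s1 s2 s3) (Z s1 s2 s3)).

(* zeta^{[2]}_{AV,2}(s1,s2,s3)
   = sum_{k>=2} | sum_{k/2 < m <= k-1} m^{-s1} (k-m)^{-s2} |^2 k^{-s3}.
   The integers m with k/2 < m are those with m >= k/2 + 1 (nat division). *)
Definition AV2sq_term (s1 s2 s3 : C) (k : nat) : C :=
  Cmult (RtoC (Cmod (sum_n_m (fun m : nat =>
            Cmult (cpow (INR m) (Copp s1)) (cpow (INR (k - m)) (Copp s2)))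
          (k / 2 + 1) (k - 1)) ^ 2))
        (cpow (INR k) (Copp s3)).

(* Sum of the series (terms vanish for k = 0, 1), componentwise. *)
Definition zetaAV2_sq (s1 s2 s3 : C) : C :=
  (Series (fun k => Re (AV2sq_term s1 s2 s3 k)),
   Series (fun k => Im (AV2sq_term s1 s2 s3 k))).

(* Main.v *)
Require Import Defs.
From Stdlib Require Import Reals Lra Lia Bool Classical ClassicalEpsilon.
From Coquelicot Require Import Coquelicot.
Open Scope R_scope.

(* For fixed [s1], [s2] the double series is the Dirichlet series in [s3] with coefficients
   [a_k = sum_{n < k/2} n^(-s2) (k-n)^(-s1)].  With the trapezoidal correction at [n = k/2], the
   increments of [k^s1 a_k] are [c k^(-s2)] up to a summable error, by a Riemann sum argument that
   does not involve [s3].  With [W = s1 + s3], the power [k^(-W)] is an increment of [k^(1-W) / (W-1)]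
   divided by a ratio that varies slowly once [k] is large compared with [|W|].  One Abel summation
   therefore reduces the tail over [k >= N], [N] of the order of [T], to a zeta tail, treated in
   the same way, and absolutely convergent sums.  Adding to the partial sums the two boundary
   terms of these summations gives holomorphic functions of [s3] that stay bounded on rectangles
   and converge to the double series far to the right.  They converge to its continuation
   everywhere, by the mean value property applied to [f e^(lambda p)], where the polynomial [p]
   has negative real part on the part of the circle where [f] is not yet known to be small.
   So for [t3] in [[T/2, T]] the function is a Dirichlet polynomial of length of the order of [T]
   up to a small error.  The diagonal terms of its mean square give the main term, the
   off-diagonal ones are bounded by means of [1 / log (l/k)], and summation over dyadic
   intervals finishes the proof. *)

(** The obstacle is that [Z] is known only through its differentiability off the hyperplanes and its
    values where the double series converges absolutely: at [sigma3] there is no formula for it.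
    Uniqueness of the continuation would not suffice either; convergence of the approximants at a
    given point is needed. The length is forced from both sides. The ratio [pow_ratio] is close to 1
    only when the index exceeds a multiple of [|z|], so [N] cannot be much smaller than [T]; the
    first boundary term of the Abel summation has size [N^(2-a-kap) / |z|], with
    [a = Re s1 + sigma3], so [N] cannot be much larger. Only [s3] varies: all constants may depend
    on [s1], [s2] and [sigma3], but the tail estimates have to be uniform in [z = s1 + s3 - 1],
    which is achieved by playing the factor [1 / |z|] of [pow_prim] against the errors of
    [pow_ratio]. *)

(** * Elementary inequalities for complex numbers *)

Lemma exp_le_compat (x y : R) : x <= y -> exp x <= exp y.
Proof. intros [H|H]; [left; apply exp_increasing; auto | right; rewrite H; auto]. Qed.

Lemma C_ext (z w : C) : Re z = Re w -> Im z = Im w -> z = w.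
Proof. destruct z, w; simpl; intros -> ->; reflexivity. Qed.

Lemma Re_minus (z w : C) : Re (Cminus z w) = Re z - Re w.
Proof. destruct z, w; simpl; ring. Qed.

Lemma Im_minus (z w : C) : Im (Cminus z w) = Im z - Im w.
Proof. destruct z, w; simpl; ring. Qed.

Lemma im_le_Cmod (z : C) : Rabs (Im z) <= Cmod z.
Proof.
  eapply Rle_trans; [|apply Rmax_Cmod]. apply Rmax_r.
Qed.

Lemma Cmod_le_Re_Im (z : C) : Cmod z <= Rabs (Re z) + Rabs (Im z).
Proof.
  replace z with (Cplus (RtoC (Re z)) (Cmult Ci (RtoC (Im z)))) at 1.
  - eapply Rle_trans; [apply Cmod_triangle|].
    rewrite Cmod_mult, Cmod_Ci, !Cmod_R. lra.
  - apply C_ext; simpl; ring.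
Qed.

Lemma Cmod_minus_sym (z w : C) : Cmod (Cminus z w) = Cmod (Cminus w z).
Proof.
  rewrite <- (Cmod_opp (Cminus w z)). f_equal. ring.
Qed.

Lemma Cmod_triangle3 (x y z : C) :
  Cmod (Cminus x z) <= Cmod (Cminus x y) + Cmod (Cminus y z).
Proof.
  replace (Cminus x z) with (Cplus (Cminus x y) (Cminus y z)) by ring.
  apply Cmod_triangle.
Qed.

Lemma Cmod_minus_le (x y : C) : Cmod (Cminus x y) <= Cmod x + Cmod y.
Proof.
  rewrite <- (Cmod_opp y). apply Cmod_triangle.
Qed.

Lemma Cmod_minus_ge (x y : C) : Cmod x - Cmod y <= Cmod (Cminus x y).
Proof.
  generalize (Cmod_triangle (Cminus x y) y).
  replace (Cplus (Cminus x y) y) with x by ring. lra.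
Qed.

Lemma Cmod_sqr (z : C) : Cmod z * Cmod z = Re z * Re z + Im z * Im z.
Proof. generalize (Cmod2_alt z). simpl. lra. Qed.

Lemma dot_le_Cmod (u v : C) :
  Rabs (Re u * Re v + Im u * Im v) <= Cmod u * Cmod v.
Proof.
  rewrite <- (Cmod_conj u), <- Cmod_mult.
  replace (Re u * Re v + Im u * Im v) with (Re (Cmult (Cconj u) v)).
  - apply re_le_Cmod.
  - destruct u, v; simpl; ring.
Qed.

(** * Complex-valued functions of a real variable *)

(** Componentwise, so that differentiation, the fundamental theorem and integrability are inherited
    from real functions. *)
Definition rder (F : R -> C) (x : R) (l : C) : Prop :=
  is_derive (fun t => Re (F t)) x (Re l) /\ is_derive (fun t => Im (F t)) x (Im l).

Definition rcont (F : R -> C) (x : R) : Prop :=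
  continuous (fun t => Re (F t)) x /\ continuous (fun t => Im (F t)) x.

Lemma rder_rcont (F : R -> C) (x : R) (l : C) : rder F x l -> rcont F x.
Proof.
  intros [H1 H2]; split; apply @ex_derive_continuous; eexists; eassumption.
Qed.

Lemma rder_ext (F G : R -> C) (x : R) (l : C) :
  (forall t, F t = G t) -> rder F x l -> rder G x l.
Proof.
  intros E [H1 H2]; split; [eapply is_derive_ext; [|exact H1]|eapply is_derive_ext; [|exact H2]];
  intros t; simpl; rewrite E; reflexivity.
Qed.

Lemma rder_plus (F G : R -> C) (x : R) (l m : C) :
  rder F x l -> rder G x m -> rder (fun t => Cplus (F t) (G t)) x (Cplus l m).
Proof.
  intros [H1 H2] [H3 H4]; split; simpl;
  [apply (is_derive_plus (fun t => Re (F t)) (fun t => Re (G t)))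
  |apply (is_derive_plus (fun t => Im (F t)) (fun t => Im (G t)))]; assumption.
Qed.

Lemma rder_const (c : C) (x : R) : rder (fun _ => c) x (RtoC 0).
Proof. split; simpl; apply @is_derive_const. Qed.

Lemma is_derive_Rmult (f g : R -> R) (x l m : R) :
  is_derive f x l -> is_derive g x m ->
  is_derive (fun t => f t * g t) x (l * g x + f x * m).
Proof.
  intros Hf Hg. exact (is_derive_mult f g x l m Hf Hg Rmult_comm).
Qed.

Lemma rder_mult (F G : R -> C) (x : R) (l m : C) :
  rder F x l -> rder G x m ->
  rder (fun t => Cmult (F t) (G t)) x (Cplus (Cmult l (G x)) (Cmult (F x) m)).
Proof.
  intros [H1 H2] [H3 H4]; split.
  - apply is_derive_ext with (fun t => Re (F t) * Re (G t) - Im (F t) * Im (G t)).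
    { intros t; rewrite re_mult; reflexivity. }
    replace (Re _) with ((Re l * Re (G x) + Re (F x) * Re m) - (Im l * Im (G x) + Im (F x) * Im m))
      by (rewrite re_plus, !re_mult; ring).
    apply (is_derive_minus (fun t => Re (F t) * Re (G t)) (fun t => Im (F t) * Im (G t)));
    apply is_derive_Rmult; assumption.
  - apply is_derive_ext with (fun t => Re (F t) * Im (G t) + Im (F t) * Re (G t)).
    { intros t; rewrite im_mult; reflexivity. }
    replace (Im _) with ((Re l * Im (G x) + Re (F x) * Im m) + (Im l * Re (G x) + Im (F x) * Re m))
      by (rewrite im_plus, !im_mult; ring).
    apply (is_derive_plus (fun t => Re (F t) * Im (G t)) (fun t => Im (F t) * Re (G t)));
    apply is_derive_Rmult; assumption.
Qed.

Lemma rder_scal (c : C) (F : R -> C) (x : R) (l : C) :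
  rder F x l -> rder (fun t => Cmult c (F t)) x (Cmult c l).
Proof.
  intros H. generalize (rder_mult _ _ _ _ _ (rder_const c x) H).
  replace (Cplus (Cmult 0 (F x)) (Cmult c l)) with (Cmult c l) by ring. auto.
Qed.

Lemma rder_RtoC (f : R -> R) (x l : R) :
  is_derive f x l -> rder (fun t => RtoC (f t)) x (RtoC l).
Proof. intros H; split; simpl; [exact H | apply @is_derive_const]. Qed.

(** Complex values admit no mean value equality, but the projection of [F] on the direction
    [u = F b - F a] is real, and its mean value theorem gives [|u|^2 <= |u| K (b - a)]. *)
Lemma mean_value_ineq (F dF : R -> C) (a b K : R) :
  a <= b ->
  (forall x, a <= x <= b -> rder F x (dF x)) ->
  (forall x, a <= x <= b -> Cmod (dF x) <= K) ->
  Cmod (Cminus (F b) (F a)) <= K * (b - a).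
Proof.
  intros Hab HF HK.
  set (u := Cminus (F b) (F a)).
  assert (H0 : 0 <= Cmod u) by apply Cmod_ge_0.
  destruct (MVT_gen (fun t => Re u * Re (F t) + Im u * Im (F t)) a b
    (fun t => Re u * Re (dF t) + Im u * Im (dF t))) as [c [Hc E]].
  - intros x Hx. rewrite Rmin_left, Rmax_right in Hx by lra.
    destruct (HF x ltac:(lra)) as [H1 H2].
    apply (is_derive_plus (fun t => Re u * Re (F t)) (fun t => Im u * Im (F t)));
    apply is_derive_scal; assumption.
  - intros x Hx. rewrite Rmin_left, Rmax_right in Hx by lra.
    destruct (HF x ltac:(lra)) as [H1 H2].
    apply continuity_pt_filterlim.
    apply (continuous_plus (fun t => Re u * Re (F t)) (fun t => Im u * Im (F t)));
    [apply (continuous_scal_r (K := R_AbsRing) (Re u) (fun t => Re (F t)))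
    |apply (continuous_scal_r (K := R_AbsRing) (Im u) (fun t => Im (F t)))];
    apply @ex_derive_continuous; eexists; eassumption.
  - rewrite Rmin_left, Rmax_right in Hc by lra.
    specialize (HK c Hc).
    assert (E2 : Cmod u * Cmod u = (Re u * Re (dF c) + Im u * Im (dF c)) * (b - a)).
    { rewrite <- E, Cmod_sqr. unfold u at 2 4. rewrite Re_minus, Im_minus. ring. }
    generalize (dot_le_Cmod u (dF c)). intros H3.
    generalize (Rle_abs (Re u * Re (dF c) + Im u * Im (dF c))). intros H4.
    destruct H0 as [H0|H0].
    + apply Rmult_le_reg_l with (Cmod u); auto. rewrite E2.
      apply Rle_trans with (Cmod u * K * (b - a)); [|lra].
      apply Rmult_le_compat_r; [lra|]. eapply Rle_trans; [apply H4|].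
      eapply Rle_trans; [apply H3|]. apply Rmult_le_compat_l; lra.
    + rewrite <- H0. apply Rmult_le_pos; [|lra].
      eapply Rle_trans; [apply Cmod_ge_0 | exact HK].
Qed.

(** * The complex exponential *)

Definition cexp (z : C) : C := (exp (Re z) * cos (Im z), exp (Re z) * sin (Im z)).

Lemma cexp_plus (z w : C) : cexp (Cplus z w) = Cmult (cexp z) (cexp w).
Proof.
  apply C_ext; rewrite ?re_mult, ?im_mult; unfold cexp; rewrite re_plus, im_plus, exp_plus;
  cbn [Re Im fst snd]; rewrite ?cos_plus, ?sin_plus; unfold Re, Im; ring.
Qed.

Lemma cexp_0 : cexp (RtoC 0) = RtoC 1.
Proof. apply C_ext; simpl; rewrite exp_0, ?cos_0, ?sin_0; ring. Qed.

Lemma Cmod_cexp (z : C) : Cmod (cexp z) = exp (Re z).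
Proof.
  unfold Cmod, cexp; cbn [fst snd].
  replace (_ + _) with (exp (Re z) * exp (Re z)).
  - apply sqrt_square, Rlt_le, exp_pos.
  - generalize (sin2_cos2 (Im z)). unfold Rsqr. intros H.
    transitivity (exp (Re z) * exp (Re z) * (sin (Im z) * sin (Im z) + cos (Im z) * cos (Im z))).
    + rewrite H; ring.
    + ring.
Qed.

Lemma cexp_neq_0 (z : C) : cexp z <> RtoC 0.
Proof.
  apply Cmod_gt_0. rewrite Cmod_cexp. apply exp_pos.
Qed.

Lemma cexp_opp (z : C) : cexp (Copp z) = Cinv (cexp z).
Proof.
  assert (H : Cmult (cexp (Copp z)) (cexp z) = RtoC 1).
  { rewrite <- cexp_plus. replace (Cplus (Copp z) z) with (RtoC 0) by ring. apply cexp_0. }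
  replace (Cinv (cexp z)) with (Cmult (Cmult (cexp (Copp z)) (cexp z)) (Cinv (cexp z))).
  - field. apply cexp_neq_0.
  - rewrite H. ring.
Qed.

(** One rule for the three uses to come: [f] the identity for [e^(zt)], [f = ln] for complex powers,
    [f = log_step] for [pow_ratio]. *)
Lemma rder_cexp_comp (f : R -> R) (z : C) (x l : R) :
  is_derive f x l ->
  rder (fun t => cexp (Cmult z (RtoC (f t)))) x (Cmult (Cmult z (RtoC l)) (cexp (Cmult z (RtoC (f x))))).
Proof.
  intros Hf. destruct z as [p q].
  split.
  - apply is_derive_ext with (fun t => exp (p * f t) * cos (q * f t)).
    { intros t; simpl. f_equal; f_equal; ring. }
    replace (Re _) with (l * p * exp (p * f x) * cos (q * f x) - exp (p * f x) * (l * q * sin (q * f x))).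
    2:{ unfold cexp; simpl. replace (p * f x - q * 0) with (p * f x) by ring.
        replace (p * 0 + q * f x) with (q * f x) by ring. ring. }
    auto_derive.
    { repeat split; exists l; exact Hf. }
    change (fun t => f t) with f. rewrite (is_derive_unique _ _ _ Hf). ring.
  - apply is_derive_ext with (fun t => exp (p * f t) * sin (q * f t)).
    { intros t; simpl. f_equal; f_equal; ring. }
    replace (Im _) with (l * p * exp (p * f x) * sin (q * f x) + exp (p * f x) * (l * q * cos (q * f x))).
    2:{ unfold cexp; simpl. replace (p * f x - q * 0) with (p * f x) by ring.
        replace (p * 0 + q * f x) with (q * f x) by ring. ring. }
    auto_derive.
    { repeat split; exists l; exact Hf. }
    change (fun t => f t) with f. rewrite (is_derive_unique _ _ _ Hf). ring.
Qed.

Lemma rder_cexp_line (z : C) (x : R) :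
  rder (fun t => cexp (Cmult z (RtoC t))) x (Cmult z (cexp (Cmult z (RtoC x)))).
Proof.
  generalize (rder_cexp_comp (fun t => t) z x 1 (is_derive_id x)).
  replace (Cmult z (RtoC 1)) with z by ring. auto.
Qed.

Lemma Re_mult_R_le (z : C) (t : R) : 0 <= t -> Re (Cmult z (RtoC t)) <= Cmod z * t.
Proof.
  intros Ht. rewrite re_scal_r. apply Rmult_le_compat_r; auto.
  eapply Rle_trans; [apply Rle_abs | apply re_le_Cmod].
Qed.

Lemma cexp_minus_1 (z : C) (t : R) : 0 <= t ->
  Cmod (Cminus (cexp (Cmult z (RtoC t))) (RtoC 1)) <= Cmod z * t * exp (Cmod z * t).
Proof.
  intros Ht.
  generalize (mean_value_ineq (fun t => cexp (Cmult z (RtoC t)))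
    (fun t => Cmult z (cexp (Cmult z (RtoC t)))) 0 t (Cmod z * exp (Cmod z * t)) Ht).
  intros H. cbn beta in H. replace (Cmult z (RtoC 0)) with (RtoC 0) in H by ring. rewrite cexp_0 in H.
  eapply Rle_trans; [apply H|].
  - intros x _. apply rder_cexp_line.
  - intros x Hx. rewrite Cmod_mult, Cmod_cexp. apply Rmult_le_compat_l; [apply Cmod_ge_0|].
    apply exp_le_compat. eapply Rle_trans; [apply Re_mult_R_le; lra|].
    apply Rmult_le_compat_l; [apply Cmod_ge_0|lra].
  - lra.
Qed.

Lemma cexp_minus_1_le (z : C) : Cmod (Cminus (cexp z) (RtoC 1)) <= Cmod z * exp (Cmod z).
Proof.
  generalize (cexp_minus_1 z 1 ltac:(lra)).
  replace (Cmult z (RtoC 1)) with z by ring. rewrite !Rmult_1_r. auto.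
Qed.

Lemma cexp_taylor2 (z : C) :
  Cmod (Cminus (Cminus (cexp z) (RtoC 1)) z) <= Cmod z * Cmod z * exp (Cmod z).
Proof.
  generalize (mean_value_ineq (fun t => Cplus (cexp (Cmult z (RtoC t))) (Cmult (Copp z) (RtoC t)))
    (fun t => Cplus (Cmult z (cexp (Cmult z (RtoC t)))) (Cmult (Copp z) (RtoC 1))) 0 1
    (Cmod z * Cmod z * exp (Cmod z)) ltac:(lra)).
  intros H. cbn beta in H. replace (Cmult z (RtoC 0)) with (RtoC 0) in H by ring.
  rewrite cexp_0 in H. replace (Cmult z (RtoC 1)) with z in H by ring.
  replace (Cminus (Cminus (cexp z) (RtoC 1)) z) with
    (Cminus (Cplus (cexp z) (Cmult (Copp z) 1)) (Cplus 1 (Cmult (Copp z) 0))) by ring.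
  eapply Rle_trans; [apply H|].
  - intros x _. apply rder_plus; [apply rder_cexp_line|].
    apply rder_scal. apply rder_RtoC. apply @is_derive_id.
  - intros x Hx.
    replace (Cplus _ _) with (Cmult z (Cminus (cexp (Cmult z (RtoC x))) (RtoC 1))) by ring.
    rewrite Cmod_mult, Rmult_assoc. apply Rmult_le_compat_l; [apply Cmod_ge_0|].
    eapply Rle_trans; [apply cexp_minus_1; lra|].
    generalize (Cmod_ge_0 z); intros Hz.
    apply Rmult_le_compat; [apply Rmult_le_pos; lra|apply Rlt_le, exp_pos| nra |].
    apply exp_le_compat. nra.
  - lra.
Qed.

(** * Complex differentiability *)

(** Written with increments, in the shape of [holo3_at], so that freezing two of the three variables
    there gives this notion at once. *)
Definition cder (F : C -> C) (z l : C) : Prop :=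
  forall eps : R, 0 < eps -> exists delta : R, 0 < delta /\
    forall h : C, Cmod h < delta ->
      Cmod (Cminus (F (Cplus z h)) (Cplus (F z) (Cmult l h))) <= eps * Cmod h.

Definition cdiff (F : C -> C) (z : C) : Prop := exists l, cder F z l.

Definition ccont (F : C -> C) (z : C) : Prop :=
  forall eps : R, 0 < eps -> exists delta : R, 0 < delta /\
    forall h : C, Cmod h < delta -> Cmod (Cminus (F (Cplus z h)) (F z)) < eps.

Lemma cder_lipschitz (F : C -> C) (z l : C) : cder F z l ->
  exists delta : R, 0 < delta /\
    forall h : C, Cmod h < delta ->
      Cmod (Cminus (F (Cplus z h)) (F z)) <= (Cmod l + 1) * Cmod h.
Proof.
  intros H. destruct (H 1 ltac:(lra)) as [d [Hd K]].
  exists d; split; auto. intros h Hh. specialize (K h Hh).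
  replace (Cminus (F (Cplus z h)) (F z)) with
    (Cplus (Cminus (F (Cplus z h)) (Cplus (F z) (Cmult l h))) (Cmult l h)) by ring.
  eapply Rle_trans; [apply Cmod_triangle|]. rewrite (Cmod_mult l). lra.
Qed.

Lemma cdiff_ccont (F : C -> C) (z : C) : cdiff F z -> ccont F z.
Proof.
  intros [l H] eps Heps. destruct (cder_lipschitz _ _ _ H) as [d [Hd K]].
  generalize (Cmod_ge_0 l); intros Hl.
  exists (Rmin d (eps / (Cmod l + 1) / 2)).
  assert (H0 : 0 < eps / (Cmod l + 1)) by (apply Rdiv_lt_0_compat; lra).
  split; [apply Rmin_case; lra|].
  intros h Hh. eapply Rle_lt_trans; [apply K|].
  - eapply Rlt_le_trans; [exact Hh | apply Rmin_l].
  - assert (H1 : Cmod h < eps / (Cmod l + 1) / 2) by (eapply Rlt_le_trans; [exact Hh | apply Rmin_r]).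
    apply Rlt_le_trans with ((Cmod l + 1) * (eps / (Cmod l + 1))).
    + apply Rmult_lt_compat_l; lra.
    + right; field; lra.
Qed.

Lemma cder_const (c z : C) : cder (fun _ => c) z (RtoC 0).
Proof.
  intros eps Heps. exists 1; split; [lra|]. intros h _.
  replace (Cminus _ _) with (RtoC 0) by ring. rewrite Cmod_0.
  apply Rmult_le_pos; [lra|apply Cmod_ge_0].
Qed.

Lemma cder_id (z : C) : cder (fun w => w) z (RtoC 1).
Proof.
  intros eps Heps. exists 1; split; [lra|]. intros h _.
  replace (Cminus _ _) with (RtoC 0) by ring. rewrite Cmod_0.
  apply Rmult_le_pos; [lra|apply Cmod_ge_0].
Qed.

Lemma cder_plus (F G : C -> C) (z l m : C) :
  cder F z l -> cder G z m -> cder (fun w => Cplus (F w) (G w)) z (Cplus l m).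
Proof.
  intros HF HG eps Heps.
  destruct (HF (eps / 2) ltac:(lra)) as [d1 [Hd1 K1]].
  destruct (HG (eps / 2) ltac:(lra)) as [d2 [Hd2 K2]].
  exists (Rmin d1 d2); split; [apply Rmin_case; lra|]. intros h Hh.
  specialize (K1 h (Rlt_le_trans _ _ _ Hh (Rmin_l _ _))).
  specialize (K2 h (Rlt_le_trans _ _ _ Hh (Rmin_r _ _))).
  replace (Cminus _ _) with (Cplus (Cminus (F (Cplus z h)) (Cplus (F z) (Cmult l h)))
    (Cminus (G (Cplus z h)) (Cplus (G z) (Cmult m h)))) by ring.
  eapply Rle_trans; [apply Cmod_triangle|]. lra.
Qed.

Lemma cder_mult (F G : C -> C) (z l m : C) :
  cder F z l -> cder G z m ->
  cder (fun w => Cmult (F w) (G w)) z (Cplus (Cmult l (G z)) (Cmult (F z) m)).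
Proof.
  intros HF HG eps Heps.
  destruct (cder_lipschitz _ _ _ HF) as [d0 [Hd0 K0]].
  destruct (cder_lipschitz _ _ _ HG) as [d3 [Hd3 K3]].
  generalize (Cmod_ge_0 (F z)) (Cmod_ge_0 (G z)) (Cmod_ge_0 l) (Cmod_ge_0 m). intros P1 P2 P3 P4.
  destruct (HF (eps / 3 / (Cmod (G z) + 1))) as [d1 [Hd1 K1]].
  { apply Rdiv_lt_0_compat; lra. }
  destruct (HG (eps / 3 / (Cmod (F z) + 1))) as [d2 [Hd2 K2]].
  { apply Rdiv_lt_0_compat; lra. }
  set (q := eps / 3 / ((Cmod l + 1) * (Cmod m + 1))).
  assert (Hq : 0 < q) by (apply Rdiv_lt_0_compat; [lra|apply Rmult_lt_0_compat; lra]).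
  exists (Rmin (Rmin d0 d3) (Rmin (Rmin d1 d2) q)). split.
  { repeat apply Rmin_case; auto. }
  intros h Hh.
  assert (B0 : Cmod h < Rmin d0 d3) by (eapply Rlt_le_trans; [exact Hh|apply Rmin_l]).
  assert (B1 : Cmod h < Rmin (Rmin d1 d2) q) by (eapply Rlt_le_trans; [exact Hh|apply Rmin_r]).
  assert (B2 : Cmod h < q) by (eapply Rlt_le_trans; [exact B1|apply Rmin_r]).
  assert (B3 : Cmod h < Rmin d1 d2) by (eapply Rlt_le_trans; [exact B1|apply Rmin_l]).
  specialize (K0 h (Rlt_le_trans _ _ _ B0 (Rmin_l _ _))).
  specialize (K3 h (Rlt_le_trans _ _ _ B0 (Rmin_r _ _))).
  specialize (K1 h (Rlt_le_trans _ _ _ B3 (Rmin_l _ _))).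
  specialize (K2 h (Rlt_le_trans _ _ _ B3 (Rmin_r _ _))).
  generalize (Cmod_ge_0 h); intros Ph.
  replace (Cminus _ _) with (Cplus (Cplus
     (Cmult (Cminus (F (Cplus z h)) (Cplus (F z) (Cmult l h))) (G z))
     (Cmult (F z) (Cminus (G (Cplus z h)) (Cplus (G z) (Cmult m h)))))
     (Cmult (Cminus (F (Cplus z h)) (F z)) (Cminus (G (Cplus z h)) (G z)))) by ring.
  eapply Rle_trans; [apply Cmod_triangle|].
  eapply Rle_trans; [apply Rplus_le_compat_r, Cmod_triangle|]. rewrite !Cmod_mult.
  assert (E1 : Cmod (Cminus (F (Cplus z h)) (Cplus (F z) (Cmult l h))) * Cmod (G z) <= eps / 3 * Cmod h).
  { apply Rle_trans with (eps / 3 / (Cmod (G z) + 1) * Cmod h * (Cmod (G z) + 1)).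
    - apply Rmult_le_compat; try apply Cmod_ge_0; lra.
    - right; field; lra. }
  assert (E2 : Cmod (F z) * Cmod (Cminus (G (Cplus z h)) (Cplus (G z) (Cmult m h))) <= eps / 3 * Cmod h).
  { apply Rle_trans with ((Cmod (F z) + 1) * (eps / 3 / (Cmod (F z) + 1) * Cmod h)).
    - apply Rmult_le_compat; try apply Cmod_ge_0; lra.
    - right; field; lra. }
  assert (E3 : Cmod (Cminus (F (Cplus z h)) (F z)) * Cmod (Cminus (G (Cplus z h)) (G z)) <= eps / 3 * Cmod h).
  { apply Rle_trans with (((Cmod l + 1) * Cmod h) * ((Cmod m + 1) * Cmod h)).
    - apply Rmult_le_compat; try apply Cmod_ge_0; lra.
    - apply Rle_trans with (((Cmod l + 1) * (Cmod m + 1)) * q * Cmod h).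
      + replace (((Cmod l + 1) * Cmod h) * ((Cmod m + 1) * Cmod h)) with
          (((Cmod l + 1) * (Cmod m + 1)) * Cmod h * Cmod h) by ring.
        apply Rmult_le_compat_r; auto. apply Rmult_le_compat_l; [|lra].
        apply Rmult_le_pos; lra.
      + right; unfold q; field; lra. }
  lra.
Qed.

Lemma cder_comp (F G : C -> C) (z l m : C) :
  cder F (G z) l -> cder G z m -> cder (fun w => F (G w)) z (Cmult l m).
Proof.
  intros HF HG eps Heps.
  destruct (cder_lipschitz _ _ _ HG) as [d3 [Hd3 K3]].
  generalize (Cmod_ge_0 l) (Cmod_ge_0 m). intros P3 P4.
  destruct (HF (eps / 2 / (Cmod m + 1))) as [d1 [Hd1 K1]].
  { apply Rdiv_lt_0_compat; lra. }
  destruct (HG (eps / 2 / (Cmod l + 1))) as [d2 [Hd2 K2]].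
  { apply Rdiv_lt_0_compat; lra. }
  set (q := d1 / (Cmod m + 1)).
  assert (Hq : 0 < q) by (apply Rdiv_lt_0_compat; lra).
  exists (Rmin (Rmin d2 d3) q). split.
  { repeat apply Rmin_case; auto. }
  intros h Hh.
  assert (B0 : Cmod h < Rmin d2 d3) by (eapply Rlt_le_trans; [exact Hh|apply Rmin_l]).
  assert (B1 : Cmod h < q) by (eapply Rlt_le_trans; [exact Hh|apply Rmin_r]).
  specialize (K2 h (Rlt_le_trans _ _ _ B0 (Rmin_l _ _))).
  specialize (K3 h (Rlt_le_trans _ _ _ B0 (Rmin_r _ _))).
  generalize (Cmod_ge_0 h); intros Ph.
  set (k := Cminus (G (Cplus z h)) (G z)) in *.
  assert (Hk : Cmod k < d1).
  { eapply Rle_lt_trans; [exact K3|].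
    apply Rlt_le_trans with ((Cmod m + 1) * q); [apply Rmult_lt_compat_l; lra|].
    right; unfold q; field; lra. }
  specialize (K1 k Hk).
  replace (Cplus (G z) k) with (G (Cplus z h)) in K1 by (unfold k; ring).
  replace (Cminus _ _) with (Cplus (Cminus (F (G (Cplus z h))) (Cplus (F (G z)) (Cmult l k)))
    (Cmult l (Cminus (G (Cplus z h)) (Cplus (G z) (Cmult m h))))) by (unfold k; ring).
  eapply Rle_trans; [apply Cmod_triangle|]. rewrite Cmod_mult.
  assert (E1 : Cmod (Cminus (F (G (Cplus z h))) (Cplus (F (G z)) (Cmult l k))) <= eps / 2 * Cmod h).
  { eapply Rle_trans; [apply K1|].
    apply Rle_trans with (eps / 2 / (Cmod m + 1) * ((Cmod m + 1) * Cmod h)).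
    - apply Rmult_le_compat_l; auto. apply Rlt_le, Rdiv_lt_0_compat; lra.
    - right; field; lra. }
  assert (E2 : Cmod l * Cmod (Cminus (G (Cplus z h)) (Cplus (G z) (Cmult m h))) <= eps / 2 * Cmod h).
  { apply Rle_trans with ((Cmod l + 1) * (eps / 2 / (Cmod l + 1) * Cmod h)).
    - apply Rmult_le_compat; try apply Cmod_ge_0; lra.
    - right; field; lra. }
  lra.
Qed.

Lemma cder_cexp (z : C) : cder cexp z (cexp z).
Proof.
  intros eps Heps.
  assert (Hm : 0 < Cmod (cexp z)) by (rewrite Cmod_cexp; apply exp_pos).
  set (q := eps / (Cmod (cexp z) * exp 1)).
  assert (He : 0 < exp 1) by apply exp_pos.
  assert (Hq : 0 < q) by (apply Rdiv_lt_0_compat; auto; apply Rmult_lt_0_compat; auto).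
  exists (Rmin 1 q). split; [apply Rmin_case; lra|].
  intros h Hh.
  assert (B0 : Cmod h < 1) by (eapply Rlt_le_trans; [exact Hh|apply Rmin_l]).
  assert (B1 : Cmod h < q) by (eapply Rlt_le_trans; [exact Hh|apply Rmin_r]).
  generalize (Cmod_ge_0 h); intros Ph.
  rewrite cexp_plus.
  replace (Cminus _ _) with (Cmult (cexp z) (Cminus (Cminus (cexp h) 1) h)) by ring.
  rewrite Cmod_mult.
  apply Rle_trans with (Cmod (cexp z) * (Cmod h * q * exp 1)).
  - apply Rmult_le_compat_l; [lra|]. eapply Rle_trans; [apply cexp_taylor2|].
    apply Rmult_le_compat; [apply Rmult_le_pos; lra|apply Rlt_le, exp_pos| |].
    + apply Rmult_le_compat_l; lra.
    + apply exp_le_compat; lra.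
  - right. unfold q. field. split; lra.
Qed.

Lemma cder_inv (z : C) : z <> RtoC 0 -> cder Cinv z (Copp (Cinv (Cmult z z))).
Proof.
  intros Hz eps Heps.
  assert (Hm : 0 < Cmod z) by (apply Cmod_gt_0; auto).
  set (q := eps * (Cmod z * Cmod z * Cmod z) / 2).
  assert (Hq : 0 < q).
  { unfold q. apply Rdiv_lt_0_compat; [|lra]. repeat apply Rmult_lt_0_compat; auto. }
  exists (Rmin (Cmod z / 2) q). split; [apply Rmin_case; lra|].
  intros h Hh.
  assert (B0 : Cmod h < Cmod z / 2) by (eapply Rlt_le_trans; [exact Hh|apply Rmin_l]).
  assert (B1 : Cmod h < q) by (eapply Rlt_le_trans; [exact Hh|apply Rmin_r]).
  generalize (Cmod_ge_0 h); intros Ph.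
  assert (Hzh : Cmod z / 2 <= Cmod (Cplus z h)).
  { generalize (Cmod_minus_ge z (Copp h)). rewrite Cmod_opp.
    replace (Cminus z (Copp h)) with (Cplus z h) by ring. lra. }
  assert (Hzh0 : Cplus z h <> RtoC 0) by (apply Cmod_gt_0; lra).
  replace (Cminus _ _) with (Cmult (Cmult h h) (Cinv (Cmult (Cmult z z) (Cplus z h)))) by (field; auto).
  rewrite !Cmod_mult, Cmod_inv by (repeat apply Cmult_neq_0; auto).
  rewrite !Cmod_mult.
  apply Rle_trans with (Cmod h * q * / (Cmod z * Cmod z * (Cmod z / 2))).
  - apply Rmult_le_compat; [apply Rmult_le_pos; lra| | apply Rmult_le_compat_l; lra|].
    + apply Rlt_le, Rinv_0_lt_compat. repeat apply Rmult_lt_0_compat; lra.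
    + apply Rinv_le_contravar; [repeat apply Rmult_lt_0_compat; lra|].
      apply Rmult_le_compat_l; [apply Rmult_le_pos; lra|exact Hzh].
  - right; unfold q; field; lra.
Qed.

Lemma cdiff_const (c z : C) : cdiff (fun _ => c) z.
Proof. eexists; apply cder_const. Qed.

Lemma cdiff_id (z : C) : cdiff (fun w => w) z.
Proof. eexists; apply cder_id. Qed.

Lemma cdiff_plus (F G : C -> C) (z : C) :
  cdiff F z -> cdiff G z -> cdiff (fun w => Cplus (F w) (G w)) z.
Proof. intros [l H] [m K]. eexists; apply cder_plus; eassumption. Qed.

Lemma cdiff_mult (F G : C -> C) (z : C) :
  cdiff F z -> cdiff G z -> cdiff (fun w => Cmult (F w) (G w)) z.
Proof. intros [l H] [m K]. eexists; apply cder_mult; eassumption. Qed.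

Lemma cdiff_comp (F G : C -> C) (z : C) :
  cdiff F (G z) -> cdiff G z -> cdiff (fun w => F (G w)) z.
Proof. intros [l H] [m K]. eexists; apply cder_comp; eassumption. Qed.

Lemma cdiff_ext (F G : C -> C) (z : C) : (forall w, F w = G w) -> cdiff F z -> cdiff G z.
Proof.
  intros E [l H]. exists l. intros eps Heps. destruct (H eps Heps) as [d [Hd K]].
  exists d; split; auto. intros h Hh. rewrite <- !E. auto.
Qed.

Lemma cdiff_minus (F G : C -> C) (z : C) :
  cdiff F z -> cdiff G z -> cdiff (fun w => Cminus (F w) (G w)) z.
Proof.
  intros H K. apply cdiff_ext with (fun w => Cplus (F w) (Cmult (RtoC (-1)) (G w))).
  - intros w. apply C_ext; simpl; ring.
  - apply cdiff_plus; auto. apply cdiff_mult; auto. apply cdiff_const.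
Qed.

Lemma cdiff_cexp (F : C -> C) (z : C) : cdiff F z -> cdiff (fun w => cexp (F w)) z.
Proof. intros H. apply (cdiff_comp cexp F); auto. eexists; apply cder_cexp. Qed.

Lemma cdiff_inv (F : C -> C) (z : C) : F z <> RtoC 0 -> cdiff F z -> cdiff (fun w => Cinv (F w)) z.
Proof. intros H0 H. apply (cdiff_comp Cinv F); auto. eexists; apply cder_inv; auto. Qed.

Lemma ccont_path (F : C -> C) (g : R -> C) (x : R) :
  ccont F (g x) -> rcont g x -> rcont (fun t => F (g t)) x.
Proof.
  intros HF [G1 G2].
  assert (K : forall eps : posreal, locally x (fun t => Cmod (Cminus (F (g t)) (F (g x))) < eps)).
  { intros eps. destruct (HF eps (cond_pos eps)) as [d [Hd K]].
    assert (Hd2 : 0 < d / 2) by lra.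
    generalize (proj1 (filterlim_locally _ _) G1 (mkposreal _ Hd2)).
    generalize (proj1 (filterlim_locally _ _) G2 (mkposreal _ Hd2)).
    intros L2 L1. generalize (filter_and _ _ L1 L2). apply filter_imp.
    intros t [A1 A2].
    replace (F (g t)) with (F (Cplus (g x) (Cminus (g t) (g x)))) by (f_equal; ring).
    apply K. eapply Rle_lt_trans; [apply Cmod_le_Re_Im|].
    rewrite Re_minus, Im_minus.
    unfold ball in A1, A2; simpl in A1, A2. unfold AbsRing_ball, abs, minus, plus, opp in A1, A2; simpl in A1, A2.
    unfold Rminus. lra. }
  split; apply filterlim_locally; intros eps; generalize (K eps); apply filter_imp; intros t Ht;
  unfold ball; simpl; unfold AbsRing_ball, abs, minus, plus, opp; simpl.
  - change (Rabs (Re (F (g t)) - Re (F (g x))) < eps). rewrite <- Re_minus.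
    eapply Rle_lt_trans; [apply re_le_Cmod | exact Ht].
  - change (Rabs (Im (F (g t)) - Im (F (g x))) < eps). rewrite <- Im_minus.
    eapply Rle_lt_trans; [apply im_le_Cmod | exact Ht].
Qed.

(** * Goursat's theorem and the mean value property *)

Definition CInt (g : R -> C) (a b : R) : C :=
  (RInt (fun t => Re (g t)) a b, RInt (fun t => Im (g t)) a b).

Definition rcont_on (g : R -> C) (a b : R) : Prop := forall x, a <= x <= b -> rcont g x.

Lemma rcont_on_ex_RInt (g : R -> C) (a b : R) : a <= b -> rcont_on g a b ->
  ex_RInt (fun t => Re (g t)) a b /\ ex_RInt (fun t => Im (g t)) a b.
Proof.
  intros Hab H; split; apply (ex_RInt_continuous (V := R_CompleteNormedModule)); intros x;
  rewrite Rmin_left, Rmax_right by lra; intros Hx; apply (H x Hx).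
Qed.

Lemma CInt_Chasles (g : R -> C) (a b c : R) : a <= b -> b <= c -> rcont_on g a c ->
  Cplus (CInt g a b) (CInt g b c) = CInt g a c.
Proof.
  intros Hab Hbc H.
  destruct (rcont_on_ex_RInt g a b Hab) as [A1 A2]; [intros x Hx; apply H; lra|].
  destruct (rcont_on_ex_RInt g b c Hbc) as [B1 B2]; [intros x Hx; apply H; lra|].
  apply C_ext; simpl.
  - apply (RInt_Chasles (V := R_CompleteNormedModule) (fun t => Re (g t))); assumption.
  - apply (RInt_Chasles (V := R_CompleteNormedModule) (fun t => Im (g t))); assumption.
Qed.

Lemma CInt_minus (f g : R -> C) (a b : R) : a <= b -> rcont_on f a b -> rcont_on g a b ->
  CInt (fun t => Cminus (f t) (g t)) a b = Cminus (CInt f a b) (CInt g a b).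
Proof.
  intros Hab Hf Hg.
  destruct (rcont_on_ex_RInt f a b Hab Hf) as [A1 A2].
  destruct (rcont_on_ex_RInt g a b Hab Hg) as [B1 B2].
  apply C_ext; rewrite ?Re_minus, ?Im_minus; simpl.
  - rewrite <- (RInt_minus (V := R_CompleteNormedModule) (fun t => Re (f t)) (fun t => Re (g t)))
      by assumption.
    apply RInt_ext; intros x _; unfold minus, plus, opp; simpl; reflexivity.
  - rewrite <- (RInt_minus (V := R_CompleteNormedModule) (fun t => Im (f t)) (fun t => Im (g t)))
      by assumption.
    apply RInt_ext; intros x _; unfold minus, plus, opp; simpl; reflexivity.
Qed.

Lemma CInt_const (c : C) (a b : R) : CInt (fun _ => c) a b = Cmult c (RtoC (b - a)).
Proof.
  apply C_ext; simpl; rewrite RInt_const; unfold scal; simpl; unfold mult; simpl; unfold Re, Im; ring.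
Qed.

(** The integrand is projected on the direction of the integral, as in [mean_value_ineq]. Estimating
    real and imaginary parts separately would cost a factor, and [circle_max] needs the constant
    1. *)
Lemma CInt_bound (g : R -> C) (a b K : R) : a <= b -> rcont_on g a b ->
  (forall x, a <= x <= b -> Cmod (g x) <= K) -> Cmod (CInt g a b) <= K * (b - a).
Proof.
  intros Hab Hg HK.
  destruct (rcont_on_ex_RInt g a b Hab Hg) as [A1 A2].
  set (u := CInt g a b).
  assert (E : Cmod u * Cmod u <= Cmod u * K * (b - a)).
  { rewrite Cmod_sqr. unfold u at 2 4. unfold CInt. cbn [Re Im fst snd].
    rewrite <- (RInt_scal (V := R_CompleteNormedModule) (fun t => Re (g t))) by assumption.
    rewrite <- (RInt_scal (V := R_CompleteNormedModule) (fun t => Im (g t))) by assumption.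
    rewrite <- (RInt_plus (V := R_CompleteNormedModule)
       (fun t => scal (Re u) (Re (g t))) (fun t => scal (Im u) (Im (g t)))).
    2,3: apply (ex_RInt_scal (V := R_CompleteNormedModule)); assumption.
    replace (Cmod u * K * (b - a)) with (RInt (fun _ => Cmod u * K) a b).
    2:{ rewrite RInt_const. unfold scal; simpl; unfold mult; simpl. ring. }
    apply RInt_le; auto.
    - apply (ex_RInt_plus (V := R_CompleteNormedModule));
      apply (ex_RInt_scal (V := R_CompleteNormedModule)); assumption.
    - apply ex_RInt_const.
    - intros x Hx. unfold plus, scal; simpl; unfold mult; simpl.
      eapply Rle_trans; [apply Rle_abs|]. eapply Rle_trans; [apply (dot_le_Cmod u (g x))|].
      apply Rmult_le_compat_l; [apply Cmod_ge_0|apply HK; lra]. }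
  destruct (Cmod_ge_0 u) as [H|H].
  - apply Rmult_le_reg_l with (Cmod u); auto. lra.
  - rewrite <- H. apply Rmult_le_pos; [|lra].
    eapply Rle_trans; [apply Cmod_ge_0|apply (HK a); lra].
Qed.

Lemma CInt_derive (F g : R -> C) (a b : R) : a <= b ->
  (forall x, a <= x <= b -> rder F x (g x)) -> rcont_on g a b ->
  CInt g a b = Cminus (F b) (F a).
Proof.
  intros Hab HF Hg.
  apply C_ext; rewrite ?Re_minus, ?Im_minus; simpl; apply is_RInt_unique.
  - apply (is_RInt_derive (V := R_CompleteNormedModule) (fun t => Re (F t)) (fun t => Re (g t)));
    rewrite Rmin_left, Rmax_right by lra; intros x Hx; [apply HF|apply Hg]; auto.
  - apply (is_RInt_derive (V := R_CompleteNormedModule) (fun t => Im (F t)) (fun t => Im (g t)));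
    rewrite Rmin_left, Rmax_right by lra; intros x Hx; [apply HF|apply Hg]; auto.
Qed.

(** * Bisection of rectangles and Goursat's theorem *)

(** The fourth quarter is returned untested: when the other three have the property and the whole
    has not, [splittable] forces it to fail. *)
Definition bad_half (P : R -> R -> R -> R -> Prop) (r : (R * R) * (R * R)) : (R * R) * (R * R) :=
  let a := fst (fst r) in let b := snd (fst r) in
  let c := fst (snd r) in let d := snd (snd r) in
  let m := (a + b) / 2 in let n := (c + d) / 2 in
  if excluded_middle_informative (P a m c n) then
    if excluded_middle_informative (P m b c n) then
      if excluded_middle_informative (P a m n d) then ((m, b), (n, d))
      else ((a, m), (n, d))
    else ((m, b), (c, n))
  else ((a, m), (c, n)).

Definition on_rect (P : R -> R -> R -> R -> Prop) (r : (R * R) * (R * R)) : Prop :=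
  P (fst (fst r)) (snd (fst r)) (fst (snd r)) (snd (snd r)).

Definition rect_wf : (R * R) * (R * R) -> Prop := on_rect (fun a b c d => a <= b /\ c <= d).

Definition splittable (P : R -> R -> R -> R -> Prop) : Prop :=
  forall a b c d, a <= b -> c <= d ->
  P a ((a + b) / 2) c ((c + d) / 2) -> P ((a + b) / 2) b c ((c + d) / 2) ->
  P a ((a + b) / 2) ((c + d) / 2) d -> P ((a + b) / 2) b ((c + d) / 2) d -> P a b c d.

Lemma bad_half_spec (P : R -> R -> R -> R -> Prop) (r : (R * R) * (R * R)) :
  splittable P -> rect_wf r -> ~ on_rect P r ->
  rect_wf (bad_half P r) /\ ~ on_rect P (bad_half P r) /\
  fst (fst r) <= fst (fst (bad_half P r)) /\ snd (fst (bad_half P r)) <= snd (fst r) /\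
  fst (snd r) <= fst (snd (bad_half P r)) /\ snd (snd (bad_half P r)) <= snd (snd r) /\
  snd (fst (bad_half P r)) - fst (fst (bad_half P r)) = (snd (fst r) - fst (fst r)) / 2 /\
  snd (snd (bad_half P r)) - fst (snd (bad_half P r)) = (snd (snd r) - fst (snd r)) / 2.
Proof.
  intros HS. destruct r as [[a b] [c d]]. unfold rect_wf, on_rect, bad_half. cbn [fst snd]. intros [H1 H2] HP.
  destruct (excluded_middle_informative _) as [Q1|Q1];
    [destruct (excluded_middle_informative _) as [Q2|Q2];
      [destruct (excluded_middle_informative _) as [Q3|Q3]|]|]; cbn [fst snd];
  (split; [lra|split; [|lra]]); auto.
Qed.

(** A compactness argument: otherwise failing quarters nest around a point [(x, y)], and the local
    hypothesis at this point contradicts the failure of a small enough one. It serves twice, for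
    Goursat's theorem and for the boundedness of continuous functions. *)
Lemma rectangle_induction (P : R -> R -> R -> R -> Prop) (a b c d : R) : splittable P -> a <= b -> c <= d ->
  (forall x y, a <= x <= b -> c <= y <= d -> exists delta, 0 < delta /\
     forall a' b' c' d', a <= a' -> a' <= x <= b' -> b' <= b -> c <= c' -> c' <= y <= d' -> d' <= d ->
       b' - a' < delta -> d' - c' < delta -> P a' b' c' d') ->
  P a b c d.
Proof.
  intros HS Hab Hcd Hloc. apply NNPP. intros HP.
  set (q := fix q (n : nat) : (R * R) * (R * R) := match n with O => ((a, b), (c, d)) | S n => bad_half P (q n) end).
  assert (Hq : forall n, rect_wf (q n) /\ ~ on_rect P (q n)).
  { induction n as [|n [I1 I2]]; [split; [split; assumption|exact HP]|].
    destruct (bad_half_spec P (q n) HS I1 I2) as [J1 [J2 _]]. split; assumption. }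
  assert (Hm : forall n m, fst (fst (q n)) <= fst (fst (q (n + m)%nat)) /\
     snd (fst (q (n + m)%nat)) <= snd (fst (q n)) /\
     fst (snd (q n)) <= fst (snd (q (n + m)%nat)) /\
     snd (snd (q (n + m)%nat)) <= snd (snd (q n))).
  { intros n. induction m as [|m IH].
    - rewrite Nat.add_0_r. lra.
    - rewrite Nat.add_succ_r. cbn [q].
      destruct (Hq (n + m)%nat) as [I1 I2].
      generalize (bad_half_spec P (q (n + m)%nat) HS I1 I2). lra. }
  assert (Hl : forall n, snd (fst (q n)) - fst (fst (q n)) = (b - a) / 2 ^ n /\
     snd (snd (q n)) - fst (snd (q n)) = (d - c) / 2 ^ n).
  { induction n as [|n [IH1 IH2]]; [simpl; lra|].
    destruct (Hq n) as [I1 I2]. cbn [q].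
    destruct (bad_half_spec P (q n) HS I1 I2) as (_ & _ & _ & _ & _ & _ & E1 & E2).
    rewrite E1, E2, IH1, IH2. simpl.
    assert (0 < 2 ^ n) by (apply pow_lt; lra). split; field; lra. }
  assert (Hx : forall n m, fst (fst (q n)) <= snd (fst (q m)) /\ fst (snd (q n)) <= snd (snd (q m))).
  { intros n m. generalize (Hm n m) (Hm m n). rewrite (Nat.add_comm m n).
    destruct (Hq (n + m)%nat) as [[I1 I2] _]. lra. }
  assert (Hlim : forall (u v : nat -> R), (forall n m, u n <= v m) ->
     exists x, forall n, u n <= x <= v n).
  { intros u v Huv.
    destruct (completeness (fun z => exists n, z = u n)) as [x [X1 X2]].
    - exists (v O). intros z [n ->]. apply Huv.
    - exists (u O), O; auto.
    - exists x. intros n; split; [apply X1; exists n; auto|].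
      apply X2. intros z [k ->]. apply Huv. }
  destruct (Hlim (fun n => fst (fst (q n))) (fun n => snd (fst (q n)))) as [x X];
    [intros; apply Hx|].
  destruct (Hlim (fun n => fst (snd (q n))) (fun n => snd (snd (q n)))) as [y Y];
    [intros; apply Hx|].
  destruct (Hloc x y (X O) (Y O)) as [delta [Hd K]].
  destruct (pow_lt_1_zero (/ 2) ltac:(rewrite Rabs_right; lra)
    (delta / ((b - a) + (d - c) + 1))) as [N HN].
  { apply Rdiv_lt_0_compat; lra. }
  specialize (HN N (le_n N)). rewrite Rabs_right in HN by (apply Rle_ge, pow_le; lra).
  assert (H2 : (b - a) / 2 ^ N < delta /\ (d - c) / 2 ^ N < delta).
  { unfold Rdiv. rewrite <- !pow_inv.
    assert (H3 : 0 < (/ 2) ^ N) by (apply pow_lt; lra).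
    assert (H4 : ((b - a) + (d - c) + 1) * (/ 2) ^ N < delta).
    { apply Rlt_le_trans with (((b - a) + (d - c) + 1) * (delta / ((b - a) + (d - c) + 1))).
      - apply Rmult_lt_compat_l; lra.
      - right; field; lra. }
    split; nra. }
  destruct (Hq N) as [_ HN2]. apply HN2. unfold on_rect.
  generalize (Hm O N) (Hl N). cbn [Nat.add]. intros M [L1 L2].
  apply K; try apply X; try apply Y; try (rewrite L1); try (rewrite L2); try apply H2; apply M.
Qed.

Definition rect_int (f : C -> C) (a b c d : R) : C :=
  Cminus (Cplus (CInt (fun x => f (x, c)) a b) (CInt (fun y => Cmult Ci (f (b, y))) c d))
    (Cplus (CInt (fun x => f (x, d)) a b) (CInt (fun y => Cmult Ci (f (a, y))) c d)).

Lemma rder_horizontal (c x : R) : rder (fun t => (t, c) : C) x (RtoC 1).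
Proof. split; simpl; [apply @is_derive_id | apply @is_derive_const]. Qed.

Lemma rder_vertical (c y : R) : rder (fun t => (c, t) : C) y Ci.
Proof. split; simpl; [apply @is_derive_const | apply @is_derive_id]. Qed.

Lemma rcont_Ci (g : R -> C) (x : R) : rcont g x -> rcont (fun t => Cmult Ci (g t)) x.
Proof.
  intros [G1 G2]; split.
  - apply continuous_ext with (fun t => opp (Im (g t))).
    { intros t; simpl. unfold opp; simpl. unfold Im; ring. }
    apply @continuous_opp; exact G2.
  - apply continuous_ext with (fun t => Re (g t)); [|exact G1].
    intros t; simpl. unfold Re; ring.
Qed.

Lemma rcont_horizontal (f : C -> C) (x c : R) : ccont f (x, c) -> rcont (fun t => f (t, c)) x.
Proof.
  intros H. apply (ccont_path f (fun t => (t, c))); auto.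
  eapply rder_rcont, rder_horizontal.
Qed.

Lemma rcont_vertical (f : C -> C) (b y : R) : ccont f (b, y) -> rcont (fun t => f (b, t)) y.
Proof.
  intros H. apply (ccont_path f (fun t => (b, t))); auto.
  eapply rder_rcont, rder_vertical.
Qed.

Definition ccont_rect (f : C -> C) (a b c d : R) : Prop :=
  forall x y, a <= x <= b -> c <= y <= d -> ccont f (x, y).

Ltac rect_cont H :=
  let t := fresh in let Ht := fresh in
  intros t Ht; try apply rcont_Ci; first [apply rcont_horizontal | apply rcont_vertical]; apply H; lra.

Lemma rect_int_minus (f g : C -> C) (a b c d : R) : a <= b -> c <= d ->
  ccont_rect f a b c d -> ccont_rect g a b c d ->
  rect_int (fun z => Cminus (f z) (g z)) a b c d = Cminus (rect_int f a b c d) (rect_int g a b c d).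
Proof.
  intros Hab Hcd Hf Hg. unfold rect_int.
  rewrite !(CInt_minus (fun x => f (x, _)) (fun x => g (x, _)));
    try assumption; try (rect_cont Hf); try (rect_cont Hg).
  assert (E : forall u, a <= u <= b -> CInt (fun y => Cmult Ci (Cminus (f (u, y)) (g (u, y)))) c d =
     Cminus (CInt (fun y => Cmult Ci (f (u, y))) c d) (CInt (fun y => Cmult Ci (g (u, y))) c d)).
  { intros u Hu. rewrite <- CInt_minus; try assumption; try (rect_cont Hf); try (rect_cont Hg).
    unfold CInt. f_equal; apply RInt_ext; intros y _; [apply (f_equal Re)|apply (f_equal Im)]; ring. }
  rewrite !E by lra. ring.
Qed.

Lemma rect_int_bound (f : C -> C) (a b c d K : R) : a <= b -> c <= d ->
  ccont_rect f a b c d ->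
  (forall x y, a <= x <= b -> c <= y <= d -> Cmod (f (x, y)) <= K) ->
  Cmod (rect_int f a b c d) <= 2 * K * ((b - a) + (d - c)).
Proof.
  intros Hab Hcd Hf HK. unfold rect_int.
  eapply Rle_trans; [apply Cmod_minus_le|].
  assert (H1 : forall y, c <= y <= d -> Cmod (CInt (fun x => f (x, y)) a b) <= K * (b - a)).
  { intros y Hy. apply CInt_bound; [assumption|rect_cont Hf|]. intros; apply HK; lra. }
  assert (H2 : forall x, a <= x <= b -> Cmod (CInt (fun y => Cmult Ci (f (x, y))) c d) <= K * (d - c)).
  { intros x Hx. apply CInt_bound; [assumption|rect_cont Hf|].
    intros; rewrite Cmod_mult, Cmod_Ci, Rmult_1_l. apply HK; lra. }
  generalize (Cmod_triangle (CInt (fun x => f (x, c)) a b) (CInt (fun y => Cmult Ci (f (b, y))) c d)).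
  generalize (Cmod_triangle (CInt (fun x => f (x, d)) a b) (CInt (fun y => Cmult Ci (f (a, y))) c d)).
  generalize (H1 c ltac:(lra)) (H1 d ltac:(lra)) (H2 a ltac:(lra)) (H2 b ltac:(lra)). lra.
Qed.

(** The quadratic polynomial [F] is a primitive, so that each side contributes a difference of
    values of [F] at corners and the four differences cancel. *)
Lemma rect_int_affine (l m : C) (a b c d : R) : a <= b -> c <= d ->
  rect_int (fun z => Cplus m (Cmult l z)) a b c d = RtoC 0.
Proof.
  intros Hab Hcd.
  set (p := fun z => Cplus m (Cmult l z)).
  set (F := fun z : C => Cplus (Cmult m z) (Cmult (Cmult l (RtoC (/ 2))) (Cmult z z))).
  assert (Hp : forall z, ccont p z).
  { intros z. apply cdiff_ccont. unfold p. apply cdiff_plus; [apply cdiff_const|].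
    apply cdiff_mult; [apply cdiff_const|apply cdiff_id]. }
  assert (HF : forall g x g', rder g x g' -> rder (fun t => F (g t)) x (Cmult g' (p (g x)))).
  { intros g x g' Hg.
    replace (Cmult g' (p (g x))) with (Cplus (Cmult m g') (Cmult (Cmult l (RtoC (/ 2)))
      (Cplus (Cmult g' (g x)) (Cmult (g x) g')))).
    - unfold F. apply rder_plus; [apply rder_scal; auto|].
      apply rder_scal. apply rder_mult; auto.
    - unfold p. replace (RtoC (/ 2)) with (Cinv (RtoC 2)).
      + field.
      + rewrite RtoC_inv; auto. }
  unfold rect_int.
  rewrite (CInt_derive (fun x => F (x, c)) (fun x => p (x, c)));
    [|assumption| |intros x _; apply rcont_horizontal, Hp].
  2:{ intros x _. replace (p (x, c)) with (Cmult (RtoC 1) (p (x, c))) by ring.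
      apply (HF (fun t => (t, c))). apply rder_horizontal. }
  rewrite (CInt_derive (fun x => F (x, d)) (fun x => p (x, d)));
    [|assumption| |intros x _; apply rcont_horizontal, Hp].
  2:{ intros x _. replace (p (x, d)) with (Cmult (RtoC 1) (p (x, d))) by ring.
      apply (HF (fun t => (t, d))). apply rder_horizontal. }
  rewrite (CInt_derive (fun x => F (a, x)) (fun x => Cmult Ci (p (a, x))));
    [|assumption| |intros x _; apply rcont_Ci, rcont_vertical, Hp].
  2:{ intros x _. apply (HF (fun t => (a, t))). apply rder_vertical. }
  rewrite (CInt_derive (fun x => F (b, x)) (fun x => Cmult Ci (p (b, x))));
    [|assumption| |intros x _; apply rcont_Ci, rcont_vertical, Hp].
  2:{ intros x _. apply (HF (fun t => (b, t))). apply rder_vertical. }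
  ring.
Qed.

Lemma rect_int_split (f : C -> C) (a m b c n d : R) : a <= m <= b -> c <= n <= d ->
  ccont_rect f a b c d ->
  rect_int f a b c d = Cplus (Cplus (rect_int f a m c n) (rect_int f m b c n))
    (Cplus (rect_int f a m n d) (rect_int f m b n d)).
Proof.
  intros Hm Hn Hf. unfold rect_int.
  rewrite <- (CInt_Chasles (fun x => f (x, c)) a m b); try lra; try (rect_cont Hf).
  rewrite <- (CInt_Chasles (fun x => f (x, d)) a m b); try lra; try (rect_cont Hf).
  rewrite <- (CInt_Chasles (fun y => Cmult Ci (f (a, y))) c n d); try lra; try (rect_cont Hf).
  rewrite <- (CInt_Chasles (fun y => Cmult Ci (f (b, y))) c n d); try lra; try (rect_cont Hf).
  ring.
Qed.

(** Near each point [f] is affine up to a small multiple of the distance; the affine part integrates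
    to 0, and what remains is a small multiple of the squared size. Measuring size by
    [(b - a)^2 + (d - c)^2] makes the bound exactly additive under quartering, so it passes from
    small rectangles to the whole one. *)
Lemma goursat (f : C -> C) (a b c d : R) : a <= b -> c <= d ->
  (forall x y, a <= x <= b -> c <= y <= d -> cdiff f (x, y)) ->
  rect_int f a b c d = RtoC 0.
Proof.
  intros Hab Hcd Hf.
  assert (Hc : ccont_rect f a b c d) by (intros x y Hx Hy; apply cdiff_ccont, Hf; auto).
  assert (Heps : forall eps, 0 < eps ->
    Cmod (rect_int f a b c d) <= eps * ((b - a) * (b - a) + (d - c) * (d - c))).
  { intros eps Heps.
    apply (rectangle_induction (fun a' b' c' d' => a <= a' -> b' <= b -> c <= c' -> d' <= d ->
      Cmod (rect_int f a' b' c' d') <= eps * ((b' - a') * (b' - a') + (d' - c') * (d' - c')))); try lra.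
    - intros a' b' c' d' H1 H2 Q1 Q2 Q3 Q4 A1 A2 A3 A4.
      rewrite (rect_int_split f a' ((a' + b') / 2) b' c' ((c' + d') / 2) d'); try lra.
      2:{ intros x y Hx Hy; apply Hc; lra. }
      specialize (Q1 ltac:(lra) ltac:(lra) ltac:(lra) ltac:(lra)).
      specialize (Q2 ltac:(lra) ltac:(lra) ltac:(lra) ltac:(lra)).
      specialize (Q3 ltac:(lra) ltac:(lra) ltac:(lra) ltac:(lra)).
      specialize (Q4 ltac:(lra) ltac:(lra) ltac:(lra) ltac:(lra)).
      eapply Rle_trans; [apply Cmod_triangle|].
      eapply Rle_trans; [apply Rplus_le_compat; apply Cmod_triangle|].
      eapply Rle_trans; [apply Rplus_le_compat; apply Rplus_le_compat; eassumption|].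
      right; field.
    - intros x y Hx Hy. destruct (Hf x y Hx Hy) as [l Hl].
      destruct (Hl (eps / 4) ltac:(lra)) as [delta [Hd K]].
      exists (delta / 2). split; [lra|].
      intros a' b' c' d' A1 A2 A3 A4 A5 A6 A7 A8 _ _ _ _.
      set (p := fun z => Cplus (Cminus (f (x, y)) (Cmult l (x, y))) (Cmult l z)).
      assert (Hp : forall z, ccont p z).
      { intros z. apply cdiff_ccont. unfold p. apply cdiff_plus; [apply cdiff_const|].
        apply cdiff_mult; [apply cdiff_const|apply cdiff_id]. }
      assert (Hc' : ccont_rect f a' b' c' d') by (intros u v Hu Hv; apply Hc; lra).
      assert (E : rect_int f a' b' c' d' = rect_int (fun z => Cminus (f z) (p z)) a' b' c' d').
      { rewrite rect_int_minus; try lra; auto; [|intros u v _ _; apply Hp].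
        unfold p at 1. rewrite rect_int_affine by lra. ring. }
      rewrite E.
      (* With side lengths [w] and [v], the remainder is at most [eps / 4 * (w + v)] on a perimeter
         [2 * (w + v)], and [(w + v)^2 <= 2 * (w^2 + v^2)]. *)
      eapply Rle_trans; [apply rect_int_bound with (K := eps / 4 * ((b' - a') + (d' - c')))|]; try lra.
      + intros u v Hu Hv. apply cdiff_ccont. apply cdiff_minus.
        * apply Hf; lra.
        * unfold p. apply cdiff_plus; [apply cdiff_const|].
          apply cdiff_mult; [apply cdiff_const|apply cdiff_id].
      + intros u v Hu Hv.
        set (h := (u - x, v - y) : C).
        assert (Hh : Cmod h <= (b' - a') + (d' - c')).
        { eapply Rle_trans; [apply Cmod_le_Re_Im|]. simpl.
          apply Rplus_le_compat; apply Rabs_le; lra. }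
        specialize (K h ltac:(lra)).
        replace (Cplus (x, y) h) with ((u, v) : C) in K by (apply C_ext; simpl; ring).
        replace (Cminus (f (u, v)) (p (u, v))) with (Cminus (f (u, v)) (Cplus (f (x, y)) (Cmult l h))).
        2:{ unfold p, h. replace ((u - x, v - y) : C) with (Cminus (u, v) (x, y)) by (apply C_ext; simpl; ring).
            ring. }
        eapply Rle_trans; [exact K|]. apply Rmult_le_compat_l; lra.
      + assert (0 <= ((b' - a') - (d' - c')) * ((b' - a') - (d' - c'))) by apply Rle_0_sqr.
        replace (2 * (eps / 4 * (b' - a' + (d' - c'))) * (b' - a' + (d' - c'))) with
          (eps * ((b' - a' + (d' - c')) * (b' - a' + (d' - c')) / 2)) by field.
        apply Rmult_le_compat_l; nra. }
  apply Cmod_eq_0.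
  set (S := (b - a) * (b - a) + (d - c) * (d - c)) in *.
  assert (HS : 0 <= S) by (unfold S; nra).
  apply Rle_antisym; [|apply Cmod_ge_0].
  apply Rle_plus_epsilon. intros e He.
  eapply Rle_trans; [apply (Heps (e / (S + 1)))|].
  - apply Rdiv_lt_0_compat; lra.
  - rewrite Rplus_0_l. apply Rle_trans with (e / (S + 1) * (S + 1)).
    + apply Rmult_le_compat_l; [|lra]. apply Rlt_le, Rdiv_lt_0_compat; lra.
    + right; field; lra.
Qed.

(* Goursat's theorem for [f (z + exp ζ)] on [x0, ln r] x [0, 2π]: the horizontal sides
   cancel by periodicity, so circular means do not depend on the radius. *)
Lemma circle_max (f : C -> C) (z : C) (r K : R) : 0 < r ->
  (forall w, Cmod (Cminus w z) <= r -> cdiff f w) ->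
  (forall w, Cmod (Cminus w z) = r -> Cmod (f w) <= K) ->
  Cmod (f z) <= K.
Proof.
  intros Hr Hf HK.
  set (g := fun zeta => f (Cplus z (cexp zeta))).
  assert (Hpi : 0 < 2 * PI) by (generalize PI_RGT_0; lra).
  assert (Hg : forall x y, x <= ln r -> cdiff g (x, y)).
  { intros x y Hx. unfold g. apply (cdiff_comp f (fun w => Cplus z (cexp w))).
    - apply Hf. replace (Cminus _ z) with (cexp (x, y)) by ring.
      rewrite Cmod_cexp. simpl. rewrite <- (exp_ln r Hr). apply exp_le_compat, Hx.
    - apply cdiff_plus; [apply cdiff_const|]. apply cdiff_cexp, cdiff_id. }
  apply Rle_plus_epsilon. intros eps Heps.
  destruct (cdiff_ccont f z) with (eps := eps) as [delta [Hd Kd]]; auto.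
  { apply Hf. replace (Cminus z z) with (RtoC 0) by ring. rewrite Cmod_0; lra. }
  (* The inner circle has radius [exp x0 < delta], so on it [f] is within [eps] of [f z]: its mean
     replaces the value at the centre, which [z + exp] does not attain. *)
  set (x0 := Rmin (ln r) (ln (delta / 2))).
  assert (H0 : x0 <= ln r) by apply Rmin_l.
  assert (H1 : exp x0 < delta).
  { apply Rle_lt_trans with (exp (ln (delta / 2))); [apply exp_le_compat, Rmin_r|].
    rewrite exp_ln; lra. }
  assert (E := goursat g x0 (ln r) 0 (2 * PI) H0 ltac:(lra)).
  specialize (E ltac:(intros x y Hx _; apply Hg; lra)).
  unfold rect_int in E.
  replace (CInt (fun x => g (x, 2 * PI)) x0 (ln r)) with (CInt (fun x => g (x, 0)) x0 (ln r)) in E.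
  2:{ unfold CInt. f_equal; apply RInt_ext; intros x _; f_equal; unfold g, cexp; simpl;
      rewrite cos_2PI, sin_2PI, cos_0, sin_0; reflexivity. }
  set (I1 := CInt (fun y => Cmult Ci (g (ln r, y))) 0 (2 * PI)) in *.
  set (I0 := CInt (fun y => Cmult Ci (g (x0, y))) 0 (2 * PI)) in *.
  assert (E1 : I1 = I0).
  { replace I1 with (Cplus (Cminus (Cplus (CInt (fun x => g (x, 0)) x0 (ln r)) I1)
      (Cplus (CInt (fun x => g (x, 0)) x0 (ln r)) I0)) I0) by ring. rewrite E. ring. }
  assert (Hcont : forall x, x <= ln r -> rcont_on (fun y => Cmult Ci (g (x, y))) 0 (2 * PI)).
  { intros x Hx y _. apply rcont_Ci, rcont_vertical, cdiff_ccont, Hg, Hx. }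
  assert (B1 : Cmod I1 <= K * (2 * PI - 0)).
  { apply CInt_bound; [lra|apply Hcont; lra|]. intros y _.
    rewrite Cmod_mult, Cmod_Ci, Rmult_1_l. apply HK.
    replace (Cminus _ z) with (cexp (ln r, y)) by ring. rewrite Cmod_cexp. simpl. apply exp_ln, Hr. }
  assert (B0 : Cmod (Cminus I0 (Cmult (Cmult Ci (f z)) (RtoC (2 * PI - 0)))) <= eps * (2 * PI - 0)).
  { rewrite <- CInt_const. unfold I0.
    rewrite <- CInt_minus; [|lra|apply Hcont, H0|intros y _; eapply rder_rcont, rder_const].
    apply CInt_bound; [lra| |].
    - intros y _. apply (ccont_path (fun w => Cminus (Cmult Ci (g w)) (Cmult Ci (f z))) (fun t => (x0, t))).
      + apply cdiff_ccont. apply cdiff_minus; [|apply cdiff_const].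
        apply cdiff_mult; [apply cdiff_const|apply Hg, H0].
      + eapply rder_rcont, rder_vertical.
    - intros y _. replace (Cminus _ _) with (Cmult Ci (Cminus (g (x0, y)) (f z))) by ring.
      rewrite Cmod_mult, Cmod_Ci, Rmult_1_l. left. apply Kd. rewrite Cmod_cexp. exact H1. }
  rewrite <- E1 in B0.
  apply Rmult_le_reg_r with (2 * PI - 0); [lra|].
  apply Rle_trans with (Cmod (Cmult (Cmult Ci (f z)) (RtoC (2 * PI - 0)))).
  - rewrite !Cmod_mult, Cmod_Ci, Cmod_R, Rabs_right by lra. lra.
  - generalize (Cmod_minus_ge (Cmult (Cmult Ci (f z)) (RtoC (2 * PI - 0))) I1).
    rewrite Cmod_minus_sym. lra.
Qed.

(** * Boundedness on rectangles and propagation of smallness *)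

Lemma ccont_bounded_rect (f : C -> C) (a b c d : R) : a <= b -> c <= d ->
  ccont_rect f a b c d ->
  exists B, forall x y, a <= x <= b -> c <= y <= d -> Cmod (f (x, y)) <= B.
Proof.
  intros Hab Hcd Hf.
  apply (rectangle_induction (fun a b c d =>
    exists B, forall x y, a <= x <= b -> c <= y <= d -> Cmod (f (x, y)) <= B)); auto.
  - intros a' b' c' d' _ _ [B1 H1] [B2 H2] [B3 H3] [B4 H4].
    exists (Rmax (Rmax B1 B2) (Rmax B3 B4)). intros x y Hx Hy.
    destruct (Rle_dec x ((a' + b') / 2)); destruct (Rle_dec y ((c' + d') / 2)).
    + eapply Rle_trans; [apply H1; lra|]. eapply Rle_trans; [apply Rmax_l|apply Rmax_l].
    + eapply Rle_trans; [apply H3; lra|]. eapply Rle_trans; [apply Rmax_l|apply Rmax_r].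
    + eapply Rle_trans; [apply H2; lra|]. eapply Rle_trans; [apply Rmax_r|apply Rmax_l].
    + eapply Rle_trans; [apply H4; lra|]. eapply Rle_trans; [apply Rmax_r|apply Rmax_r].
  - intros x y Hx Hy. destruct (Hf x y Hx Hy 1 ltac:(lra)) as [delta [Hd K]].
    exists (delta / 2); split; [lra|].
    intros a' b' c' d' A1 A2 A3 A4 A5 A6 A7 A8. exists (Cmod (f (x, y)) + 1).
    intros u v Hu Hv.
    specialize (K (u - x, v - y)).
    replace (Cplus (x, y) (u - x, v - y)) with ((u, v) : C) in K by (apply C_ext; simpl; ring).
    generalize (Cmod_minus_ge (f (u, v)) (f (x, y))).
    assert (Cmod (u - x, v - y) < delta).
    { eapply Rle_lt_trans; [apply Cmod_le_Re_Im|]. simpl.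
      assert (Rabs (u - x) < delta / 2) by (apply Rabs_def1; lra).
      assert (Rabs (v - y) < delta / 2) by (apply Rabs_def1; lra). lra. }
    specialize (K H). lra.
Qed.

(* With [u = (w - z) / r], the real part of [u + u^2/2] on [|u| = 1] is [x + x^2 - 1/2],
   where [x = Re u]; it is at most -3/16 as soon as [x <= 1/4]. *)
Lemma small_push_left (B eps r : R) : 0 <= B -> 0 < eps -> 0 < r ->
  exists eta, 0 < eta /\ forall (f : C -> C) (z : C),
    (forall w, Cmod (Cminus w z) <= r -> cdiff f w) ->
    (forall w, Cmod (Cminus w z) = r -> Cmod (f w) <= B) ->
    (forall w, Cmod (Cminus w z) = r -> Re z + r / 4 <= Re w -> Cmod (f w) <= eta) ->
    Cmod (f z) <= eps.
Proof.
  intros HB He Hr.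
  (* Chosen so that [exp (- 3 / 16 * lam) = eps / (eps + B)]: where only [|f| <= B] is known, the
     product is then at most [eps]. *)
  set (lam := 16 / 3 * ln (1 + B / eps)).
  assert (HBe : 0 <= B / eps) by (apply Rmult_le_pos; [auto|apply Rlt_le, Rinv_0_lt_compat, He]).
  assert (Hlam : 0 <= lam).
  { unfold lam. apply Rmult_le_pos; [lra|]. rewrite <- ln_1. apply ln_le; lra. }
  (* On the circle the real part of [p] is at most 3/2, its value at [u = 1]; smallness of [f] has
     to compensate a growth by [exp (3 / 2 * lam)]. *)
  exists (eps * exp (- (3 / 2 * lam))). split; [apply Rmult_lt_0_compat; [auto|apply exp_pos]|].
  intros f z Hf HfB Hfs.
  set (u := fun w => Cmult (Cminus w z) (RtoC (/ r))).
  set (p := fun w => Cplus (u w) (Cmult (RtoC (/ 2)) (Cmult (u w) (u w)))).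
  set (g := fun w => Cmult (f w) (cexp (Cmult (RtoC lam) (p w)))).
  assert (Eg : g z = f z).
  { unfold g, p, u. replace (Cminus z z) with (RtoC 0) by ring.
    replace (Cmult (RtoC lam) _) with (RtoC 0) by ring. rewrite cexp_0. ring. }
  rewrite <- Eg. apply circle_max with r; auto.
  - intros w Hw. unfold g. apply cdiff_mult; [apply Hf, Hw|]. apply cdiff_cexp.
    assert (Hu : cdiff u w).
    { unfold u. apply cdiff_mult; [|apply cdiff_const]. apply cdiff_minus; [apply cdiff_id|apply cdiff_const]. }
    apply cdiff_mult; [apply cdiff_const|]. unfold p. apply cdiff_plus; auto.
    apply cdiff_mult; [apply cdiff_const|]. apply cdiff_mult; auto.
  - intros w Hw. unfold g. rewrite Cmod_mult, Cmod_cexp.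
    assert (Hu : Cmod (u w) = 1).
    { unfold u. rewrite Cmod_mult, Hw, Cmod_R, Rabs_right; [field; lra|].
      apply Rle_ge, Rlt_le, Rinv_0_lt_compat, Hr. }
    assert (Hu2 := Cmod_sqr (u w)). rewrite Hu in Hu2.
    set (x := Re (u w)) in *.
    assert (Ep : Re (p w) = x + x * x - / 2).
    { unfold p. rewrite re_plus, re_scal_l, re_mult. fold x. lra. }
    assert (Hx : Re w = Re z + r * x).
    { unfold x, u. rewrite re_scal_r, Re_minus. field; lra. }
    assert (Hx1 : -1 <= x <= 1).
    { split; nra. }
    rewrite re_scal_l, Ep.
    destruct (Rle_dec x (1 / 4)) as [Hc|Hc].
    + apply Rle_trans with (B * exp (lam * (- (3 / 16)))).
      * apply Rmult_le_compat; [apply Cmod_ge_0|apply Rlt_le, exp_pos|apply HfB, Hw|].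
        apply exp_le_compat, Rmult_le_compat_l; auto. nra.
      * replace (lam * - (3 / 16)) with (- ln (1 + B / eps)) by (unfold lam; field).
        rewrite exp_Ropp, exp_ln by lra.
        apply Rmult_le_reg_r with (1 + B / eps); [lra|].
        rewrite Rmult_assoc, Rinv_l, Rmult_1_r by lra.
        replace (eps * (1 + B / eps)) with (eps + B) by (field; lra). lra.
    + apply Rle_trans with (eps * exp (- (3 / 2 * lam)) * exp (lam * (3 / 2))).
      * apply Rmult_le_compat; [apply Cmod_ge_0|apply Rlt_le, exp_pos| |].
        -- apply Hfs; auto. rewrite Hx. nra.
        -- apply exp_le_compat, Rmult_le_compat_l; auto. nra.
      * rewrite Rmult_assoc, <- exp_plus.
        replace (_ + _) with 0 by lra. rewrite exp_0. lra.
Qed.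

(** Every application of [small_push_left] moves the frontier of smallness [r / 4] to the left. Its
    discs of radius [r] reach [r] up and down, so each step also costs [r] of height, and [J] steps
    must start from half-height [INR J * r]. The bound [B], common to all [M], is what makes [eta]
    independent of [M]. *)
Lemma limit_push_left (h : nat -> C -> C) (A r y0 B : R) (J M0 : nat) : 0 < r -> 0 <= B ->
  (forall M w, (M0 <= M)%nat -> A - INR J * (r / 4) - r <= Re w <= A + r ->
     Rabs (Im w - y0) <= INR J * r + r -> cdiff (h M) w /\ Cmod (h M w) <= B) ->
  (forall eps, 0 < eps -> exists M1, forall M w, (M1 <= M)%nat -> A <= Re w <= A + r ->
     Rabs (Im w - y0) <= INR J * r -> Cmod (h M w) <= eps) ->
  forall eps, 0 < eps -> exists M1, forall M, (M1 <= M)%nat ->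
     Cmod (h M (A - INR J * (r / 4), y0)) <= eps.
Proof.
  intros Hr HB Hh Hlim.
  assert (K : forall j, (j <= J)%nat -> forall eps, 0 < eps -> exists M1, forall M w, (M1 <= M)%nat ->
     A - INR j * (r / 4) <= Re w <= A + r -> Rabs (Im w - y0) <= (INR J - INR j) * r ->
     Cmod (h M w) <= eps).
  { induction j as [|j IH]; intros Hj eps He.
    - destruct (Hlim eps He) as [M1 H1]. exists M1. intros M w HM Hw1 Hw2.
      apply H1; auto; simpl in *; lra.
    - destruct (small_push_left B eps r HB He Hr) as [eta [Heta Hpush]].
      (* [eta] is for pushing to new points, [eps] for the points already covered at the previous
         stage. *)
      destruct (IH ltac:(lia) (Rmin eta eps) ltac:(apply Rmin_case; auto)) as [M1 H1].
      exists (Nat.max M0 M1). intros M w HM Hw1 Hw2.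
      rewrite S_INR in Hw1, Hw2.
      assert (HjJ : INR (S j) <= INR J) by (apply le_INR; auto). rewrite S_INR in HjJ.
      assert (Hj0 : 0 <= INR j) by apply pos_INR.
      assert (Hsub : forall v, Cmod (Cminus v w) <= r -> Re w - r <= Re v <= Re w + r /\
         Rabs (Im v - y0) <= (INR J - INR j) * r).
      { intros v Hv. generalize (re_le_Cmod (Cminus v w)) (im_le_Cmod (Cminus v w)).
        rewrite Re_minus, Im_minus. intros R1 R2. split.
        - generalize (Rle_abs (Re v - Re w)) (Rle_abs (- (Re v - Re w))).
          rewrite Rabs_Ropp. lra.
        - replace (Im v - y0) with ((Im v - Im w) + (Im w - y0)) by ring.
          eapply Rle_trans; [apply Rabs_triang|]. lra. }
      destruct (Rle_dec (A - INR j * (r / 4)) (Re w)) as [Hc|Hc].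
      + eapply Rle_trans; [apply H1; [lia|lra|]|apply Rmin_r].
        eapply Rle_trans; [exact Hw2|]. apply Rmult_le_compat_r; lra.
      + assert (P1 : 0 <= INR j * (r / 4)) by (apply Rmult_le_pos; lra).
        assert (P2 : (INR j + 1) * (r / 4) <= INR J * (r / 4)) by (apply Rmult_le_compat_r; lra).
        apply Hpush.
        * intros v Hv. destruct (Hsub v Hv) as [V1 V2]. apply Hh; [lia|lra|].
          eapply Rle_trans; [exact V2|]. nra.
        * intros v Hv. destruct (Hsub v ltac:(lra)) as [V1 V2]. apply Hh; [lia|lra|].
          eapply Rle_trans; [exact V2|]. nra.
        * intros v Hv Hv2. destruct (Hsub v ltac:(lra)) as [V1 V2].
          eapply Rle_trans; [apply H1; [lia|lra|exact V2]|apply Rmin_l]. }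
  intros eps He. destruct (K J (le_n J) eps He) as [M1 H1].
  exists M1. intros M HM. apply H1; auto; simpl.
  - assert (0 <= INR J) by apply pos_INR. nra.
  - rewrite !Rminus_diag, Rabs_R0. lra.
Qed.

(** * Finite sums and power sums *)

Fixpoint csum (f : nat -> C) (n : nat) : C :=
  match n with O => RtoC 0 | S n => Cplus (csum f n) (f n) end.

Fixpoint rsum (f : nat -> R) (n : nat) : R :=
  match n with O => 0 | S n => rsum f n + f n end.

Lemma csum_ext (f g : nat -> C) (n : nat) :
  (forall i, (i < n)%nat -> f i = g i) -> csum f n = csum g n.
Proof. induction n; simpl; intros H; auto. rewrite IHn, H; auto. Qed.

Lemma csum_plus (f g : nat -> C) (n : nat) :
  csum (fun i => Cplus (f i) (g i)) n = Cplus (csum f n) (csum g n).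
Proof. induction n; simpl; [ring|]. rewrite IHn; ring. Qed.

Lemma csum_minus (f g : nat -> C) (n : nat) :
  csum (fun i => Cminus (f i) (g i)) n = Cminus (csum f n) (csum g n).
Proof. induction n; simpl; [ring|]. rewrite IHn; ring. Qed.

Lemma csum_scal (c : C) (f : nat -> C) (n : nat) :
  csum (fun i => Cmult c (f i)) n = Cmult c (csum f n).
Proof. induction n; simpl; [ring|]. rewrite IHn; ring. Qed.

Lemma csum_split (f : nat -> C) (n m : nat) :
  csum f (n + m) = Cplus (csum f n) (csum (fun i => f (n + i)%nat) m).
Proof.
  induction m; simpl.
  - rewrite Nat.add_0_r; ring.
  - rewrite Nat.add_succ_r; simpl. rewrite IHm; ring.
Qed.

Lemma csum_shift (f : nat -> C) (n : nat) :
  csum f (S n) = Cplus (f O) (csum (fun i => f (S i)) n).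
Proof. induction n; simpl; [ring|]. simpl in IHn. rewrite IHn; ring. Qed.

Lemma csum_bound (f : nat -> C) (g : nat -> R) (n : nat) :
  (forall i, (i < n)%nat -> Cmod (f i) <= g i) -> Cmod (csum f n) <= rsum g n.
Proof.
  induction n; simpl; intros H.
  - rewrite Cmod_0; lra.
  - eapply Rle_trans; [apply Cmod_triangle|]. apply Rplus_le_compat; auto.
Qed.

Lemma csum_0 (f : nat -> C) (n : nat) : (forall i, (i < n)%nat -> f i = RtoC 0) -> csum f n = RtoC 0.
Proof. induction n; simpl; intros H; auto. rewrite IHn, H; auto. ring. Qed.

Lemma cdiff_csum (F : nat -> C -> C) (z : C) (n : nat) :
  (forall i, (i < n)%nat -> cdiff (F i) z) -> cdiff (fun w => csum (fun i => F i w) n) z.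
Proof.
  induction n; simpl; intros H; [apply cdiff_const|]. apply cdiff_plus; auto.
Qed.

Lemma sum_n_m_csum (f : nat -> C) (a b : nat) :
  (sum_n_m f a b : C) = csum (fun i => f (a + i)%nat) (S b - a).
Proof.
  destruct (Compare_dec.le_lt_dec a b) as [H|H].
  - replace b with (a + (b - a))%nat by lia. generalize (b - a)%nat; clear b H. intros m.
    replace (S (a + m) - a)%nat with (S m) by lia.
    induction m.
    + rewrite Nat.add_0_r, sum_n_n. simpl. rewrite Nat.add_0_r. ring.
    + rewrite Nat.add_succ_r, sum_n_Sm by lia. rewrite IHm. simpl. rewrite Nat.add_succ_r. reflexivity.
  - rewrite sum_n_m_zero by auto. replace (S b - a)%nat with O by lia. reflexivity.
Qed.

Lemma rsum_ext (f g : nat -> R) (n : nat) :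
  (forall i, (i < n)%nat -> f i = g i) -> rsum f n = rsum g n.
Proof. induction n; simpl; intros H; auto. rewrite IHn, H; auto. Qed.

Lemma rsum_le (f g : nat -> R) (n : nat) :
  (forall i, (i < n)%nat -> f i <= g i) -> rsum f n <= rsum g n.
Proof. induction n; simpl; intros H; [lra|]. apply Rplus_le_compat; auto. Qed.

Lemma rsum_plus (f g : nat -> R) (n : nat) :
  rsum (fun i => f i + g i) n = rsum f n + rsum g n.
Proof. induction n; simpl; [ring|]. rewrite IHn; ring. Qed.

Lemma rsum_scal (c : R) (f : nat -> R) (n : nat) :
  rsum (fun i => c * f i) n = c * rsum f n.
Proof. induction n; simpl; [ring|]. rewrite IHn; ring. Qed.

Lemma rsum_nonneg (f : nat -> R) (n : nat) : (forall i, (i < n)%nat -> 0 <= f i) -> 0 <= rsum f n.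
Proof. induction n; simpl; intros H; [lra|]. apply Rplus_le_le_0_compat; auto. Qed.

Lemma rsum_telescope (u : nat -> R) (n : nat) : rsum (fun i => u i - u (S i)) n = u O - u n.
Proof. induction n; simpl; [ring|]. rewrite IHn; ring. Qed.

Lemma rsum_const (c : R) (n : nat) : rsum (fun _ => c) n = INR n * c.
Proof. induction n; [simpl; ring|]. rewrite S_INR. simpl. rewrite IHn; ring. Qed.

Lemma rsum_split (f : nat -> R) (n m : nat) :
  rsum f (n + m) = rsum f n + rsum (fun i => f (n + i)%nat) m.
Proof.
  induction m; simpl.
  - rewrite Nat.add_0_r; ring.
  - rewrite Nat.add_succ_r; simpl. rewrite IHm; ring.
Qed.

Lemma rsum_shift (f : nat -> R) (n : nat) :
  rsum f (S n) = f O + rsum (fun i => f (S i)) n.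
Proof. induction n; simpl; [ring|]. simpl in IHn. rewrite IHn; ring. Qed.

Lemma rsum_incr (f : nat -> R) (n m : nat) : (n <= m)%nat -> (forall i, 0 <= f i) -> rsum f n <= rsum f m.
Proof.
  intros H Hf. replace m with (n + (m - n))%nat by lia. rewrite rsum_split.
  assert (0 <= rsum (fun i => f (n + i)%nat) (m - n)) by (apply rsum_nonneg; auto). lra.
Qed.

(** * Real powers and their sums *)

Lemma Rpower_pos (x y : R) : 0 < Rpower x y.
Proof. apply exp_pos. Qed.

Lemma Rpower_le_l (x y e : R) : 0 < x <= y -> 0 <= e -> Rpower x e <= Rpower y e.
Proof.
  intros H He. apply exp_le_compat, Rmult_le_compat_l; auto. apply ln_le; lra.
Qed.

Lemma Rpower_ge_l (x y e : R) : 0 < x <= y -> e <= 0 -> Rpower y e <= Rpower x e.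
Proof.
  intros H He. apply exp_le_compat.
  assert (ln x <= ln y) by (apply ln_le; lra). nra.
Qed.

Lemma Rpower_le_r (x e f : R) : 1 <= x -> e <= f -> Rpower x e <= Rpower x f.
Proof.
  intros H He. apply exp_le_compat, Rmult_le_compat_r; auto.
  rewrite <- ln_1. apply ln_le; lra.
Qed.

Lemma Rpower_ge_1 (x e : R) : 1 <= x -> 0 <= e -> 1 <= Rpower x e.
Proof.
  intros. rewrite <- (Rpower_O x) by lra. apply Rpower_le_r; auto.
Qed.

Lemma Rpower_le_1 (x e : R) : 1 <= x -> e <= 0 -> Rpower x e <= 1.
Proof.
  intros. rewrite <- (Rpower_O x) by lra. apply Rpower_le_r; auto.
Qed.

Lemma Rpower_Sr (x e : R) : 0 < x -> Rpower x (e + 1) = x * Rpower x e.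
Proof. intros. rewrite Rpower_plus, Rpower_1 by auto. ring. Qed.

Lemma Rpower_Pr (x e : R) : 0 < x -> Rpower x (e - 1) = Rpower x e / x.
Proof. intros. replace e with (e - 1 + 1) at 2 by ring. rewrite Rpower_Sr by auto. field; lra. Qed.

Lemma is_derive_Rpower (x e : R) : 0 < x -> is_derive (fun t => Rpower t e) x (e * Rpower x (e - 1)).
Proof.
  intros Hx. rewrite Rpower_Pr by auto. unfold Rpower. auto_derive; [auto|]. field; lra.
Qed.

Lemma Rpower_MVT (x y e : R) : 0 < x -> x < y ->
  exists z, x <= z <= y /\ Rpower y e - Rpower x e = e * Rpower z (e - 1) * (y - x).
Proof.
  intros Hx Hxy.
  destruct (MVT_gen (fun t => Rpower t e) x y (fun t => e * Rpower t (e - 1))) as [z [Hz E]].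
  - intros t; rewrite Rmin_left, Rmax_right by lra; intros Ht. apply is_derive_Rpower; lra.
  - intros t; rewrite Rmin_left, Rmax_right by lra; intros Ht.
    apply continuity_pt_filterlim. apply (ex_derive_continuous (fun t => Rpower t e)). exists (e * Rpower t (e - 1)). apply is_derive_Rpower; lra.
  - rewrite Rmin_left, Rmax_right in Hz by lra. exists z; auto.
Qed.

Lemma INR_S_pos (n : nat) : 1 <= INR (S n).
Proof. rewrite S_INR. generalize (pos_INR n). lra. Qed.

(** For [q >= 0], each term after the first is at most an increment of [x^(1-q) / (1-q)], by the
    mean value theorem. For [q < 0] the terms increase, and their number times the last one
    suffices. *)
Lemma power_sum_le (q : R) : q < 1 -> exists K, 0 < K /\ forall n,
  rsum (fun i => Rpower (INR (S i)) (- q)) (S n) <= K * Rpower (INR (S n)) (1 - q).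
Proof.
  intros Hq.
  destruct (Rle_dec 0 q) as [H0|H0].
  - exists (/ (1 - q)). assert (HK : 0 < / (1 - q)) by (apply Rinv_0_lt_compat; lra).
    split; auto. induction n.
    + simpl. unfold Rpower. rewrite ln_1, !Rmult_0_r, exp_0.
      assert (1 <= / (1 - q)); [|lra]. rewrite <- Rinv_1. apply Rinv_le_contravar; lra.
    + cbn [rsum] in *. set (s := rsum _ n) in *.
      destruct (Rpower_MVT (INR (S n)) (INR (S (S n))) (1 - q)) as [z [Hz E]].
      { generalize (INR_S_pos n); lra. }
      { rewrite (S_INR (S n)). lra. }
      replace (INR (S (S n)) - INR (S n)) with 1 in E by (rewrite (S_INR (S n)); ring).
      assert (Rpower (INR (S (S n))) (- q) <= Rpower z (- q)).
      { apply Rpower_ge_l; [|lra]. generalize (INR_S_pos n); lra. }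
      replace (1 - q - 1) with (- q) in E by ring.
      replace (Rpower (INR (S (S n))) (1 - q)) with
        (Rpower (INR (S n)) (1 - q) + (1 - q) * Rpower z (- q)) by lra.
      rewrite Rmult_plus_distr_l, <- Rmult_assoc, Rinv_l by lra. lra.
  - exists 1. split; [lra|]. intros n.
    apply Rle_trans with (rsum (fun _ => Rpower (INR (S n)) (- q)) (S n)).
    + apply rsum_le. intros i Hi. apply Rpower_le_l; [|lra].
      split; [generalize (INR_S_pos i); lra|]. apply le_INR; lia.
    + rewrite rsum_const. replace (1 - q) with (- q + 1) by ring.
      rewrite Rpower_Sr; [lra|]. generalize (INR_S_pos n); lra.
Qed.

Lemma power_tail_le (q : R) : 1 < q -> exists K, 0 < K /\ forall n m,
  rsum (fun i => Rpower (INR (S n + i)) (- q)) m <= K * Rpower (INR (S n)) (1 - q).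
Proof.
  (* The term at [x] is compared with an increment over [[x, x + 1]], which only sees arguments up
     to [x + 1 <= 2 * x]; hence the factor [2^q]. *)
  intros Hq. exists (Rpower 2 q / (q - 1)).
  assert (HK : 0 < Rpower 2 q / (q - 1)) by (apply Rdiv_lt_0_compat; [apply Rpower_pos|lra]).
  split; auto. intros n m.
  apply Rle_trans with (rsum (fun i => Rpower 2 q / (q - 1) *
    (Rpower (INR (S n + i)) (1 - q) - Rpower (INR (S n + S i)) (1 - q))) m).
  - apply rsum_le. intros i _.
    set (x := INR (S n + i)).
    assert (Hx : 1 <= x) by (unfold x; rewrite plus_INR; generalize (INR_S_pos n) (pos_INR i); lra).
    replace (INR (S n + S i)) with (x + 1) by (unfold x; rewrite !plus_INR, (S_INR i); ring).
    destruct (Rpower_MVT x (x + 1) (1 - q)) as [z [Hz E]]; try lra.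
    replace (1 - q - 1) with (- q) in E by ring.
    replace (Rpower x (1 - q) - Rpower (x + 1) (1 - q)) with ((q - 1) * Rpower z (- q)) by lra.
    replace (Rpower 2 q / (q - 1) * ((q - 1) * Rpower z (- q))) with (Rpower 2 q * Rpower z (- q))
      by (field; lra).
    apply Rle_trans with (Rpower 2 q * Rpower (2 * x) (- q)).
    + rewrite <- Rpower_mult_distr by lra.
      rewrite <- Rmult_assoc, <- Rpower_plus. replace (q + - q) with 0 by ring.
      rewrite Rpower_O by lra. lra.
    + apply Rmult_le_compat_l; [apply Rlt_le, Rpower_pos|]. apply Rpower_ge_l; lra.
  - rewrite rsum_scal. apply Rmult_le_compat_l; [lra|].
    rewrite (rsum_telescope (fun i => Rpower (INR (S n + i)) (1 - q))).
    rewrite Nat.add_0_r. generalize (Rpower_pos (INR (S n + m)) (1 - q)). lra.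
Qed.

(** * Complex powers of positive reals *)

Lemma cpow_cexp (x : R) (s : C) : cpow x s = cexp (Cmult s (RtoC (ln x))).
Proof. unfold cpow, cexp. rewrite re_scal_r, im_mult. simpl. f_equal; f_equal; f_equal; unfold Im; ring. Qed.

Lemma Cmod_cpow (x : R) (s : C) : Cmod (cpow x s) = Rpower x (Re s).
Proof. rewrite cpow_cexp, Cmod_cexp, re_scal_r. reflexivity. Qed.

Lemma cpow_plus (x : R) (s t : C) : cpow x (Cplus s t) = Cmult (cpow x s) (cpow x t).
Proof. rewrite !cpow_cexp, <- cexp_plus. f_equal; ring. Qed.

Lemma cpow_mult_base (x y : R) (s : C) : 0 < x -> 0 < y ->
  cpow (x * y) s = Cmult (cpow x s) (cpow y s).
Proof. intros. rewrite !cpow_cexp, <- cexp_plus, ln_mult by auto. f_equal. rewrite RtoC_plus; ring. Qed.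

Lemma cpow_0 (x : R) : cpow x (RtoC 0) = RtoC 1.
Proof. rewrite cpow_cexp, <- cexp_0. f_equal; ring. Qed.

Lemma cpow_1 (x : R) : 0 < x -> cpow x (RtoC 1) = RtoC x.
Proof.
  intros Hx. unfold cpow. simpl. rewrite Rmult_1_l, Rmult_0_l, exp_ln, cos_0, sin_0 by auto.
  apply C_ext; simpl; ring.
Qed.

Lemma cpow_opp (x : R) (s : C) : cpow x (Copp s) = Cinv (cpow x s).
Proof. rewrite !cpow_cexp, <- cexp_opp. f_equal; ring. Qed.

Lemma cpow_opp_mult (x : R) (s : C) : Cmult (cpow x (Copp s)) (cpow x s) = RtoC 1.
Proof. rewrite <- cpow_plus. replace (Cplus (Copp s) s) with (RtoC 0) by ring. apply cpow_0. Qed.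

Lemma rder_cpow (x : R) (s : C) : 0 < x ->
  rder (fun t => cpow t s) x (Cmult s (cpow x (Cminus s (RtoC 1)))).
Proof.
  intros Hx. apply rder_ext with (fun t => cexp (Cmult s (RtoC (ln t)))).
  { intros t; rewrite cpow_cexp; reflexivity. }
  replace (Cmult s (cpow x (Cminus s 1))) with (Cmult (Cmult s (RtoC (/ x))) (cexp (Cmult s (RtoC (ln x))))).
  - apply (rder_cexp_comp ln). apply is_derive_Reals. apply derivable_pt_lim_ln, Hx.
  - rewrite <- cpow_cexp. unfold Cminus. rewrite cpow_plus, cpow_opp, cpow_1 by auto.
    rewrite RtoC_inv by lra. ring.
Qed.

Lemma rder_comp (F : R -> C) (g : R -> R) (x l : R) (m : C) :
  rder F (g x) m -> is_derive g x l -> rder (fun t => F (g t)) x (Cmult (RtoC l) m).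
Proof.
  intros [H1 H2] Hg. split.
  - replace (Re (Cmult (RtoC l) m)) with (scal l (Re m)).
    + apply (is_derive_comp (fun t => Re (F t)) g); auto.
    + rewrite re_scal_l; reflexivity.
  - replace (Im (Cmult (RtoC l) m)) with (scal l (Im m)).
    + apply (is_derive_comp (fun t => Im (F t)) g); auto.
    + rewrite im_scal_l; reflexivity.
Qed.

Lemma cdiff_cpow (x : R) (F : C -> C) (z : C) : cdiff F z -> cdiff (fun w => cpow x (F w)) z.
Proof.
  intros H. apply cdiff_ext with (fun w => cexp (Cmult (F w) (RtoC (ln x)))).
  { intros w; rewrite cpow_cexp; reflexivity. }
  apply cdiff_cexp, cdiff_mult; auto. apply cdiff_const.
Qed.

(** * Tails of Dirichlet series *)

(** For [Re z > 0] this is the integral of [u^(-z-1)] over [[x, oo)]; for other nonzero [z] it is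
    the continuation of that integral. *)
Definition pow_prim (z : C) (x : R) : C := Cdiv (cpow x (Copp z)) z.

Definition log_step (x : R) : R := ln (x + 1) - ln x.

(* [pow_ratio z x] is the integral of [u^(-z-1)] over [x, x+1] divided by [x^(-z-1)]. *)
Definition pow_ratio (z : C) (x : R) : C :=
  Cmult (Cdiv (RtoC x) z) (Cminus (RtoC 1) (cexp (Cmult (Copp z) (RtoC (log_step x))))).

Lemma pow_prim_step (z : C) (x : R) : z <> RtoC 0 -> 0 < x ->
  Cminus (pow_prim z x) (pow_prim z (x + 1)) =
  Cmult (pow_ratio z x) (cpow x (Cminus (Copp z) (RtoC 1))).
Proof.
  intros Hz Hx. unfold pow_prim, pow_ratio, log_step.
  assert (E : cpow (x + 1) (Copp z) =
    Cmult (cpow x (Copp z)) (cexp (Cmult (Copp z) (RtoC (ln (x + 1) - ln x))))).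
  { rewrite !cpow_cexp, <- cexp_plus. f_equal. rewrite RtoC_minus. ring. }
  rewrite E. change (Cminus (Copp z) (RtoC 1)) with (Cplus (Copp z) (Copp (RtoC 1))). rewrite cpow_plus, (cpow_opp x (RtoC 1)), cpow_1 by auto.
  assert (RtoC x <> RtoC 0) by (intros H; injection H; lra).
  field. auto.
Qed.

Lemma log_step_bounds (x : R) : 0 < x -> / (x + 1) <= log_step x <= / x.
Proof.
  intros Hx. unfold log_step.
  destruct (MVT_gen ln x (x + 1) Rinv) as [c [Hc E]].
  - intros t; rewrite Rmin_left, Rmax_right by lra; intros Ht.
    apply is_derive_Reals, derivable_pt_lim_ln; lra.
  - intros t; rewrite Rmin_left, Rmax_right by lra; intros Ht.
    apply derivable_continuous_pt. exists (/ t). apply derivable_pt_lim_ln; lra.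
  - rewrite Rmin_left, Rmax_right in Hc by lra. rewrite E.
    replace (/ c * (x + 1 - x)) with (/ c) by ring.
    split; apply Rinv_le_contravar; lra.
Qed.

(** As [log_step x <= / x], the condition [Cmod z <= x] keeps the exponent in the unit disc, where
    the exponential factor of the Taylor remainders is at most [exp 1 <= 3]. *)
Lemma cexp_step_taylor (z : C) (x : R) : 0 < x -> Cmod z <= x ->
  Cmod (Cminus (cexp (Cmult (Copp z) (RtoC (log_step x)))) (RtoC 1)) <= 3 * Cmod z / x /\
  Cmod (Cminus (Cminus (cexp (Cmult (Copp z) (RtoC (log_step x)))) (RtoC 1))
     (Cmult (Copp z) (RtoC (log_step x)))) <= 3 * (Cmod z * Cmod z) / (x * x).
Proof.
  intros Hx Hz.
  assert (Hl := log_step_bounds x Hx).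
  assert (Hix : 0 < / x) by (apply Rinv_0_lt_compat; auto).
  assert (Hl0 : 0 <= log_step x).
  { eapply Rle_trans; [|apply Hl]. apply Rlt_le, Rinv_0_lt_compat; lra. }
  set (y := Cmult (Copp z) (RtoC (log_step x))).
  generalize (Cmod_ge_0 z). intros Hz0.
  assert (Hy : Cmod y <= Cmod z / x).
  { unfold y. rewrite Cmod_mult, Cmod_opp, Cmod_R, Rabs_right by lra.
    apply Rmult_le_compat_l; lra. }
  assert (Hy1 : Cmod z / x <= 1).
  { apply Rmult_le_reg_r with x; auto. unfold Rdiv. rewrite Rmult_assoc, Rinv_l; lra. }
  assert (He : exp (Cmod y) <= 3).
  { eapply Rle_trans; [|apply exp_le_3]. apply exp_le_compat; lra. }
  assert (H0 := Cmod_ge_0 y). assert (He0 := exp_pos (Cmod y)).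
  split.
  - eapply Rle_trans; [apply cexp_minus_1_le|].
    replace (3 * Cmod z / x) with (Cmod z / x * 3) by (field; lra).
    apply Rmult_le_compat; lra.
  - eapply Rle_trans; [apply cexp_taylor2|].
    replace (3 * (Cmod z * Cmod z) / (x * x)) with ((Cmod z / x) * (Cmod z / x) * 3) by (field; lra).
    apply Rmult_le_compat; try lra; [nra|]. apply Rmult_le_compat; lra.
Qed.

Lemma pow_ratio_near_1 (z : C) (x : R) : z <> RtoC 0 -> 0 < x -> Cmod z <= x ->
  Cmod (Cminus (pow_ratio z x) (RtoC 1)) <= (1 + 3 * Cmod z) / x.
Proof.
  intros Hz Hx Hzx.
  destruct (cexp_step_taylor z x Hx Hzx) as [_ H2].
  assert (Hl := log_step_bounds x Hx).
  assert (Hm : 0 < Cmod z) by (apply Cmod_gt_0; auto).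
  unfold pow_ratio.
  set (G := Cminus (Cminus _ _) _) in H2.
  replace (Cminus _ (RtoC 1)) with
    (Cminus (RtoC (x * log_step x - 1)) (Cmult (Cdiv (RtoC x) z) G)).
  2:{ unfold G. rewrite RtoC_minus, RtoC_mult. field. auto. }
  eapply Rle_trans; [apply Cmod_minus_le|].
  rewrite Cmod_mult, Cmod_div, !Cmod_R, (Rabs_right x) by (auto; lra).
  assert (Rabs (x * log_step x - 1) <= / x).
  { assert (x * log_step x <= 1).
    { apply Rle_trans with (x * / x); [apply Rmult_le_compat_l; lra|right; field; lra]. }
    assert (1 - / x <= x * log_step x).
    { apply Rle_trans with (x * / (x + 1)); [|apply Rmult_le_compat_l; lra].
      apply Rmult_le_reg_r with (x * (x + 1)); [nra|].
      replace ((1 - / x) * (x * (x + 1))) with (x * x - 1) by (field; lra).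
      replace (x * / (x + 1) * (x * (x + 1))) with (x * x) by (field; lra). lra. }
    assert (0 < / x) by (apply Rinv_0_lt_compat; auto).
    apply Rabs_le. lra. }
  assert (x / Cmod z * Cmod G <= 3 * Cmod z / x).
  { apply Rle_trans with (x / Cmod z * (3 * (Cmod z * Cmod z) / (x * x))).
    - apply Rmult_le_compat_l; auto. apply Rlt_le, Rdiv_lt_0_compat; auto.
    - right; field; lra. }
  unfold Rdiv in *. lra.
Qed.

(** The derivative of the ratio is a difference of two terms, [(1 - e) / z] and [e / (t + 1)], both
    equal to [1 / t] up to errors of order [(1 + |z|) / t^2]. This cancellation gains a factor [x]
    over what [pow_ratio_near_1] gives, and makes the variations of the ratio summable. *)
Lemma pow_ratio_step (z : C) (x : R) : z <> RtoC 0 -> 0 < x -> Cmod z <= x ->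
  Cmod (Cminus (pow_ratio z (x + 1)) (pow_ratio z x)) <= (1 + 6 * Cmod z) / (x * x).
Proof.
  intros Hz Hx Hzx.
  assert (Hm : 0 < Cmod z) by (apply Cmod_gt_0; auto).
  set (e := fun t => cexp (Cmult (Copp z) (RtoC (log_step t)))).
  generalize (mean_value_ineq (pow_ratio z)
    (fun t => Cminus (Cmult (Cinv z) (Cminus (RtoC 1) (e t))) (Cmult (RtoC (/ (t + 1))) (e t)))
    x (x + 1) ((1 + 6 * Cmod z) / (x * x)) ltac:(lra)).
  intros H. replace (_ / _) with ((1 + 6 * Cmod z) / (x * x) * (x + 1 - x)) by ring.
  apply H; clear H.
  - intros t Ht. unfold pow_ratio. fold (e t).
    assert (Ht0 : RtoC t <> RtoC 0) by (intros H; injection H; lra).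
    assert (Ht1 : RtoC (t + 1) <> RtoC 0) by (intros H; injection H; lra).
    replace (Cminus (Cmult (Cinv z) (Cminus (RtoC 1) (e t))) (Cmult (RtoC (/ (t + 1))) (e t))) with
      (Cplus (Cmult (Cmult (Cinv z) (RtoC 1)) (Cplus (RtoC 1) (Cmult (RtoC (-1)) (e t))))
        (Cmult (Cmult (Cinv z) (RtoC t)) (Cplus (RtoC 0)
          (Cmult (RtoC (-1)) (Cmult (Cmult (Copp z) (RtoC (/ (t + 1) - / t))) (e t)))))).
    2:{ rewrite RtoC_minus, !RtoC_inv. 2,3: lra.
        rewrite RtoC_plus in *. replace (RtoC (-1)) with (Copp (RtoC 1)) by (apply C_ext; simpl; ring).
        field. auto. }
    apply rder_ext with (fun s => Cmult (Cmult (Cinv z) (RtoC s)) (Cplus (RtoC 1) (Cmult (RtoC (-1)) (e s)))).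
    { intros s. unfold e. replace (RtoC (-1)) with (Copp (RtoC 1)) by (apply C_ext; simpl; ring).
      unfold Cdiv. ring. }
    apply rder_mult.
    + apply rder_scal, rder_RtoC. apply @is_derive_id.
    + apply rder_plus; [apply rder_const|]. apply rder_scal.
      apply (rder_cexp_comp log_step). unfold log_step. auto_derive; [lra|]. field; lra.
  - intros t Ht.
    destruct (cexp_step_taylor z t ltac:(lra) ltac:(lra)) as [H1 H2].
    fold (e t) in H1, H2. set (G := Cminus (Cminus _ _) _) in H2.
    replace (Cminus (Cmult _ _) _) with
      (Cminus (Cminus (RtoC (log_step t - / (t + 1))) (Cmult (Cinv z) G))
        (Cmult (RtoC (/ (t + 1))) (Cminus (e t) (RtoC 1)))).
    2:{ unfold G. rewrite RtoC_minus. field. auto. }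
    assert (Hl := log_step_bounds t ltac:(lra)).
    eapply Rle_trans; [apply Cmod_minus_le|].
    eapply Rle_trans; [apply Rplus_le_compat_r, Cmod_minus_le|].
    assert (Hit : 0 < / (t + 1)) by (apply Rinv_0_lt_compat; lra).
    assert (Hit2 : 0 < / t) by (apply Rinv_0_lt_compat; lra).
    rewrite !Cmod_mult, Cmod_inv, !Cmod_R, (Rabs_right (/ (t + 1))) by (auto; lra).
    assert (Hle : / (t + 1) <= / t) by (apply Rinv_le_contravar; lra).
    assert (E1 : Rabs (log_step t - / (t + 1)) <= / t * / t).
    { rewrite Rabs_right by lra. apply Rle_trans with (/ t - / (t + 1)); [lra|].
      replace (/ t - / (t + 1)) with (/ t * / (t + 1)) by (field; lra).
      apply Rmult_le_compat_l; lra. }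
    assert (E2 : / Cmod z * Cmod G <= 3 * Cmod z * (/ t * / t)).
    { apply Rle_trans with (/ Cmod z * (3 * (Cmod z * Cmod z) / (t * t))).
      - apply Rmult_le_compat_l; auto. apply Rlt_le, Rinv_0_lt_compat, Hm.
      - right; field; lra. }
    assert (E3 : / (t + 1) * Cmod (Cminus (e t) (RtoC 1)) <= 3 * Cmod z * (/ t * / t)).
    { apply Rle_trans with (/ t * (3 * Cmod z / t)).
      - apply Rmult_le_compat; try lra. apply Cmod_ge_0.
      - right; field; lra. }
    assert (E4 : / t * / t <= / (x * x)).
    { rewrite <- Rinv_mult. apply Rinv_le_contravar; nra. }
    apply Rle_trans with ((1 + 6 * Cmod z) * (/ t * / t)); [lra|].
    apply Rmult_le_compat_l; lra.
Qed.

(** The condition [2 + 6 * Cmod z <= x] is what [pow_ratio_near_1] requires for a distance at most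
    1/2 from 1; so the inverse is at most 2 and inherits closeness to 1 and slow variation. *)
Lemma pow_ratio_inv (z : C) (x : R) : z <> RtoC 0 -> 2 + 6 * Cmod z <= x ->
  pow_ratio z x <> RtoC 0 /\
  Cmod (Cinv (pow_ratio z x)) <= 2 /\
  Cmod (Cminus (Cinv (pow_ratio z x)) (RtoC 1)) <= 2 * (1 + 3 * Cmod z) / x /\
  Cmod (Cminus (Cinv (pow_ratio z (x + 1))) (Cinv (pow_ratio z x))) <= 4 * (1 + 6 * Cmod z) / (x * x).
Proof.
  intros Hz Hx.
  assert (Hm : 0 < Cmod z) by (apply Cmod_gt_0; auto).
  assert (K : forall y, x <= y -> / 2 <= Cmod (pow_ratio z y)).
  { intros y Hy. generalize (pow_ratio_near_1 z y Hz ltac:(lra) ltac:(lra)). intros H.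
    assert ((1 + 3 * Cmod z) / y <= / 2).
    { apply Rmult_le_reg_r with y; [lra|]. unfold Rdiv. rewrite Rmult_assoc, Rinv_l by lra. lra. }
    generalize (Cmod_minus_ge (RtoC 1) (pow_ratio z y)). rewrite Cmod_minus_sym, Cmod_1. lra. }
  assert (K0 : forall y, x <= y -> pow_ratio z y <> RtoC 0).
  { intros y Hy. apply Cmod_gt_0. generalize (K y Hy). lra. }
  assert (Ki : forall y, x <= y -> Cmod (Cinv (pow_ratio z y)) <= 2).
  { intros y Hy. rewrite Cmod_inv by auto. replace 2 with (/ / 2) by field.
    apply Rinv_le_contravar; [lra|auto]. }
  assert (P0 := K0 x ltac:(lra)). assert (P1 := K0 (x + 1) ltac:(lra)).
  split; [exact P0|split; [apply Ki; lra|split]].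
  - replace (Cminus (Cinv (pow_ratio z x)) (RtoC 1)) with
      (Cmult (Cinv (pow_ratio z x)) (Cminus (RtoC 1) (pow_ratio z x))) by (field; auto).
    rewrite Cmod_mult, (Cmod_minus_sym (RtoC 1)).
    replace (2 * (1 + 3 * Cmod z) / x) with (2 * ((1 + 3 * Cmod z) / x)) by (field; lra).
    apply Rmult_le_compat; try apply Cmod_ge_0; [apply Ki; lra|].
    apply pow_ratio_near_1; auto; lra.
  - replace (Cminus (Cinv (pow_ratio z (x + 1))) (Cinv (pow_ratio z x))) with
      (Cmult (Cmult (Cinv (pow_ratio z (x + 1))) (Cinv (pow_ratio z x)))
        (Cminus (pow_ratio z x) (pow_ratio z (x + 1)))) by (field; auto).
    rewrite !Cmod_mult, (Cmod_minus_sym (pow_ratio z x)).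
    replace (4 * (1 + 6 * Cmod z) / (x * x)) with (2 * 2 * ((1 + 6 * Cmod z) / (x * x))) by (field; lra).
    apply Rmult_le_compat; try apply Cmod_ge_0.
    + apply Rmult_le_pos; apply Cmod_ge_0.
    + apply Rmult_le_compat; try apply Cmod_ge_0; apply Ki; lra.
    + apply pow_ratio_step; auto; lra.
Qed.

Lemma csum_abel (b Q : nat -> C) (m : nat) :
  csum (fun i => Cmult (b i) (Cminus (Q i) (Q (S i)))) (S m) =
  Cplus (Cminus (Cmult (b O) (Q O)) (Cmult (b m) (Q (S m))))
    (csum (fun i => Cmult (Q (S i)) (Cminus (b (S i)) (b i))) m).
Proof.
  induction m.
  - simpl. ring.
  - change (csum ?f (S (S m))) with (Cplus (csum f (S m)) (f (S m))). rewrite IHm. simpl. ring.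
Qed.

Lemma Cmod_pow_prim_le (z : C) (y e : R) : 1 <= y -> 1 <= Cmod z -> - Re z <= e ->
  Cmod (pow_prim z y) <= Rpower y e / Cmod z.
Proof.
  intros Hy Hz He. unfold pow_prim.
  assert (z <> RtoC 0) by (apply Cmod_gt_0; lra).
  rewrite Cmod_div by auto. apply Rmult_le_compat_r; [apply Rlt_le, Rinv_0_lt_compat; lra|].
  rewrite Cmod_cpow, re_opp. apply Rpower_le_r; auto.
Qed.

Lemma Cmod_pow_prim_le_1 (z : C) (y e : R) : 1 <= y -> 1 <= Cmod z -> - Re z <= e ->
  Cmod (pow_prim z y) <= Rpower y e.
Proof.
  intros Hy Hz He. eapply Rle_trans; [apply Cmod_pow_prim_le; eassumption|].
  apply Rmult_le_reg_r with (Cmod z); [lra|]. unfold Rdiv. rewrite Rmult_assoc, Rinv_l by lra.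
  generalize (Rpower_pos y e). nra.
Qed.

Lemma INR_step (n i : nat) : INR (n + S i) = INR (n + i) + 1.
Proof. rewrite !plus_INR, S_INR; ring. Qed.

Lemma INR_Spos (n i : nat) : 1 <= INR (S n + i).
Proof. apply (INR_S_pos (n + i)). Qed.

Lemma Rinv_half_shift (y : R) : 1 <= y -> / y <= 2 * / (y + 1).
Proof.
  intros Hy. apply Rmult_le_reg_r with (y * (y + 1)); [nra|].
  replace (/ y * (y * (y + 1))) with (y + 1) by (field; lra).
  replace (2 * / (y + 1) * (y * (y + 1))) with (2 * y) by (field; lra). lra.
Qed.

(** The errors of [pow_ratio] grow like [1 + q * |z|], while [pow_prim] brings [1 / |z|]. This trade
    makes the tail estimates uniform in [z]. *)
Lemma one_plus_ratio (q m : R) : 0 <= q -> 1 <= m -> / m * (1 + q * m) <= 1 + q.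
Proof.
  intros Hq Hm. apply Rmult_le_reg_l with m; [lra|].
  rewrite <- Rmult_assoc, Rinv_r by lra. nra.
Qed.

Lemma power_tail_decreasing (q : R) : 1 < q -> exists K, 0 < K /\ forall n m,
  rsum (fun i => Rpower (INR (S n + i) + 1) (- q)) m <= K * Rpower (INR (S n)) (1 - q).
Proof.
  intros Hq. destruct (power_tail_le q Hq) as [K [HK H]]. exists K; split; auto.
  intros n m. eapply Rle_trans; [|apply (H n m)].
  apply rsum_le. intros i _. apply Rpower_ge_l; [|lra].
  generalize (INR_Spos n i). lra.
Qed.

(** [pow_prim] at the end point stands for the missing infinite tail. With it, the sum stays bounded
    in [m] for exponents [z + 1] of real part at least [x0 - 1 > 0], thus also to the left of
    absolute convergence. The three summands of the constant belong to the first boundary term, the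
    end point and the variation of [b]. *)
Lemma zeta_tail_bound (x0 : R) : 1 < x0 -> exists K, 0 < K /\ forall (z : C) (n m : nat),
  x0 - 2 <= Re z -> 1 <= Cmod z -> 2 + 6 * Cmod z <= INR (S n) ->
  Cmod (Cplus (csum (fun i => cpow (INR (S n + i)) (Cminus (Copp z) (RtoC 1))) (S m))
    (pow_prim z (INR (S n + S m)))) <= K * Rpower (INR (S n)) (2 - x0).
Proof.
  intros Hx0. destruct (power_tail_decreasing x0 Hx0) as [K [HK HT]].
  exists (2 + 16 + 112 * K). split; [lra|].
  intros z n m Hre Hz Hn.
  assert (Hz0 : z <> RtoC 0) by (apply Cmod_gt_0; lra).
  set (y := fun i => INR (S n + i)).
  assert (Hy : forall i, INR (S n) <= y i).
  { intros i; unfold y; rewrite plus_INR. generalize (pos_INR i). lra. }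
  assert (HyS : forall i, y (S i) = y i + 1) by (intros i; unfold y; apply INR_step).
  assert (Hn1 := INR_S_pos n).
  set (b := fun i => Cinv (pow_ratio z (y i))).
  set (Q := fun i => pow_prim z (y i)).
  assert (Hb : forall i, pow_ratio z (y i) <> RtoC 0 /\ Cmod (b i) <= 2 /\
    Cmod (Cminus (b i) (RtoC 1)) <= 2 * (1 + 3 * Cmod z) / y i /\
    Cmod (Cminus (b (S i)) (b i)) <= 4 * (1 + 6 * Cmod z) / (y i * y i)).
  { intros i. unfold b. rewrite HyS. apply pow_ratio_inv; auto. generalize (Hy i); lra. }
  assert (HQ : forall i, Cmod (Q i) <= Rpower (y i) (2 - x0) / Cmod z).
  { intros i. apply Cmod_pow_prim_le; auto; [generalize (Hy i); lra|lra]. }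
  rewrite (csum_ext _ (fun i => Cmult (b i) (Cminus (Q i) (Q (S i))))).
  2:{ intros i _. unfold Q, b. rewrite HyS, pow_prim_step; auto.
      - fold (y i). field. apply Hb.
      - generalize (Hy i); lra. }
  rewrite csum_abel.
  fold (y (S m)). fold (Q (S m)).
  (* The end term [- b m * Q (S m)] of the Abel summation may grow with [m]. Joined to the added
     [Q (S m)] it acquires the factor [1 - b m], which is small. *)
  replace (Cplus _ (Q (S m))) with (Cplus (Cplus (Cmult (b O) (Q O))
     (Cmult (Cminus (RtoC 1) (b m)) (Q (S m))))
     (csum (fun i => Cmult (Q (S i)) (Cminus (b (S i)) (b i))) m)) by ring.
  eapply Rle_trans; [apply Cmod_triangle|].
  eapply Rle_trans; [apply Rplus_le_compat_r, Cmod_triangle|].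
  rewrite !Rmult_plus_distr_r.
  assert (Hmono : forall t, INR (S n) <= t -> Rpower t (1 - x0) <= Rpower (INR (S n)) (2 - x0)).
  { intros t Ht. apply Rle_trans with (Rpower (INR (S n)) (1 - x0)).
    - apply Rpower_ge_l; lra.
    - apply Rpower_le_r; lra. }
  apply Rplus_le_compat; [apply Rplus_le_compat|].
  - rewrite Cmod_mult. apply Rmult_le_compat; try apply Cmod_ge_0; [apply Hb|].
    unfold Q, y. rewrite Nat.add_0_r. apply Cmod_pow_prim_le_1; auto; lra.
  - rewrite Cmod_mult, Cmod_minus_sym.
    destruct (Hb m) as (_ & _ & B & _). specialize (HQ (S m)).
    eapply Rle_trans; [apply Rmult_le_compat; try apply Cmod_ge_0; [exact B|exact HQ]|].
    assert (Hym := Hy m). assert (HI := Rinv_half_shift (y m) ltac:(lra)).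
    rewrite HyS. assert (HP := Rpower_pos (y m + 1) (2 - x0)).
    assert (HO := one_plus_ratio 3 (Cmod z) ltac:(lra) Hz).
    apply Rle_trans with (2 * (/ Cmod z * (1 + 3 * Cmod z)) * (/ y m) * Rpower (y m + 1) (2 - x0)).
    { right; field; lra. }
    apply Rle_trans with (16 * (Rpower (y m + 1) (2 - x0) * / (y m + 1))).
    { apply Rle_trans with (2 * (1 + 3) * (2 * / (y m + 1)) * Rpower (y m + 1) (2 - x0)); [|right; ring].
      apply Rmult_le_compat_r; [lra|]. apply Rmult_le_compat; try lra.
      - apply Rmult_le_pos; [lra|]. apply Rmult_le_pos; [|lra].
        apply Rlt_le, Rinv_0_lt_compat; lra.
      - apply Rlt_le, Rinv_0_lt_compat; lra. }
    apply Rmult_le_compat_l; [lra|].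
    replace (Rpower (y m + 1) (2 - x0) * / (y m + 1)) with (Rpower (y m + 1) (2 - x0 - 1))
      by (apply Rpower_Pr; lra).
    replace (2 - x0 - 1) with (1 - x0) by ring. apply Hmono; lra.
  - apply Rle_trans with (rsum (fun i => 112 * Rpower (y i + 1) (- x0)) m).
    + apply csum_bound. intros i _. rewrite Cmod_mult.
      destruct (Hb i) as (_ & _ & _ & B). specialize (HQ (S i)).
      eapply Rle_trans; [apply Rmult_le_compat; try apply Cmod_ge_0; [exact HQ|exact B]|].
      assert (Hyi := Hy i). assert (HI := Rinv_half_shift (y i) ltac:(lra)).
      rewrite HyS. assert (HP := Rpower_pos (y i + 1) (2 - x0)).
      assert (HO := one_plus_ratio 6 (Cmod z) ltac:(lra) Hz).
      assert (0 < / y i) by (apply Rinv_0_lt_compat; lra).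
      apply Rle_trans with (4 * (/ Cmod z * (1 + 6 * Cmod z)) * (/ y i * / y i) * Rpower (y i + 1) (2 - x0)).
      { right; field; lra. }
      replace (- x0) with (2 - x0 - 1 - 1) by ring. rewrite !Rpower_Pr by lra.
      apply Rle_trans with (4 * (1 + 6) * ((2 * / (y i + 1)) * (2 * / (y i + 1))) * Rpower (y i + 1) (2 - x0));
        [|right; field; lra].
      apply Rmult_le_compat_r; [lra|]. apply Rmult_le_compat; try lra.
      * apply Rmult_le_pos; [lra|]. apply Rmult_le_pos; [|lra].
        apply Rlt_le, Rinv_0_lt_compat; lra.
      * apply Rmult_le_pos; lra.
      * apply Rmult_le_compat; lra.
    + rewrite rsum_scal, Rmult_assoc. apply Rmult_le_compat_l; [lra|].
      eapply Rle_trans; [apply HT|]. apply Rmult_le_compat_l; [lra|]. apply Hmono; lra.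
Qed.

(* [At] is the smoothed coefficient sequence; multiplied by [pow_prim] its increments are
   [c (k+1)^(-s2) / z] up to summable terms, so a single Abel summation turns the
   series into a zeta tail and absolutely convergent pieces.  The two terms
   [pow_prim _ (INR (S n + S (S m)))] are the counterterms that continue the partial sums. *)
Lemma smooth_tail_bound (a0 kap theta C1 C2 C3 : R) (c s2 : C) (At d tau : nat -> C) :
  1 < a0 + kap -> kap <= Re s2 -> kap <= 1 -> 0 < theta ->
  0 <= C1 -> 0 <= C2 -> 0 <= C3 ->
  (forall k, Cmod (At (S k)) <= C1 * Rpower (INR (S k)) (1 - kap)) ->
  (forall k, Cminus (At (S (S k))) (At (S k)) =
     Cplus (Cmult c (cpow (INR (S (S k))) (Copp s2))) (d (S k))) ->
  (forall k, Cmod (d (S k)) <= C2 * Rpower (INR (S (S k))) (- 1 - kap)) ->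
  (forall k, Cmod (tau (S k)) <= C3 * Rpower (INR (S k)) (- Re s2)) ->
  exists K, 0 < K /\ forall (z : C) (n m : nat),
    let z' := Cminus (Cplus z s2) (RtoC 1) in
    a0 - 1 <= Re z -> 1 <= Cmod z -> 1 <= Cmod z' ->
    theta * INR (S n) <= Cmod z ->
    2 + 6 * Cmod z <= INR (S n) -> 2 + 6 * Cmod z' <= INR (S n) ->
    Cmod (Cplus (Cplus
      (csum (fun i => Cmult (Cminus (At (S n + i)%nat) (tau (S n + i)%nat))
         (cpow (INR (S n + i)) (Cminus (Copp z) (RtoC 1)))) (S (S m)))
      (Cmult (At (S n + S m)%nat) (pow_prim z (INR (S n + S (S m))))))
      (Cmult (Cdiv c z) (pow_prim z' (INR (S n + S (S m))))))
    <= K * Rpower (INR (S n)) (1 - a0 - kap).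
Proof.
  intros Hq Hks Hk1 Hth HC1 HC2 HC3 HA HdA Hd Htau.
  set (x0 := a0 + Re s2).
  assert (Hx0 : 1 < x0) by (unfold x0; lra).
  destruct (zeta_tail_bound x0 Hx0) as [Kz [HKz HZ]].
  destruct (power_tail_decreasing (a0 + kap) Hq) as [Kp [HKp HP]].
  destruct (power_tail_le x0 Hx0) as [Kq [HKq HPq]].
  (* One summand for each part of the error [e i] below: the variation of [b], the difference
     [b - 1] multiplied by the main increment, and the remainder [d]. *)
  set (Ce := 112 * C1 + 16 * Cmod c + 2 * C2).
  assert (Hc0 := Cmod_ge_0 c).
  exists (2 * C1 / theta + 16 * C1 + Ce * Kp + 2 * Cmod c * Kz / theta + C3 * Kq + 1).
  assert (Hth' : 0 < / theta) by (apply Rinv_0_lt_compat; auto).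
  split.
  { unfold Ce.
    assert (0 <= 2 * C1 / theta) by (apply Rmult_le_pos; lra).
    assert (0 <= 2 * Cmod c * Kz / theta) by (apply Rmult_le_pos; [apply Rmult_le_pos|]; lra).
    assert (0 <= C3 * Kq) by (apply Rmult_le_pos; lra).
    assert (0 <= (112 * C1 + 16 * Cmod c + 2 * C2) * Kp) by (apply Rmult_le_pos; lra). lra. }
  intros z n m z' Hre Hz Hz' Hthz Hn Hn'.
  assert (Hz0 : z <> RtoC 0) by (apply Cmod_gt_0; lra).
  set (y := fun i => INR (S n + i)).
  assert (Hy : forall i, INR (S n) <= y i).
  { intros i; unfold y; rewrite plus_INR. generalize (pos_INR i). lra. }
  assert (HyS : forall i, y (S i) = y i + 1) by (intros i; unfold y; apply INR_step).
  assert (Hn1 := INR_S_pos n).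
  set (N := INR (S n)) in *.
  set (A := fun i => At (S n + i)%nat).
  set (b := fun i => Cinv (pow_ratio z (y i))).
  set (Q := fun i => pow_prim z (y i)).
  assert (Hb : forall i, pow_ratio z (y i) <> RtoC 0 /\ Cmod (b i) <= 2 /\
    Cmod (Cminus (b i) (RtoC 1)) <= 2 * (1 + 3 * Cmod z) / y i /\
    Cmod (Cminus (b (S i)) (b i)) <= 4 * (1 + 6 * Cmod z) / (y i * y i)).
  { intros i. unfold b. rewrite HyS. apply pow_ratio_inv; auto. generalize (Hy i); lra. }
  assert (HQ : forall i, Cmod (Q i) <= Rpower (y i) (1 - a0) / Cmod z).
  { intros i. apply Cmod_pow_prim_le; auto; [generalize (Hy i); lra|lra]. }
  assert (HAi : forall i, Cmod (A i) <= C1 * Rpower (y i) (1 - kap)) by (intros i; apply HA).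
  assert (Hiz : 0 < / Cmod z) by (apply Rinv_0_lt_compat; lra).
  set (V := fun i => cpow (y i) (Cminus (Copp z') (RtoC 1))).
  (* The main increment of [At], multiplied by [Q], is a pure power again, with exponent [- z' - 1];
     its sum is the zeta tail, divided by [z]. *)
  assert (HV : forall i, Cmult (Q (S i)) (Cmult c (cpow (y (S i)) (Copp s2))) = Cmult (Cdiv c z) (V (S i))).
  { intros i. unfold Q, V, pow_prim, z'.
    replace (Cminus (Copp (Cminus (Cplus z s2) 1)) 1) with (Cplus (Copp z) (Copp s2)) by ring.
    rewrite cpow_plus. field. auto. }
  set (e := fun i => Cminus (Cmult (Q (S i)) (Cminus (Cmult (A (S i)) (b (S i))) (Cmult (A i) (b i))))
     (Cmult (Cdiv c z) (V (S i)))).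
  assert (He : forall i, Cmod (e i) <= Ce * Rpower (y i + 1) (- (a0 + kap))).
  { intros i.
    assert (HdA' : Cminus (A (S i)) (A i) = Cplus (Cmult c (cpow (y (S i)) (Copp s2))) (d (S n + i)%nat)).
    { unfold A, y. rewrite <- plus_n_Sm. apply (HdA (n + i)%nat). }
    assert (Hd' : Cmod (d (S n + i)%nat) <= C2 * Rpower (y i + 1) (- 1 - kap)).
    { rewrite <- HyS. unfold y. rewrite <- plus_n_Sm. apply (Hd (n + i)%nat). }
    replace (e i) with (Cplus (Cplus
      (Cmult (Cmult (Q (S i)) (A (S i))) (Cminus (b (S i)) (b i)))
      (Cmult (Cmult (Cdiv c z) (V (S i))) (Cminus (b i) (RtoC 1))))
      (Cmult (Cmult (Q (S i)) (d (S n + i)%nat)) (b i))).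
    2:{ unfold e.
        replace (A (S i)) with (Cplus (A i) (Cplus (Cmult c (cpow (y (S i)) (Copp s2))) (d (S n + i)%nat)))
          by (rewrite <- HdA'; ring).
        rewrite <- HV. ring. }
    destruct (Hb i) as (_ & B1 & B2 & B3).
    assert (HQi := HQ (S i)). assert (HAi' := HAi (S i)). rewrite HyS in *.
    assert (Hyi := Hy i). assert (HI := Rinv_half_shift (y i) ltac:(lra)).
    assert (Hiy : 0 < / y i) by (apply Rinv_0_lt_compat; lra).
    assert (HO3 := one_plus_ratio 3 (Cmod z) ltac:(lra) Hz).
    assert (HO6 := one_plus_ratio 6 (Cmod z) ltac:(lra) Hz).
    set (P := Rpower (y i + 1)) in *.
    assert (HP0 : forall t, 0 < P t) by (intros; apply Rpower_pos).
    assert (HPm : forall t, P (t - 1) = P t * / (y i + 1)) by (intros; unfold P; apply Rpower_Pr; lra).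
    assert (HPp : forall s t, P (s + t) = P s * P t) by (intros; unfold P; apply Rpower_plus).
    unfold Ce. eapply Rle_trans; [apply Cmod_triangle|].
    eapply Rle_trans; [apply Rplus_le_compat_r, Cmod_triangle|].
    rewrite !Rmult_plus_distr_r.
    apply Rplus_le_compat; [apply Rplus_le_compat|].
    - rewrite !Cmod_mult.
      apply Rle_trans with (P (1 - a0) / Cmod z * (C1 * P (1 - kap)) * (4 * (1 + 6 * Cmod z) / (y i * y i))).
      { apply Rmult_le_compat; auto; try apply Cmod_ge_0.
        - apply Rmult_le_pos; apply Cmod_ge_0.
        - apply Rmult_le_compat; auto; apply Cmod_ge_0. }
      replace (- (a0 + kap)) with ((1 - a0) + (1 - kap) - 1 - 1) by ring.
      rewrite !HPm, HPp.
      apply Rle_trans with (C1 * (P (1 - a0) * P (1 - kap)) * (4 * (/ Cmod z * (1 + 6 * Cmod z)) * (/ y i * / y i))).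
      { right; field; lra. }
      apply Rle_trans with (C1 * (P (1 - a0) * P (1 - kap)) * (4 * (1 + 6) * ((2 * / (y i + 1)) * (2 * / (y i + 1))))).
      2:{ right; field; lra. }
      apply Rmult_le_compat_l.
      { apply Rmult_le_pos; auto. apply Rmult_le_pos; left; auto. }
      apply Rmult_le_compat; try lra.
      + apply Rmult_le_pos; [lra|]. apply Rmult_le_pos; lra.
      + apply Rmult_le_pos; lra.
      + apply Rmult_le_compat; lra.
    - rewrite !Cmod_mult, Cmod_div by auto.
      assert (HVi : Cmod (V (S i)) <= P (1 - x0)).
      { unfold V. rewrite Cmod_cpow, HyS. apply Rpower_le_r; [lra|].
        rewrite Re_minus, re_opp. unfold z'. rewrite Re_minus, re_plus. simpl. unfold x0. lra. }
      apply Rle_trans with (Cmod c / Cmod z * P (1 - x0) * (2 * (1 + 3 * Cmod z) / y i)).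
      { apply Rmult_le_compat; auto; try apply Cmod_ge_0.
        - apply Rmult_le_pos; [|apply Cmod_ge_0]. apply Rmult_le_pos; lra.
        - apply Rmult_le_compat_l; auto. apply Rmult_le_pos; lra. }
      apply Rle_trans with (Cmod c * P (1 - x0) * (2 * (/ Cmod z * (1 + 3 * Cmod z)) * / y i)).
      { right; field; lra. }
      apply Rle_trans with (Cmod c * P (1 - x0) * (2 * (1 + 3) * (2 * / (y i + 1)))).
      { apply Rmult_le_compat_l.
        { apply Rmult_le_pos; auto. left; auto. }
        apply Rmult_le_compat; try lra. apply Rmult_le_pos; [lra|]. apply Rmult_le_pos; lra. }
      apply Rle_trans with (16 * Cmod c * P (1 - x0 - 1)).
      { rewrite HPm. right; ring. }
      apply Rmult_le_compat_l; [lra|]. unfold P. apply Rpower_le_r; [lra|]. unfold x0; lra.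
    - rewrite !Cmod_mult.
      apply Rle_trans with (P (1 - a0) / Cmod z * (C2 * P (- 1 - kap)) * 2).
      { apply Rmult_le_compat; auto; try apply Cmod_ge_0.
        - apply Rmult_le_pos; apply Cmod_ge_0.
        - apply Rmult_le_compat; auto; apply Cmod_ge_0. }
      replace (- (a0 + kap)) with ((1 - a0) + (- 1 - kap)) by ring. rewrite HPp.
      apply Rle_trans with (/ Cmod z * (2 * C2 * (P (1 - a0) * P (- 1 - kap)))).
      { right; field; lra. }
      apply Rle_trans with (1 * (2 * C2 * (P (1 - a0) * P (- 1 - kap)))); [|lra].
      apply Rmult_le_compat_r.
      { apply Rmult_le_pos; [lra|]. apply Rmult_le_pos; left; auto. }
      rewrite <- Rinv_1. apply Rinv_le_contravar; lra. }
  assert (E : csum (fun i => Cmult (Cminus (At (S n + i)%nat) (tau (S n + i)%nat))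
         (cpow (INR (S n + i)) (Cminus (Copp z) (RtoC 1)))) (S (S m)) =
    Cminus (Cplus (Cminus (Cmult (Cmult (A O) (b O)) (Q O)) (Cmult (Cmult (A (S m)) (b (S m))) (Q (S (S m)))))
      (Cplus (csum e (S m)) (Cmult (Cdiv c z) (csum (fun i => V (S i)) (S m)))))
      (csum (fun i => Cmult (tau (S n + i)%nat) (cpow (y i) (Cminus (Copp z) (RtoC 1)))) (S (S m)))).
  { rewrite <- csum_scal, <- csum_plus.
    rewrite (csum_ext (fun i => Cplus (e i) _) (fun i => Cmult (Q (S i))
      (Cminus (Cmult (A (S i)) (b (S i))) (Cmult (A i) (b i)))) (S m)).
    2:{ intros i _. unfold e. ring. }
    rewrite <- (csum_abel (fun i => Cmult (A i) (b i)) Q (S m)), <- csum_minus.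
    apply csum_ext. intros i _. unfold Q, b. rewrite HyS, pow_prim_step; auto.
    - fold (y i). unfold A. field. apply Hb.
    - generalize (Hy i); lra. }
  rewrite E. fold (y (S (S m))). fold (Q (S (S m))). fold (A (S m)).
  set (Zt := Cplus (csum (fun i => V (S i)) (S m)) (pow_prim z' (y (S (S m))))).
  set (Tt := csum (fun i => Cmult (tau (S n + i)%nat) (cpow (y i) (Cminus (Copp z) (RtoC 1)))) (S (S m))).
  match goal with |- Cmod ?X <= _ => replace X with
    (Cminus (Cplus (Cplus (Cplus (Cmult (Cmult (A O) (b O)) (Q O))
      (Cmult (Cmult (A (S m)) (Cminus (RtoC 1) (b (S m)))) (Q (S (S m))))) (csum e (S m)))
      (Cmult (Cdiv c z) Zt)) Tt) by (unfold Zt, Tt; ring) end.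
  assert (PN : forall t, 0 < Rpower N t) by (intros; apply Rpower_pos).
  set (X := Rpower N (1 - a0 - kap)).
  assert (HX : 0 < X) by apply PN.
  assert (HNX : Rpower N ((1 - a0) + (1 - kap)) = N * X).
  { replace ((1 - a0) + (1 - kap)) with ((1 - a0 - kap) + 1) by ring. apply Rpower_Sr; lra. }
  (* The hypothesis with [theta] acts here: in the first boundary term and in the zeta tail,
     [1 / |z|] is worth a factor [1 / N]. *)
  assert (HNz : N * / Cmod z <= / theta).
  { apply Rmult_le_reg_r with (theta * Cmod z); [apply Rmult_lt_0_compat; lra|].
    replace (N * / Cmod z * (theta * Cmod z)) with (theta * N) by (field; lra).
    replace (/ theta * (theta * Cmod z)) with (Cmod z) by (field; lra). auto. }
  assert (HxX : forall t, N <= t -> Rpower t (1 - a0 - kap) <= X).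
  { intros t Ht. apply Rpower_ge_l; lra. }
  assert (T1 : Cmod (Cmult (Cmult (A O) (b O)) (Q O)) <= 2 * C1 / theta * X).
  { rewrite !Cmod_mult.
    specialize (HAi O). specialize (HQ O). destruct (Hb O) as (_ & B1 & _).
    replace (y O) with N in * by (unfold y; rewrite Nat.add_0_r; reflexivity).
    apply Rle_trans with (C1 * Rpower N (1 - kap) * 2 * (Rpower N (1 - a0) / Cmod z)).
    { apply Rmult_le_compat; auto; try apply Cmod_ge_0.
      - apply Rmult_le_pos; apply Cmod_ge_0.
      - apply Rmult_le_compat; auto; apply Cmod_ge_0. }
    apply Rle_trans with (2 * C1 * (/ Cmod z * Rpower N ((1 - a0) + (1 - kap)))).
    { rewrite Rpower_plus. right; field; lra. }
    rewrite HNX.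
    apply Rle_trans with (2 * C1 * X * (N * / Cmod z)); [right; ring|].
    apply Rle_trans with (2 * C1 * X * / theta); [|right; field; lra].
    apply Rmult_le_compat_l; auto. apply Rmult_le_pos; lra. }
  assert (T2 : Cmod (Cmult (Cmult (A (S m)) (Cminus (RtoC 1) (b (S m)))) (Q (S (S m)))) <= 16 * C1 * X).
  { rewrite !Cmod_mult, (Cmod_minus_sym (RtoC 1)).
    specialize (HAi (S m)). specialize (HQ (S (S m))). destruct (Hb (S m)) as (_ & _ & B2 & _).
    rewrite (HyS (S m)) in *. assert (Hym := Hy (S m)). set (t := y (S m)) in *.
    assert (HI := Rinv_half_shift t ltac:(lra)).
    assert (Hit : 0 < / t) by (apply Rinv_0_lt_compat; lra).
    assert (HO3 := one_plus_ratio 3 (Cmod z) ltac:(lra) Hz).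
    apply Rle_trans with (C1 * Rpower (t + 1) (1 - kap) * (2 * (1 + 3 * Cmod z) / t) * (Rpower (t + 1) (1 - a0) / Cmod z)).
    { apply Rmult_le_compat; auto; try apply Cmod_ge_0.
      - apply Rmult_le_pos; apply Cmod_ge_0.
      - apply Rmult_le_compat; auto; try apply Cmod_ge_0.
        eapply Rle_trans; [exact HAi|]. apply Rmult_le_compat_l; auto.
        apply Rpower_le_l; lra. }
    apply Rle_trans with (C1 * Rpower (t + 1) ((1 - a0) + (1 - kap)) * (2 * (/ Cmod z * (1 + 3 * Cmod z)) * / t)).
    { rewrite Rpower_plus. right; field; lra. }
    apply Rle_trans with (C1 * Rpower (t + 1) ((1 - a0) + (1 - kap)) * (2 * (1 + 3) * (2 * / (t + 1)))).
    { apply Rmult_le_compat_l.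
      - apply Rmult_le_pos; auto. apply Rlt_le, Rpower_pos.
      - apply Rmult_le_compat; try lra. apply Rmult_le_pos; [lra|]. apply Rmult_le_pos; lra. }
    apply Rle_trans with (16 * C1 * Rpower (t + 1) ((1 - a0) + (1 - kap) - 1)).
    { rewrite Rpower_Pr by lra. right; field; lra. }
    apply Rmult_le_compat_l; [lra|].
    replace ((1 - a0) + (1 - kap) - 1) with (1 - a0 - kap) by ring. apply HxX; lra. }
  assert (T3 : Cmod (csum e (S m)) <= Ce * Kp * X).
  { eapply Rle_trans; [apply csum_bound; intros i _; apply He|].
    rewrite rsum_scal, Rmult_assoc. apply Rmult_le_compat_l; [unfold Ce; lra|].
    eapply Rle_trans; [apply HP|]. right. unfold X, N. f_equal. f_equal. ring. }
  assert (T4 : Cmod (Cmult (Cdiv c z) Zt) <= 2 * Cmod c * Kz / theta * X).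
  { rewrite Cmod_mult, Cmod_div by auto.
    assert (HZt : Cmod Zt <= Kz * Rpower (N + 1) (2 - x0)).
    { specialize (HZ z' (S n) m). rewrite (S_INR (S n)) in HZ. fold N in HZ.
      assert (Hr : x0 - 2 <= Re z') by (unfold z'; rewrite Re_minus, re_plus; simpl; unfold x0; lra).
      specialize (HZ Hr Hz' ltac:(lra)).
      unfold Zt, V. replace (y (S (S m))) with (INR (S (S n) + S m)) by (unfold y; f_equal; lia).
      erewrite csum_ext; [exact HZ|]. intros i _. cbn beta. unfold y.
      replace (S n + S i)%nat with (S (S n) + i)%nat by lia. reflexivity. }
    assert (H2 : Rpower (N + 1) (2 - x0) <= 2 * N * X).
    { replace (2 - x0) with ((1 - x0) + 1) by ring. rewrite Rpower_Sr by lra.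
      apply Rmult_le_compat; try lra.
      - apply Rlt_le, Rpower_pos.
      - apply Rle_trans with (Rpower (N + 1) (1 - a0 - kap)); [|apply HxX; lra].
        apply Rpower_le_r; [lra|]. unfold x0; lra. }
    apply Rle_trans with (Cmod c / Cmod z * (Kz * (2 * N * X))).
    { apply Rmult_le_compat_l; [apply Rmult_le_pos; lra|].
      eapply Rle_trans; [exact HZt|]. apply Rmult_le_compat_l; lra. }
    apply Rle_trans with (2 * Cmod c * Kz * X * (N * / Cmod z)); [right; field; lra|].
    apply Rle_trans with (2 * Cmod c * Kz * X * / theta); [|right; field; lra].
    apply Rmult_le_compat_l; auto. repeat apply Rmult_le_pos; lra. }
  assert (T5 : Cmod Tt <= C3 * Kq * X).
  { unfold Tt. apply Rle_trans with (rsum (fun i => C3 * Rpower (INR (S n + i)) (- x0)) (S (S m))).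
    - apply csum_bound. intros i _. rewrite Cmod_mult, Cmod_cpow.
      apply Rle_trans with (C3 * Rpower (y i) (- Re s2) * Rpower (y i) (- a0)).
      + apply Rmult_le_compat; try apply Cmod_ge_0; [apply Rlt_le, Rpower_pos|apply (Htau (n + i)%nat)|].
        apply Rpower_le_r; [generalize (Hy i); lra|]. rewrite Re_minus, re_opp. simpl. lra.
      + rewrite Rmult_assoc, <- Rpower_plus. right. unfold y, x0. f_equal. f_equal. ring.
    - rewrite rsum_scal, Rmult_assoc. apply Rmult_le_compat_l; auto.
      eapply Rle_trans; [apply HPq|]. apply Rmult_le_compat_l; [lra|].
      fold N. unfold X. apply Rpower_le_r; [lra|]. unfold x0; lra. }
  eapply Rle_trans; [apply Cmod_minus_le|].
  eapply Rle_trans; [apply Rplus_le_compat_r, Cmod_triangle|].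
  eapply Rle_trans; [apply Rplus_le_compat_r, Rplus_le_compat_r, Cmod_triangle|].
  eapply Rle_trans; [apply Rplus_le_compat_r, Rplus_le_compat_r, Rplus_le_compat_r, Cmod_triangle|].
  lra.
Qed.

(** * Riemann sums of functions with a power singularity *)

Definition riemann_sum (g : R -> C) (K : nat) : C :=
  Cmult (RtoC (/ INR K)) (csum (fun i => g (INR i / INR K)) K).

Lemma csum_mul (f : nat -> C) (K L : nat) :
  csum f (K * L) = csum (fun n => csum (fun r => f (n * L + r)%nat) L) K.
Proof.
  induction K; [reflexivity|]. simpl. rewrite <- IHK, <- csum_split. f_equal. lia.
Qed.

Lemma C_cauchy_rate (u : nat -> C) (v : nat -> R) :
  (forall n, 0 <= v n) -> is_lim_seq v 0 ->
  (forall n m, (1 <= n)%nat -> (1 <= m)%nat -> Cmod (Cminus (u n) (u m)) <= v n + v m) ->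
  exists l, forall n, (1 <= n)%nat -> Cmod (Cminus (u n) l) <= v n.
Proof.
  intros Hv Hlim Hu.
  assert (Hl : forall eps, 0 < eps -> exists N, (1 <= N)%nat /\ forall n, (n >= N)%nat -> v n < eps).
  { intros eps He. apply is_lim_seq_spec in Hlim. destruct (Hlim (mkposreal eps He)) as [N HN].
    exists (S N). split; [lia|]. intros n Hn. specialize (HN n ltac:(lia)). simpl in HN.
    rewrite Rminus_0_r in HN. generalize (Rle_abs (v n)). lra. }
  assert (HC : Cauchy_crit (fun n => Re (u n)) /\ Cauchy_crit (fun n => Im (u n))).
  { split; intros eps He; destruct (Hl (eps / 2) ltac:(lra)) as [N [HN1 HN]]; exists N; intros n m Hn Hm;
    unfold R_dist; [rewrite <- Re_minus|rewrite <- Im_minus];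
    generalize (re_le_Cmod (Cminus (u n) (u m))) (im_le_Cmod (Cminus (u n) (u m)))
      (Hu n m ltac:(lia) ltac:(lia)) (HN n Hn) (HN m Hm); lra. }
  destruct HC as [HC1 HC2].
  destruct (Rcomplete.R_complete _ HC1) as [l1 L1]. destruct (Rcomplete.R_complete _ HC2) as [l2 L2].
  exists ((l1, l2) : C). intros n Hn.
  apply Rle_plus_epsilon. intros eps He.
  destruct (L1 (eps / 4) ltac:(lra)) as [N1 K1]. destruct (L2 (eps / 4) ltac:(lra)) as [N2 K2].
  destruct (Hl (eps / 4) ltac:(lra)) as [N3 [H31 K3]].
  set (m := (N1 + N2 + N3)%nat).
  specialize (K1 m ltac:(unfold m; lia)). specialize (K2 m ltac:(unfold m; lia)).
  specialize (K3 m ltac:(unfold m; lia)). specialize (Hu n m Hn ltac:(unfold m; lia)).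
  unfold R_dist in K1, K2.
  eapply Rle_trans; [apply (Cmod_triangle3 _ (u m))|].
  generalize (Cmod_le_Re_Im (Cminus (u m) (l1, l2))). rewrite Re_minus, Im_minus. simpl.
  unfold Re, Im in *. lra.
Qed.

Lemma Rpower_lim_0 (e : R) : e < 0 -> is_lim_seq (fun n => Rpower (INR (S n)) e) 0.
Proof.
  intros He. apply is_lim_seq_spec. intros [eps Heps]. simpl.
  assert (Hq : 0 < - / e) by (apply Ropp_0_gt_lt_contravar, Rinv_lt_0_compat, He).
  destruct (INR_unbounded (Rpower (/ eps) (- / e))) as [N HN].
  exists N. intros n Hn. rewrite Rminus_0_r, Rabs_right by (apply Rle_ge, Rlt_le, Rpower_pos).
  assert (Hx : Rpower (/ eps) (- / e) < INR (S n)).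
  { apply Rlt_le_trans with (INR N); [exact HN|]. apply le_INR; lia. }
  replace eps with (Rpower (Rpower (/ eps) (- / e)) e).
  - change (exp (e * ln (INR (S n))) < exp (e * ln (Rpower (/ eps) (- / e)))). apply exp_increasing.
    assert (ln (Rpower (/ eps) (- / e)) < ln (INR (S n))) by (apply ln_increasing; [apply Rpower_pos|auto]).
    nra.
  - rewrite Rpower_mult. replace (- / e * e) with (-1) by (field; lra).
    unfold Rpower. rewrite ln_Rinv by auto. replace (-1 * - ln eps) with (ln eps) by ring. apply exp_ln; auto.
Qed.

(* The sums for [K] and [L] are both compared with the one for the common refinement [K * L]. *)
Lemma riemann_sum_rate (g : R -> C) (B gam : R) :
  3 / 4 <= gam < 3 / 2 -> 0 <= B ->
  (forall u, u <= 0 -> g u = RtoC 0) -> (forall u, 1 / 2 < u -> g u = RtoC 0) ->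
  (forall u, 0 < u <= 1 / 2 -> Cmod (g u) <= B * Rpower u (1 - gam)) ->
  (forall u v, 0 < u <= v -> v <= 1 / 2 -> Cmod (Cminus (g v) (g u)) <= B * Rpower u (- gam) * (v - u)) ->
  exists beta K0, 0 < K0 /\ forall K, (1 <= K)%nat ->
    Cmod (Cminus (riemann_sum g K) beta) <= K0 * Rpower (INR K) (gam - 7 / 4).
Proof.
  intros Hgam HB Hg0 Hg1 Hb Hlip.
  destruct (power_sum_le (gam - 1) ltac:(lra)) as [K1 [HK1 HS1]].
  destruct (power_sum_le (3 / 4) ltac:(lra)) as [K2 [HK2 HS2]].
  set (D := B * K1 + B * K2 + 4 * B).
  assert (HD : 0 <= D) by (unfold D; nra).
  assert (Href : forall K L, (1 <= K)%nat -> (1 <= L)%nat ->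
    Cmod (Cminus (riemann_sum g (K * L)) (riemann_sum g K)) <= D * Rpower (INR K) (gam - 7 / 4)).
  { intros K L HK HL.
    assert (HKr : 1 <= INR K) by (apply (le_INR 1); auto).
    assert (HLr : 1 <= INR L) by (apply (le_INR 1); auto).
    assert (HKi : 0 < / INR K) by (apply Rinv_0_lt_compat; lra).
    assert (HLi : 0 < / INR L) by (apply Rinv_0_lt_compat; lra).
    set (P := Rpower (INR K)).
    assert (HP : forall t, 0 < P t) by (intros; apply Rpower_pos).
    (* [chi n - chi (S n)] singles out the cell where [g] may jump at 1/2; as it telescopes, the
       jump costs a bounded amount in the sum over all cells. *)
    set (chi := fun n : nat => if Rle_dec (INR n / INR K) (1 / 2) then 1 else 0).
    (* For the [n]-th coarse cell, the mean over its [L] fine points of the deviation from the left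
       end point. *)
    set (E := fun n => Cmult (RtoC (/ INR L)) (csum (fun r => Cminus (g (INR (n * L + r) / INR (K * L)))
       (g (INR n / INR K))) L)).
    assert (Heq : Cminus (riemann_sum g (K * L)) (riemann_sum g K) = Cmult (RtoC (/ INR K)) (csum E K)).
    { unfold riemann_sum. rewrite csum_mul, mult_INR, Rinv_mult, RtoC_mult.
      unfold E. rewrite csum_scal.
      rewrite (csum_ext (fun n => csum (fun r => Cminus _ _) L) (fun n => Cminus
        (csum (fun r => g (INR (n * L + r) / (INR K * INR L))) L) (Cmult (RtoC (INR L)) (g (INR n / INR K))))).
      2:{ intros n _. rewrite csum_minus. rewrite mult_INR. f_equal.
          clear. induction L; [simpl; ring|]. rewrite S_INR, RtoC_plus.
          change (csum ?f (S L)) with (Cplus (csum f L) (f L)). cbn beta. rewrite IHL. ring. }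
      rewrite csum_minus, csum_scal.
      replace (RtoC (/ INR L)) with (Cinv (RtoC (INR L))) by (rewrite RtoC_inv; auto; lra).
      field. intros H; injection H; lra. }
    rewrite Heq, Cmod_mult, Cmod_R, Rabs_right by lra.
    (* In the cell at the singularity the difference bound is useless; the size bound is summed
       instead, the sample at 0 being 0. *)
    assert (HE0 : Cmod (E O) <= B * K1 * P (gam - 1)).
    { unfold E. rewrite Cmod_mult, Cmod_R, Rabs_right by lra.
      destruct L as [|L]; [lia|]. rewrite csum_shift.
      replace (g (INR 0 / INR K)) with (RtoC 0) by (rewrite Hg0; auto; simpl; unfold Rdiv; lra).
      rewrite (Hg0 (INR (0 * S L + 0) / INR (K * S L))) by (simpl; unfold Rdiv; lra).
      replace (Cplus (Cminus (RtoC 0) (RtoC 0)) _) with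
        (csum (fun i => Cminus (g (INR (0 * S L + S i) / INR (K * S L))) (RtoC 0)) L) by ring.
      assert (HKL : 0 < INR (K * S L)) by (apply (lt_INR 0); lia).
      destruct L as [|L].
      { simpl. rewrite Cmod_0, Rmult_0_r. apply Rmult_le_pos; [nra|left; auto]. }
      set (y := INR (K * S (S L))) in *.
      apply Rle_trans with (/ INR (S (S L)) * rsum (fun i => B * Rpower y (gam - 1) * Rpower (INR (S i)) (- (gam - 1))) (S L)).
      - apply Rmult_le_compat_l; [lra|]. apply csum_bound. intros i Hi.
        replace (0 * S (S L) + S i)%nat with (S i) by lia.
        replace (Cminus _ (RtoC 0)) with (g (INR (S i) / y)) by ring.
        assert (Hi1 := INR_S_pos i).
        destruct (Rle_dec (INR (S i) / y) (1 / 2)) as [Hc|Hc].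
        + eapply Rle_trans; [apply Hb; split; auto; apply Rdiv_lt_0_compat; lra|].
          right. rewrite Rmult_assoc. f_equal.
          unfold Rdiv. rewrite <- Rpower_mult_distr by (try apply Rinv_0_lt_compat; lra).
          rewrite Rmult_comm. f_equal; [|f_equal; ring].
          unfold Rpower. rewrite ln_Rinv by auto. f_equal. ring.
        + rewrite Hg1 by lra. rewrite Cmod_0.
          repeat apply Rmult_le_pos; auto; apply Rlt_le, Rpower_pos.
      - rewrite rsum_scal.
        assert (Hm : rsum (fun i => Rpower (INR (S i)) (- (gam - 1))) (S L) <= K1 * Rpower (INR (S (S L))) (2 - gam)).
        { eapply Rle_trans; [apply HS1|]. apply Rmult_le_compat_l; [lra|].
          replace (1 - (gam - 1)) with (2 - gam) by ring. apply Rpower_le_l; [|lra].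
          split; [generalize (INR_S_pos L); lra|apply le_INR; lia]. }
        set (l := INR (S (S L))) in *.
        apply Rle_trans with (/ l * (B * Rpower y (gam - 1) * (K1 * Rpower l (2 - gam)))).
        { apply Rmult_le_compat_l; [lra|]. apply Rmult_le_compat_l; auto.
          apply Rmult_le_pos; auto. apply Rlt_le, Rpower_pos. }
        right. unfold y. rewrite mult_INR. fold l.
        rewrite <- Rpower_mult_distr by lra. fold P.
        replace (2 - gam) with (- (gam - 1) + 1) by ring. rewrite Rpower_Sr by lra.
        rewrite Rpower_Ropp. field. split; [apply Rgt_not_eq, Rpower_pos|lra]. }
    assert (HEn : forall n, (1 <= n)%nat -> Cmod (E n) <=
       B * P (gam - 1) * Rpower (INR n) (- gam) + 4 * B * (chi n - chi (S n))).
    { intros n Hn. assert (Hnr : 1 <= INR n) by (apply (le_INR 1); auto).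
      set (bd := B * P (gam - 1) * Rpower (INR n) (- gam) + 4 * B * (chi n - chi (S n))).
      assert (Hu0 : 0 < INR n / INR K) by (apply Rdiv_lt_0_compat; lra).
      assert (Hgen : forall r, (r < L)%nat -> Cmod (Cminus (g (INR (n * L + r) / INR (K * L))) (g (INR n / INR K))) <= bd).
      { intros r Hr.
        assert (Er : INR (n * L + r) / INR (K * L) = INR n / INR K + INR r / INR L * / INR K).
        { rewrite plus_INR, !mult_INR. field. lra. }
        rewrite Er.
        assert (Hr0 : 0 <= INR r / INR L <= 1).
        { split; [apply Rmult_le_pos; [apply pos_INR|lra]|].
          apply Rmult_le_reg_r with (INR L); [lra|]. unfold Rdiv. rewrite Rmult_assoc, Rinv_l by lra.
          rewrite Rmult_1_l, Rmult_1_r. apply le_INR; lia. }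
        set (u := INR n / INR K) in *. set (q := INR r / INR L * / INR K).
        assert (Hq : 0 <= q <= / INR K) by (unfold q; split; nra).
        assert (Hpos : 0 <= B * P (gam - 1) * Rpower (INR n) (- gam)).
        { repeat apply Rmult_le_pos; auto; apply Rlt_le; auto; apply Rpower_pos. }
        assert (HSn : INR (S n) / INR K = u + / INR K) by (unfold u; rewrite S_INR; field; lra).
        unfold bd, chi. rewrite HSn. fold u.
        destruct (Rle_dec u (1 / 2)) as [C1|C1]; [|destruct (Rle_dec (u + / INR K) (1 / 2)); [lra|];
          rewrite !Hg1 by lra; replace (Cminus _ _) with (RtoC 0) by ring; rewrite Cmod_0; lra].
        destruct (Rle_dec (u + / INR K) (1 / 2)) as [C2|C2].
        - eapply Rle_trans; [apply Hlip; lra|].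
          replace (u + q - u) with q by ring.
          apply Rle_trans with (B * Rpower u (- gam) * / INR K).
          { apply Rmult_le_compat_l; [|lra]. apply Rmult_le_pos; auto. apply Rlt_le, Rpower_pos. }
          apply Req_le. unfold u, Rdiv. rewrite <- Rpower_mult_distr by lra.
          unfold P. rewrite Rpower_Pr by lra.
          replace (Rpower (/ INR K) (- gam)) with (Rpower (INR K) gam); [field; lra|].
          unfold Rpower. rewrite ln_Rinv by lra. f_equal. ring.
        (* Since [n >= 1] gives [u >= / INR K], a cell that passes 1/2 starts beyond 1/4. There
           [|g| <= 2 * B], because [gam - 1 <= 1/2] and [4^(1/2) = 2]. *)
        - assert (Hu4 : 1 / 4 < u).
          { assert (/ INR K <= u) by (unfold u, Rdiv; nra). lra. }
          assert (Hbig : forall t, 1 / 4 < t -> Cmod (g t) <= 2 * B).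
          { intros t Ht. destruct (Rle_dec t (1 / 2)) as [C3|C3].
            - eapply Rle_trans; [apply Hb; lra|].
              rewrite (Rmult_comm 2 B). apply Rmult_le_compat_l; auto.
              destruct (Rle_dec gam 1) as [C4|C4].
              + apply Rle_trans with (Rpower 1 (1 - gam)); [apply Rpower_le_l; lra|].
                unfold Rpower. rewrite ln_1, Rmult_0_r, exp_0. lra.
              + apply Rle_trans with (Rpower (/ 4) (1 - gam)); [apply Rpower_ge_l; lra|].
                apply Rle_trans with (Rpower 4 (/ 2)).
                * replace (Rpower (/ 4) (1 - gam)) with (Rpower 4 (gam - 1)).
                  -- apply Rpower_le_r; lra.
                  -- unfold Rpower. rewrite ln_Rinv by lra. f_equal. ring.
                * rewrite Rpower_sqrt by lra. replace 4 with (2 * 2) by ring. rewrite sqrt_square; lra.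
            - rewrite Hg1 by lra. rewrite Cmod_0. lra. }
          eapply Rle_trans; [apply Cmod_minus_le|].
          generalize (Hbig u Hu4) (Hbig (u + q) ltac:(lra)). lra. }
      unfold E. rewrite Cmod_mult, Cmod_R, Rabs_right by lra.
      apply Rle_trans with (/ INR L * rsum (fun _ => bd) L).
      - apply Rmult_le_compat_l; [lra|]. apply csum_bound. exact Hgen.
      - rewrite rsum_const. right. field. lra. }
    assert (Hsum : Cmod (csum E K) <= D * P (gam - 3 / 4)).
    { destruct K as [|K]; [lia|].
      rewrite csum_shift. eapply Rle_trans; [apply Cmod_triangle|].
      assert (Hchi : forall n, 0 <= chi n <= 1) by (intros n; unfold chi; destruct Rle_dec; lra).
      assert (HPg : P (gam - 1) <= P (gam - 3 / 4)) by (apply Rpower_le_r; lra).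
      assert (H1P : 1 <= P (gam - 3 / 4)) by (apply Rpower_ge_1; lra).
      assert (Htail : Cmod (csum (fun i => E (S i)) K) <= B * K2 * P (gam - 3 / 4) + 4 * B).
      { apply Rle_trans with (rsum (fun i => B * P (gam - 1) * Rpower (INR (S i)) (- (3 / 4)) +
          4 * B * (chi (S i) - chi (S (S i)))) K).
        - apply csum_bound. intros i _. eapply Rle_trans; [apply HEn; lia|].
          apply Rplus_le_compat_r, Rmult_le_compat_l.
          + apply Rmult_le_pos; auto. left; auto.
          + apply Rpower_le_r; [apply INR_S_pos|lra].
        - rewrite rsum_plus, !rsum_scal, (rsum_telescope (fun i => chi (S i))).
          assert (H4 : 4 * B * (chi 1%nat - chi (S K)) <= 4 * B).
          { generalize (Hchi 1%nat) (Hchi (S K)). nra. }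
          apply Rplus_le_compat; auto.
          apply Rle_trans with (B * P (gam - 1) * (K2 * P (1 - 3 / 4))).
          + apply Rmult_le_compat_l; [apply Rmult_le_pos; auto; left; auto|].
            eapply Rle_trans; [|apply HS2]. apply rsum_incr; [lia|]. intros; apply Rlt_le, Rpower_pos.
          + right. replace (gam - 3 / 4) with ((gam - 1) + (1 - 3 / 4)) by lra.
            unfold P. rewrite Rpower_plus. ring. }
      unfold D. rewrite !Rmult_plus_distr_r. rewrite Rplus_assoc. apply Rplus_le_compat.
      - eapply Rle_trans; [exact HE0|]. apply Rmult_le_compat_l; [nra|auto].
      - eapply Rle_trans; [exact Htail|]. apply Rplus_le_compat_l. nra. }
    apply Rle_trans with (/ INR K * (D * P (gam - 3 / 4))).
    { apply Rmult_le_compat_l; [lra|auto]. }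
    right. replace (gam - 7 / 4) with ((gam - 3 / 4) - 1) by field.
    unfold P. rewrite Rpower_Pr by lra. field; lra. }
  destruct (C_cauchy_rate (riemann_sum g)
    (fun n => match n with O => 0 | S m => D * Rpower (INR (S m)) (gam - 7 / 4) end)) as [beta Hbeta].
  - intros [|n]; [lra|]. apply Rmult_le_pos; auto. apply Rlt_le, Rpower_pos.
  - apply is_lim_seq_incr_1.
    replace (Finite 0) with (Rbar_mult D 0) by (simpl; f_equal; ring).
    apply is_lim_seq_scal_l. apply Rpower_lim_0. lra.
  - intros [|n] [|m] Hn Hm; try lia.
    eapply Rle_trans; [apply (Cmod_triangle3 _ (riemann_sum g (S n * S m)))|].
    rewrite (Cmod_minus_sym (riemann_sum g (S n))). apply Rplus_le_compat; [apply Href; auto|].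
    rewrite Nat.mul_comm. apply Href; auto.
  - exists beta, (D + 1). split; [lra|]. intros [|K] HK; [lia|].
    eapply Rle_trans; [apply Hbeta; auto|]. apply Rmult_le_compat_r; [apply Rlt_le, Rpower_pos|lra].
Qed.

(** * Asymptotics of the coefficients *)

Definition conv_sum (phi : R -> C) (s : C) (k : nat) : C :=
  csum (fun i => Cmult (cpow (INR (S i)) (Copp s)) (phi (INR (S i) / INR k))) ((k - 1) / 2).

(* Half of the term [n = k/2]: the trapezoidal correction, which removes the dependence of the
   increments of [conv_sum] on the parity of [k]. *)
Definition half_term (phi : R -> C) (s : C) (k : nat) : C :=
  if Nat.even k then Cmult (RtoC (/ 2)) (Cmult (cpow (INR k / 2) (Copp s)) (phi (1 / 2))) else RtoC 0.

Lemma Rpower_comparable (y K e : R) : 0 < K -> K / 4 <= y <= K ->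
  Rpower y e <= Rpower 4 (Rabs e) * Rpower K e.
Proof.
  intros HK Hy. destruct (Rle_dec 0 e) as [He|He].
  - rewrite Rabs_right by lra. apply Rle_trans with (1 * Rpower K e).
    + rewrite Rmult_1_l. apply Rpower_le_l; lra.
    + apply Rmult_le_compat_r; [apply Rlt_le, Rpower_pos|apply Rpower_ge_1; lra].
  - rewrite Rabs_left by lra. apply Rle_trans with (Rpower (K / 4) e); [apply Rpower_ge_l; lra|].
    right. unfold Rdiv. rewrite <- Rpower_mult_distr by lra. rewrite Rmult_comm. f_equal.
    unfold Rpower. rewrite ln_Rinv by lra. f_equal. ring.
Qed.

Lemma power_sum_le_upto (q : R) : q < 1 -> exists K, 0 < K /\ forall h k, (h <= k)%nat -> (1 <= k)%nat ->
  rsum (fun i => Rpower (INR (S i)) (- q)) h <= K * Rpower (INR k) (1 - q).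
Proof.
  intros Hq. destruct (power_sum_le q Hq) as [K [HK H]]. exists K; split; auto.
  intros h [|k] Hh Hk; [lia|]. eapply Rle_trans; [|apply H].
  apply rsum_incr; auto. intros; apply Rlt_le, Rpower_pos.
Qed.

Lemma half_cases (k : nat) : (1 <= k)%nat ->
  (k = 2 * ((k - 1) / 2) + 1 /\ Nat.even k = false /\ Nat.even (S k) = true /\ (S k - 1) / 2 = (k - 1) / 2)%nat \/
  (k = 2 * ((k - 1) / 2) + 2 /\ Nat.even k = true /\ Nat.even (S k) = false /\ (S k - 1) / 2 = S ((k - 1) / 2))%nat.
Proof.
  intros Hk. generalize (Nat.div_mod_eq (k - 1) 2) (Nat.mod_upper_bound (k - 1) 2 ltac:(lia)).
  generalize (Nat.div_mod_eq (S k - 1) 2) (Nat.mod_upper_bound (S k - 1) 2 ltac:(lia)).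
  set (h := ((k - 1) / 2)%nat). set (h' := ((S k - 1) / 2)%nat). intros E1 E2 E3 E4.
  assert (Hc : (k = 2 * h + 1 \/ k = 2 * h + 2)%nat) by lia.
  destruct Hc as [Hc|Hc]; [left|right]; (split; [exact Hc|split; [|split; [|lia]]]); rewrite Hc;
  rewrite ?Nat.even_succ, ?Nat.odd_add, ?Nat.even_add, ?Nat.odd_mul, ?Nat.even_mul; reflexivity.
Qed.

Lemma taylor2 (phi phi1 phi2 : R -> C) (B u v : R) :
  (forall t, 0 <= t <= 1 / 2 -> rder phi t (phi1 t)) ->
  (forall t, 0 <= t <= 1 / 2 -> rder phi1 t (phi2 t)) ->
  (forall t, 0 <= t <= 1 / 2 -> Cmod (phi2 t) <= B) ->
  0 <= u <= v -> v <= 1 / 2 ->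
  Cmod (Cminus (Cminus (phi v) (phi u)) (Cmult (phi1 u) (RtoC (v - u)))) <= B * (v - u) * (v - u).
Proof.
  intros H1 H2 HB Hu Hv.
  generalize (mean_value_ineq (fun t => Cplus (phi t) (Cmult (Copp (phi1 u)) (RtoC t)))
    (fun t => Cplus (phi1 t) (Cmult (Copp (phi1 u)) (RtoC 1))) u v (B * (v - u)) ltac:(lra)).
  intros H. cbn beta in H.
  replace (Cminus (Cminus (phi v) (phi u)) _) with
    (Cminus (Cplus (phi v) (Cmult (Copp (phi1 u)) v)) (Cplus (phi u) (Cmult (Copp (phi1 u)) u)))
    by (rewrite RtoC_minus; ring).
  apply H.
  - intros t Ht. apply rder_plus; [apply H1; lra|]. apply rder_scal, rder_RtoC, @is_derive_id.
  - intros t Ht. replace (Cplus _ _) with (Cminus (phi1 t) (phi1 u)) by ring.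
    apply Rle_trans with (B * (t - u)).
    + apply mean_value_ineq with phi2; [lra| |]; intros r Hr; [apply H2|apply HB]; lra.
    + apply Rmult_le_compat_l; [|lra]. eapply Rle_trans; [apply Cmod_ge_0|apply (HB t); lra].
Qed.

(** From [k] to [K = k + 1] the sample points move from [n/k] to [n/K], by [n / (k K)]. To first
    order this changes the sum by [- K^(-s)] times a Riemann sum of [u^(1-s) phi'(u)] over
    [(0, 1/2]], with limit [beta]. At the upper end, the new terms and the half terms together
    amount to [c1 K^(-s)] for both parities, up to [O(K^(-Re s - 1))]. Hence [c = c1 - beta]. *)
Lemma smoothed_increment (phi phi1 phi2 : R -> C) (s : C) (B kap : R) :
  (forall t, 0 <= t <= 1 / 2 -> rder phi t (phi1 t)) ->
  (forall t, 0 <= t <= 1 / 2 -> rder phi1 t (phi2 t)) ->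
  (forall t, 0 <= t <= 1 / 2 -> Cmod (phi t) <= B /\ Cmod (phi1 t) <= B /\ Cmod (phi2 t) <= B) ->
  Re s < 3 / 2 -> kap <= Re s -> kap <= 3 / 4 ->
  exists c K0, 0 <= K0 /\ forall k, (1 <= k)%nat ->
    Cmod (Cminus (Cminus (Cplus (conv_sum phi s (S k)) (half_term phi s (S k)))
        (Cplus (conv_sum phi s k) (half_term phi s k)))
      (Cmult c (cpow (INR (S k)) (Copp s)))) <= K0 * Rpower (INR (S k)) (- 1 - kap).
Proof.
  intros H1 H2 HB Hs Hk1 Hk2.
  assert (HB0 : 0 <= B).
  { eapply Rle_trans; [apply Cmod_ge_0|apply (HB 0); lra]. }
  (* Raised to 3/4 so that [riemann_sum_rate] also covers small and negative [Re s]. *)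
  set (gam := Rmax (Re s) (3 / 4)).
  assert (Hgam : 3 / 4 <= gam < 3 / 2) by (unfold gam; split; [apply Rmax_r|apply Rmax_case; lra]).
  assert (Hgs : Re s <= gam) by apply Rmax_l.
  set (g0 := fun u => Cmult (cpow u (Cminus (RtoC 1) s)) (phi1 u)).
  (* Cut off beyond 1/2, so that a Riemann sum over all of [[0, 1)] picks just the points of the
     convolution. *)
  set (g := fun u => if Rlt_dec 0 u then (if Rle_dec u (1 / 2) then g0 u else RtoC 0) else RtoC 0).
  assert (Hgin : forall u, 0 < u <= 1 / 2 -> g u = g0 u).
  { intros u Hu. unfold g. destruct (Rlt_dec 0 u); [|lra]. destruct (Rle_dec u (1 / 2)); [auto|lra]. }
  assert (Hg0 : forall u, u <= 0 -> g u = RtoC 0).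
  { intros u Hu. unfold g. destruct (Rlt_dec 0 u); [lra|auto]. }
  assert (Hg1 : forall u, 1 / 2 < u -> g u = RtoC 0).
  { intros u Hu. unfold g. destruct (Rlt_dec 0 u); auto. destruct (Rle_dec u (1 / 2)); [lra|auto]. }
  assert (Hmono : forall u e f, 0 < u <= 1 / 2 -> f <= e -> Rpower u e <= Rpower u f).
  { intros u e f Hu Hef. unfold Rpower. apply exp_le_compat.
    assert (ln u < 0) by (rewrite <- ln_1; apply ln_increasing; lra). nra. }
  set (B1 := B * (1 + Cmod (Cminus (RtoC 1) s))).
  assert (Hms := Cmod_ge_0 (Cminus (RtoC 1) s)).
  assert (HB1 : B <= B1) by (unfold B1; nra).
  destruct (riemann_sum_rate g B1 gam Hgam ltac:(lra) Hg0 Hg1) as [beta [KR [HKR HR]]].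
  { intros u Hu. rewrite Hgin by auto. unfold g0. rewrite Cmod_mult, Cmod_cpow, Rmult_comm.
    apply Rmult_le_compat; try apply Cmod_ge_0; [apply Rlt_le, Rpower_pos| |].
    - eapply Rle_trans; [apply HB; lra|lra].
    - apply Hmono; auto. rewrite Re_minus. simpl. lra. }
  { intros u v Hu Hv. rewrite !Hgin by lra.
    apply mean_value_ineq with (fun t => Cplus (Cmult (Cmult (Cminus (RtoC 1) s)
       (cpow t (Cminus (Cminus (RtoC 1) s) (RtoC 1)))) (phi1 t)) (Cmult (cpow t (Cminus (RtoC 1) s)) (phi2 t)));
      [lra| |].
    - intros t Ht. unfold g0. apply rder_mult; [apply rder_cpow; lra|apply H2; lra].
    - intros t Ht. eapply Rle_trans; [apply Cmod_triangle|].
      rewrite !Cmod_mult, !Cmod_cpow, !Re_minus. simpl.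
      destruct (HB t ltac:(lra)) as (_ & B2 & B3).
      assert (E1 : Rpower t (1 - Re s - 1) <= Rpower u (- gam)).
      { apply Rle_trans with (Rpower t (- gam)); [apply Hmono; lra|apply Rpower_ge_l; lra]. }
      assert (E2 : Rpower t (1 - Re s) <= Rpower u (- gam)).
      { apply Rle_trans with (Rpower t (- gam)); [apply Hmono; lra|apply Rpower_ge_l; lra]. }
      unfold B1. assert (P0 := Rpower_pos u (- gam)).
      apply Rle_trans with (Cmod (Cminus 1 s) * Rpower u (- gam) * B + Rpower u (- gam) * B); [|right; ring].
      apply Rplus_le_compat; apply Rmult_le_compat; auto; try apply Cmod_ge_0.
      + apply Rmult_le_pos; [apply Cmod_ge_0|apply Rlt_le, Rpower_pos].
      + apply Rmult_le_compat_l; auto.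
      + apply Rlt_le, Rpower_pos. }
  destruct (power_sum_le_upto kap ltac:(lra)) as [KP [HKP HP]].
  (* For even [k], [half_term] equals [c1 * k^(-s)] exactly. *)
  set (c1 := Cmult (Cmult (RtoC (/ 2)) (cpow (/ 2) (Copp s))) (phi (1 / 2))).
  set (G := Rpower 4 (Rabs (1 - Re s)) * B).
  set (F := Rpower 4 (Rabs (- Re s - 1))).
  assert (HG : 0 <= G) by (unfold G; apply Rmult_le_pos; auto; apply Rlt_le, Rpower_pos).
  assert (HF : 0 <= F) by (apply Rlt_le, Rpower_pos).
  assert (Hs0 := Cmod_ge_0 s).
  set (J0 := B * F + B * Cmod s * F).
  exists (Cminus c1 beta), (B * KP + KR + 2 * (Cmod beta + KR) + 2 * G + J0).
  assert (HJ0 : 0 <= J0) by (unfold J0; assert (0 <= B * F) by nra; assert (0 <= B * Cmod s * F) by (repeat apply Rmult_le_pos; lra); lra).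
  assert (Hb0 := Cmod_ge_0 beta).
  split; [nra|].
  intros k Hk. set (K := INR (S k)). set (h := ((k - 1) / 2)%nat).
  assert (Hkr : 1 <= INR k) by (apply (le_INR 1); auto).
  assert (EK : K = INR k + 1) by (unfold K; apply S_INR).
  assert (HhK : (k = 2 * h + 1 \/ k = 2 * h + 2)%nat).
  { destruct (half_cases k Hk) as [[E _]|[E _]]; unfold h; auto. }
  assert (HhKr : K = 2 * INR (S h) \/ K = 2 * INR (S h) + 1).
  { rewrite EK, S_INR. destruct HhK as [E|E]; rewrite E, plus_INR, mult_INR; simpl; [left|right]; ring. }
  assert (HKi : 0 < / K) by (apply Rinv_0_lt_compat; lra).
  assert (Hkinv : / INR k <= 2 * / K) by (rewrite EK; apply (Rmult_le_reg_r (INR k * (INR k + 1))); [nra|];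
    replace (/ INR k * (INR k * (INR k + 1))) with (INR k + 1) by (field; lra);
    replace (2 * / (INR k + 1) * (INR k * (INR k + 1))) with (2 * INR k) by (field; lra); lra).
  assert (Hki : 0 < / INR k) by (apply Rinv_0_lt_compat; lra).
  set (P := Rpower K).
  assert (HPpos : forall t, 0 < P t) by (intros; apply Rpower_pos).
  assert (HPm : forall t u, t <= u -> P t <= P u) by (intros; apply Rpower_le_r; lra).
  assert (HPd : forall t, P (t - 1) = P t * / K) by (intros; unfold P; apply Rpower_Pr; lra).
  assert (Hi : forall i, (i < h)%nat -> 0 < INR (S i) /\ INR (S i) / INR k <= 1 / 2 /\ INR (S i) / K <= INR (S i) / INR k).
  { intros i Hih. generalize (INR_S_pos i). intros Hi1. split; [lra|].
    assert (2 * INR (S i) <= INR k).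
    { replace 2 with (INR 2) by reflexivity. rewrite <- mult_INR. apply le_INR. lia. }
    split.
    - apply Rmult_le_reg_r with (INR k); [lra|]. unfold Rdiv. rewrite Rmult_assoc, Rinv_l; lra.
    - unfold Rdiv. apply Rmult_le_compat_l; [lra|]. apply Rinv_le_contravar; lra. }
  set (nn := fun i => cpow (INR (S i)) (Copp s)).
  set (u := fun i => INR (S i) / K). set (v := fun i => INR (S i) / INR k).
  set (D1 := csum (fun i => Cmult (nn i) (Cminus (Cminus (phi (v i)) (phi (u i)))
     (Cmult (phi1 (u i)) (RtoC (v i - u i))))) h).
  set (Mn := csum (fun i => Cmult (nn i) (Cmult (phi1 (u i)) (RtoC (v i - u i)))) h).
  set (J := Cminus (Cminus (Cplus (conv_sum phi s (S k)) (half_term phi s (S k)))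
     (Cplus (csum (fun i => Cmult (nn i) (phi (u i))) h) (half_term phi s k))) (Cmult c1 (cpow K (Copp s)))).
  (* The point [n = h + 1] still satisfies [n / K <= 1/2]: it belongs to the Riemann sum but not to
     the [h] terms of [Mn], and has to be subtracted. *)
  set (gh := g (INR (S h) / K)).
  assert (HD1 : Cmod D1 <= B * KP * P (- 1 - kap)).
  { apply Rle_trans with (rsum (fun i => B * (/ K * / K) * Rpower (INR (S i)) (- kap)) h).
    - apply csum_bound. intros i Hih. destruct (Hi i Hih) as (I1 & I2 & I3). unfold u, v.
      assert (I4 : 0 <= INR (S i) / K) by (apply Rmult_le_pos; lra).
      rewrite Cmod_mult. unfold nn. rewrite Cmod_cpow, re_opp, Rmult_comm.
      apply Rmult_le_compat; try apply Cmod_ge_0; [apply Rlt_le, Rpower_pos| |].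
      + eapply Rle_trans; [apply (taylor2 phi phi1 phi2 B); auto; intros; apply HB; auto|].
        rewrite Rmult_assoc. apply Rmult_le_compat_l; auto.
        assert (E : INR (S i) / INR k - INR (S i) / K = INR (S i) / INR k * / K).
        { rewrite EK. field. lra. }
        rewrite E. apply Rmult_le_compat; nra.
      + apply Rpower_le_r; [apply INR_S_pos|lra].
    - rewrite rsum_scal. apply Rle_trans with (B * (/ K * / K) * (KP * P (1 - kap))).
      + apply Rmult_le_compat_l; [nra|]. apply HP; lia.
      + replace (- 1 - kap) with (1 - kap - 1 - 1) by ring. rewrite !HPd. right; ring. }
  assert (HMn : Mn = Cmult (cpow K (Copp s)) (Cmult (RtoC (/ INR k)) (Cminus (Cmult (RtoC K) (riemann_sum g (S k))) gh))).
  { assert (E : Cmult (RtoC K) (riemann_sum g (S k)) = Cplus (csum (fun i => g0 (u i)) h) gh).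
    { unfold riemann_sum. fold K. rewrite Cmult_assoc, <- RtoC_mult, Rinv_r, Cmult_1_l by lra.
      rewrite csum_shift. rewrite (Hg0 (INR 0 / K)) by (simpl; unfold Rdiv; lra).
      replace k with (h + S (k - S h))%nat at 1 by lia.
      rewrite csum_split, csum_shift. rewrite Nat.add_0_r.
      rewrite (csum_0 (fun i => g (INR (S (h + S i)) / K))).
      2:{ intros i _. apply Hg1. apply Rmult_lt_reg_r with K; [lra|].
          unfold Rdiv at 2. rewrite Rmult_assoc, Rinv_l by lra.
          assert (INR (S (S h)) <= INR (S (h + S i))) by (apply le_INR; lia).
          rewrite (S_INR (S h)) in H. lra. }
      rewrite (csum_ext (fun i => g (INR (S i) / K)) (fun i => g0 (u i))).
      - unfold gh. ring.
      - intros i Hih. apply Hgin. destruct (Hi i Hih) as (I1 & I2 & I3). unfold u. split; [apply Rdiv_lt_0_compat; lra|lra]. }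
    rewrite E. replace (Cminus (Cplus _ gh) gh) with (csum (fun i => g0 (u i)) h) by ring.
    rewrite <- !csum_scal. apply csum_ext. intros i Hih.
    destruct (Hi i Hih) as (I1 & I2 & I3). unfold nn, g0, u, v.
    assert (Eu : cpow (INR (S i) / K) (Cminus (RtoC 1) s) =
      Cmult (Cmult (RtoC (INR (S i))) (cpow (INR (S i)) (Copp s))) (Cmult (RtoC (/ K)) (cpow K s))).
    { unfold Rdiv. rewrite cpow_mult_base by auto. unfold Cminus. rewrite !cpow_plus, !cpow_1 by auto.
      f_equal. f_equal. rewrite !cpow_cexp, ln_Rinv by lra. f_equal. rewrite RtoC_opp. ring. }
    rewrite Eu.
    replace (INR (S i) / INR k - INR (S i) / K) with (INR (S i) * / K * / INR k) by (rewrite EK; field; lra).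
    rewrite !RtoC_mult.
    transitivity (Cmult (Cmult (cpow K (Copp s)) (cpow K s)) (Cmult (Cmult (cpow (INR (S i)) (Copp s)) (phi1 (INR (S i) / K)))
      (Cmult (RtoC (INR (S i))) (Cmult (RtoC (/ K)) (RtoC (/ INR k)))))).
    - rewrite cpow_opp_mult. ring.
    - ring. }
  assert (Hrel : Cminus (Cminus (Cplus (conv_sum phi s (S k)) (half_term phi s (S k)))
        (Cplus (conv_sum phi s k) (half_term phi s k))) (Cmult (Cminus c1 beta) (cpow K (Copp s))) =
     Cplus (Cminus J D1) (Cmult (cpow K (Copp s)) (Cminus (Cmult (RtoC (/ INR k)) (Cminus gh (riemann_sum g (S k))))
        (Cminus (riemann_sum g (S k)) beta)))).
  { assert (E : conv_sum phi s k = Cplus (csum (fun i => Cmult (nn i) (phi (u i))) h) (Cplus D1 Mn)).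
    { unfold D1, Mn. rewrite <- !csum_plus. unfold conv_sum. apply csum_ext. intros i _. unfold nn, v. ring. }
    rewrite E, HMn. unfold J.
    assert (E2 : Cmult (RtoC (/ INR k)) (RtoC K) = Cplus (RtoC 1) (RtoC (/ INR k))).
    { rewrite <- RtoC_mult, <- RtoC_plus. f_equal. rewrite EK. field. lra. }
    replace (Cmult (RtoC (/ INR k)) (Cminus (Cmult (RtoC K) (riemann_sum g (S k))) gh)) with
      (Cminus (Cmult (Cmult (RtoC (/ INR k)) (RtoC K)) (riemann_sum g (S k))) (Cmult (RtoC (/ INR k)) gh)) by ring.
    rewrite E2. ring. }
  rewrite Hrel.
  assert (HRk : Cmod (Cminus (riemann_sum g (S k)) beta) <= KR * P (gam - 7 / 4)) by (apply HR; lia).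
  assert (HP1 : P (gam - 7 / 4) <= 1) by (apply Rpower_le_1; lra).
  assert (HRb : Cmod (riemann_sum g (S k)) <= Cmod beta + KR).
  { generalize (Cmod_minus_ge (riemann_sum g (S k)) beta). nra. }
  assert (Hgh : Cmod gh <= G).
  { assert (Q : / 4 <= INR (S h) / K <= 1 / 2).
    { generalize (INR_S_pos h); intros. split; apply Rmult_le_reg_r with K; try lra;
      replace (INR (S h) / K * K) with (INR (S h)) by (field; lra); destruct HhKr; lra. }
    unfold gh. rewrite Hgin by lra. unfold g0. rewrite Cmod_mult, Cmod_cpow, Re_minus. change (Re (RtoC 1)) with 1.
    unfold G. apply Rmult_le_compat; try apply Cmod_ge_0; [apply Rlt_le, Rpower_pos| |].
    2:{ destruct (HB (INR (S h) / K) ltac:(lra)) as (_ & B2 & _). exact B2. }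
    eapply Rle_trans; [apply (Rpower_comparable _ 1); lra|].
    replace (Rpower 1 (1 - Re s)) with 1; [lra|]. unfold Rpower. rewrite ln_1, Rmult_0_r, exp_0. auto. }
  (* For odd [k] the new half term is exactly [c1 K^(-s)] and [J] vanishes. For even [k] the full
     term at [k/2] enters and its half leaves; comparing with [c1 K^(-s)] costs one mean value
     estimate for [phi] and one for the power. *)
  assert (HJ : Cmod J <= J0 * P (- Re s - 1)).
  { unfold J. destruct (half_cases k Hk) as [(C1 & C2 & C3 & C4)|(C1 & C2 & C3 & C4)]; fold h in C1, C4.
    - replace (Cminus _ _) with (RtoC 0).
      { rewrite Cmod_0. apply Rmult_le_pos; auto. left; auto. }
      unfold conv_sum, half_term. rewrite C2, C3, C4. fold K.
      replace (cpow (K / 2) (Copp s)) with (Cmult (cpow K (Copp s)) (cpow (/ 2) (Copp s)))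
        by (rewrite <- cpow_mult_base by lra; reflexivity).
      unfold c1, nn, u. ring.
    - assert (Ek : INR k / 2 = INR (S h)).
      { assert (E0 : INR k = INR (2 * h + 2)) by (f_equal; exact C1).
        rewrite plus_INR, mult_INR in E0. rewrite (S_INR h). simpl in E0. lra. }
      assert (Hq : K / 4 <= INR (S h) <= K).
      { rewrite <- Ek, EK. lra. }
      replace (Cminus _ _) with (Cplus (Cmult (cpow (INR (S h)) (Copp s)) (Cminus (phi (INR (S h) / K)) (phi (1 / 2))))
        (Cmult (Cmult (RtoC (/ 2)) (phi (1 / 2))) (Cminus (cpow (INR (S h)) (Copp s)) (cpow (K / 2) (Copp s))))).
      2:{ unfold conv_sum, half_term. rewrite C2, C3, C4. fold K. rewrite Ek.
          replace (cpow (K / 2) (Copp s)) with (Cmult (cpow K (Copp s)) (cpow (/ 2) (Copp s)))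
            by (rewrite <- cpow_mult_base by lra; reflexivity).
          match goal with |- context [csum ?f (S h)] => change (csum f (S h)) with (Cplus (csum f h) (f h)) end.
          cbn beta. unfold c1, nn, u.
          replace (RtoC (/ 2)) with (Cinv (RtoC 2)) by (rewrite RtoC_inv; auto). field. }
      eapply Rle_trans; [apply Cmod_triangle|]. unfold J0. rewrite Rmult_plus_distr_r.
      assert (E12 : 1 / 2 - INR (S h) / K = / 2 * / K) by (rewrite <- Ek, EK; field; lra).
      apply Rplus_le_compat.
      + rewrite Cmod_mult, Cmod_cpow, re_opp, Cmod_minus_sym.
        assert (E1 : Cmod (Cminus (phi (1 / 2)) (phi (INR (S h) / K))) <= B * (/ 2 * / K)).
        { rewrite <- E12. assert (0 < INR (S h) / K) by (apply Rdiv_lt_0_compat; lra).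
          apply mean_value_ineq with phi1; [lra| |]; intros t Ht; [apply H1|apply HB]; lra. }
        apply Rle_trans with (INR (S h) * Rpower (INR (S h)) (- Re s - 1) * (B * (/ 2 * / K))).
        * apply Rmult_le_compat; auto; try apply Cmod_ge_0; [apply Rlt_le, Rpower_pos|].
          right. rewrite <- Rpower_Sr by lra. f_equal; ring.
        * apply Rle_trans with (K * (F * P (- Re s - 1)) * (B * (/ 2 * / K))).
          { apply Rmult_le_compat_r; [nra|]. apply Rmult_le_compat; try lra; [apply Rlt_le, Rpower_pos|].
            apply Rpower_comparable; lra. }
          assert (0 <= B * F * P (- Re s - 1)) by (repeat apply Rmult_le_pos; auto; left; auto).
          apply Rle_trans with (/ 2 * (B * F * P (- Re s - 1))); [right; field; lra|lra].
      + rewrite !Cmod_mult, Cmod_R, Rabs_right, Cmod_minus_sym by lra.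
        assert (E1 : Cmod (Cminus (cpow (K / 2) (Copp s)) (cpow (INR (S h)) (Copp s))) <=
          (Cmod s * (F * P (- Re s - 1))) * (K / 2 - INR (S h))).
        { apply (mean_value_ineq (fun t => cpow t (Copp s))
            (fun t => Cmult (Copp s) (cpow t (Cminus (Copp s) (RtoC 1))))).
          - lra.
          - intros t Ht. apply rder_cpow. lra.
          - intros t Ht. rewrite Cmod_mult, Cmod_opp, Cmod_cpow, Re_minus, re_opp. simpl.
            apply Rmult_le_compat_l; auto. apply Rpower_comparable; lra. }
        assert (E2 := HB (1 / 2) ltac:(lra)).
        assert (E3 : 0 <= Cmod s * (F * P (- Re s - 1))) by (repeat apply Rmult_le_pos; auto; left; auto).
        apply Rle_trans with (/ 2 * B * (Cmod s * (F * P (- Re s - 1)) * (K / 2 - INR (S h)))).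
        * apply Rmult_le_compat; try apply Cmod_ge_0; auto.
          -- apply Rmult_le_pos; [lra|apply Cmod_ge_0].
          -- apply Rmult_le_compat_l; lra.
        * replace (K / 2 - INR (S h)) with (/ 2) by lra.
          assert (0 <= B * (Cmod s * (F * P (- Re s - 1)))) by (apply Rmult_le_pos; auto).
          lra. }
  assert (HE1 : P (- Re s - 1) <= P (- 1 - kap)) by (apply HPm; lra).
  (* If [gam = Re s], this is the condition [kap <= 3/4]; if [gam = 3/4], it is [kap <= Re s]. *)
  assert (HE2 : P (- Re s) * P (gam - 7 / 4) <= P (- 1 - kap)).
  { unfold P. rewrite <- Rpower_plus. apply HPm. unfold gam. apply Rmax_case; lra. }
  assert (HPk := HPpos (- 1 - kap)).
  eapply Rle_trans; [apply Cmod_triangle|].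
  eapply Rle_trans; [apply Rplus_le_compat_r, Cmod_minus_le|].
  rewrite Cmod_mult, Cmod_cpow, re_opp. fold (P (- Re s)).
  assert (HL : P (- Re s) * Cmod (Cminus (Cmult (RtoC (/ INR k)) (Cminus gh (riemann_sum g (S k))))
     (Cminus (riemann_sum g (S k)) beta)) <= (KR + 2 * (Cmod beta + KR) + 2 * G) * P (- 1 - kap)).
  { apply Rle_trans with (P (- Re s) * (2 * / K * (G + (Cmod beta + KR)) + KR * P (gam - 7 / 4))).
    - apply Rmult_le_compat_l; [left; auto|].
      eapply Rle_trans; [apply Cmod_minus_le|]. apply Rplus_le_compat; auto.
      rewrite Cmod_mult, Cmod_R, Rabs_right by lra.
      apply Rmult_le_compat; try apply Cmod_ge_0; try lra.
      eapply Rle_trans; [apply Cmod_minus_le|]. lra.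
    - apply Rle_trans with (2 * (G + (Cmod beta + KR)) * (P (- Re s) * / K) + KR * (P (- Re s) * P (gam - 7 / 4))).
      { right; ring. }
      rewrite <- HPd.
      apply Rle_trans with (2 * (G + (Cmod beta + KR)) * P (- 1 - kap) + KR * P (- 1 - kap)); [|right; ring].
      apply Rplus_le_compat; apply Rmult_le_compat_l; lra. }
  assert (J0 * P (- Re s - 1) <= J0 * P (- 1 - kap)) by (apply Rmult_le_compat_l; auto).
  lra.
Qed.

(** * The double series as a Dirichlet series in the third variable *)

Definition conv_coef (s1 s2 : C) (k : nat) : C :=
  sum_n_m (fun m : nat => Cmult (cpow (INR m) (Copp s1)) (cpow (INR (k - m)) (Copp s2))) (k / 2 + 1) (k - 1).

(** Extended by 0 outside the triangle [1 <= n < m], so that rows and diagonals become sums over one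
    common square and may be interchanged. *)
Definition AV2_summand (s1 s2 s3 : C) (m n : nat) : C :=
  if Nat.leb 1 n && Nat.ltb n m then
    Cmult (Cmult (cpow (INR m) (Copp s1)) (cpow (INR n) (Copp s2))) (cpow (INR (m + n)) (Copp s3))
  else RtoC 0.

Lemma csum_delta (x : nat -> C) (j L : nat) :
  csum (fun n => if Nat.eqb n j then x n else RtoC 0) L = if Nat.ltb j L then x j else RtoC 0.
Proof.
  induction L; [reflexivity|]. simpl csum. rewrite IHL.
  destruct (Nat.ltb_spec j L), (Nat.eqb_spec L j), (Nat.ltb_spec j (S L)); try lia; subst; ring.
Qed.

Lemma csum_swap (f : nat -> nat -> C) (n m : nat) :
  csum (fun i => csum (f i) m) n = csum (fun j => csum (fun i => f i j) n) m.
Proof.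
  induction n; simpl.
  - rewrite csum_0; auto.
  - rewrite IHn, <- csum_plus. reflexivity.
Qed.

Lemma AV2_summand_out (s1 s2 s3 : C) (m n : nat) : (n = 0 \/ m <= n)%nat ->
  AV2_summand s1 s2 s3 m n = RtoC 0.
Proof.
  intros H. unfold AV2_summand.
  destruct (Nat.leb_spec 1 n), (Nat.ltb_spec n m); simpl; auto; lia.
Qed.

Lemma AV2_summand_in (s1 s2 s3 : C) (m n : nat) : (1 <= n < m)%nat ->
  AV2_summand s1 s2 s3 m n =
  Cmult (Cmult (cpow (INR m) (Copp s1)) (cpow (INR n) (Copp s2))) (cpow (INR (m + n)) (Copp s3)).
Proof.
  intros H. unfold AV2_summand.
  destruct (Nat.leb_spec 1 n), (Nat.ltb_spec n m); simpl; auto; lia.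
Qed.

Lemma AV2_term_csum (s1 s2 s3 : C) (m L : nat) : (m <= L)%nat ->
  AV2_term s1 s2 s3 m = csum (AV2_summand s1 s2 s3 m) L.
Proof.
  intros HL. unfold AV2_term. rewrite sum_n_m_csum.
  replace L with (m + (L - m))%nat by lia. rewrite csum_split.
  rewrite (csum_0 (fun i => AV2_summand s1 s2 s3 m (m + i))) by (intros; apply AV2_summand_out; lia).
  destruct m as [|m]; [simpl; ring|].
  rewrite csum_shift, AV2_summand_out by lia.
  replace (S (S m - 1) - 1)%nat with m by lia.
  rewrite (csum_ext (fun i => AV2_summand s1 s2 s3 (S m) (S i))
    (fun i => Cmult (Cmult (cpow (INR (S m)) (Copp s1)) (cpow (INR (1 + i)) (Copp s2)))
       (cpow (INR (S m + (1 + i))) (Copp s3)))).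
  - ring.
  - intros i Hi. rewrite AV2_summand_in by lia. reflexivity.
Qed.

Lemma conv_coef_summand (s1 s2 s3 : C) (k L : nat) : (k < L)%nat ->
  Cmult (conv_coef s1 s2 k) (cpow (INR k) (Copp s3)) =
  csum (fun m => csum (fun n => if Nat.eqb k (m + n) then AV2_summand s1 s2 s3 m n else RtoC 0) L) L.
Proof.
  intros HL. unfold conv_coef. rewrite sum_n_m_csum.
  rewrite (csum_ext (fun m => csum _ L) (fun m => if Nat.leb m k then AV2_summand s1 s2 s3 m (k - m) else RtoC 0)).
  2:{ intros m Hm. destruct (Nat.leb_spec m k) as [H|H].
      - rewrite (csum_ext _ (fun n => if Nat.eqb n (k - m) then AV2_summand s1 s2 s3 m n else RtoC 0)).
        + rewrite csum_delta. destruct (Nat.ltb_spec (k - m) L); [reflexivity|lia].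
        + intros n Hn. destruct (Nat.eqb_spec k (m + n)), (Nat.eqb_spec n (k - m)); auto; lia.
      - apply csum_0. intros n Hn. destruct (Nat.eqb_spec k (m + n)); auto; lia. }
  generalize (Nat.div_mod_eq k 2) (Nat.mod_upper_bound k 2 ltac:(lia)).
  set (h := (k / 2)%nat). intros E1 E2.
  set (c := (S (k - 1) - (h + 1))%nat).
  replace L with ((h + 1) + (c + (L - (h + 1) - c)))%nat by (unfold c; lia).
  rewrite (csum_split _ (h + 1)), (csum_split _ c).
  rewrite (csum_0 _ (h + 1)).
  2:{ intros m Hm. destruct (Nat.leb_spec m k); auto. apply AV2_summand_out. lia. }
  rewrite (csum_0 _ (L - (h + 1) - c)).
  2:{ intros m Hm. destruct (Nat.leb_spec (h + 1 + (c + m)) k); auto. apply AV2_summand_out. unfold c in *. lia. }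
  rewrite Cmult_comm, <- csum_scal.
  replace (Cplus (RtoC 0) _) with (csum (fun i => if Nat.leb (h + 1 + i) k
    then AV2_summand s1 s2 s3 (h + 1 + i) (k - (h + 1 + i)) else RtoC 0) c) by ring.
  apply csum_ext. intros i Hi. unfold c in Hi.
  destruct (Nat.leb_spec (h + 1 + i) k); [|lia].
  rewrite AV2_summand_in by lia.
  replace (h + 1 + i + (k - (h + 1 + i)))%nat with k by lia. ring.
Qed.

Lemma conv_coef_partial_sum (s1 s2 s3 : C) (M : nat) :
  csum (fun k => Cmult (conv_coef s1 s2 k) (cpow (INR k) (Copp s3))) M =
  csum (fun m => csum (fun n => if Nat.ltb (m + n) M then AV2_summand s1 s2 s3 m n else RtoC 0) M) M.
Proof.
  rewrite (csum_ext _ (fun k => csum (fun m => csum (fun n => if Nat.eqb k (m + n)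
    then AV2_summand s1 s2 s3 m n else RtoC 0) M) M)) by (intros; apply conv_coef_summand; auto).
  rewrite csum_swap. apply csum_ext. intros m _.
  rewrite csum_swap. apply csum_ext. intros n _.
  apply (csum_delta (fun _ => AV2_summand s1 s2 s3 m n)).
Qed.

Lemma is_series_csum (u : nat -> C) (l : C) :
  @is_series C_AbsRing C_NormedModule u l -> forall eps, 0 < eps ->
  exists N, forall n, (N <= n)%nat -> Cmod (Cminus (csum u n) l) < eps.
Proof.
  intros H eps He.
  destruct (proj1 (filterlim_locally_ball_norm _ _) H (mkposreal eps He)) as [N HN].
  exists (S N). intros [|n] Hn; [lia|]. specialize (HN n ltac:(lia)).
  assert (E : (sum_n u n : C) = csum u (S n)).
  { unfold sum_n. rewrite sum_n_m_csum. rewrite Nat.sub_0_r. reflexivity. }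
  rewrite <- E. exact HN.
Qed.

(** The filter [f] lets one estimate serve whole rows and rows cut by a condition on [m + n]. The
    powers of [m] and [n] are at most [m^(|Re s1| + |Re s2|)], which leaves [m^(-5)] for each of
    fewer than [m] terms, more than enough. *)
Lemma AV2_row_bound (s1 s2 s3 : C) (m L : nat) (f : nat -> bool) :
  5 + Rabs (Re s1) + Rabs (Re s2) <= Re s3 -> (1 <= m <= L)%nat ->
  Cmod (csum (fun n => if f n then AV2_summand s1 s2 s3 m n else RtoC 0) L) <= Rpower (INR m) (- (2)).
Proof.
  intros Hs Hm.
  assert (Hmr : 1 <= INR m) by (apply (le_INR 1); lia).
  replace L with (m + (L - m))%nat by lia. rewrite csum_split.
  rewrite (csum_0 (fun i => if f (m + i)%nat then _ else _)).
  2:{ intros i _. rewrite AV2_summand_out by lia. destruct (f _); auto. }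
  rewrite Cplus_0_r.
  apply Rle_trans with (rsum (fun _ => Rpower (INR m) (- (5))) m).
  - apply csum_bound. intros n Hn.
    assert (P0 := Rpower_pos (INR m) (- (5))).
    destruct (f n); [|rewrite Cmod_0; lra].
    destruct n as [|n]; [rewrite AV2_summand_out, Cmod_0 by auto; lra|].
    assert (Hn1 := INR_S_pos n). assert (Hnm : INR (S n) <= INR m) by (apply le_INR; lia).
    rewrite AV2_summand_in by lia. rewrite !Cmod_mult, !Cmod_cpow, !re_opp.
    replace (- (5)) with (Rabs (Re s1) + Rabs (Re s2) + (- (5 + Rabs (Re s1) + Rabs (Re s2)))) by ring.
    rewrite !Rpower_plus.
    assert (HA := Rle_abs (Re s1)). assert (HA' := Rle_abs (- Re s1)). rewrite Rabs_Ropp in HA'.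
    assert (HB := Rle_abs (Re s2)). assert (HB' := Rle_abs (- Re s2)). rewrite Rabs_Ropp in HB'.
    apply Rmult_le_compat; try (apply Rmult_le_pos); try (apply Rlt_le, Rpower_pos).
    + apply Rmult_le_compat; try (apply Rlt_le, Rpower_pos); [apply Rpower_le_r; lra|].
      apply Rle_trans with (Rpower (INR (S n)) (Rabs (Re s2))); [apply Rpower_le_r; lra|].
      apply Rpower_le_l; [lra|apply Rabs_pos].
    + rewrite plus_INR. apply Rle_trans with (Rpower (INR m) (- Re s3)).
      * apply Rpower_ge_l; [lra|]. generalize (Rabs_pos (Re s1)) (Rabs_pos (Re s2)); lra.
      * apply Rpower_le_r; lra.
  - rewrite rsum_const. replace (- (5)) with (- (6) + 1) by ring.
    rewrite Rpower_Sr by lra.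
    apply Rle_trans with (Rpower (INR m) (- (6) + 1 + 1)).
    + rewrite !Rpower_Sr by lra. lra.
    + apply Rpower_le_r; lra.
Qed.

(** The double series is summed by rows, the Dirichlet series by diagonals [m + n = k]. For
    [M >= 2 h] the rows [m < h] are complete in both partial sums, as [m + n < 2 h] there; all other
    rows are absorbed by a tail of the series of [m^(-2)]. The second half of the constant accounts
    for the rows from [M] on. *)
Lemma AV2_partial_sums (s1 s2 : C) : exists K, 0 < K /\
  forall (Z : C -> C -> C -> C), is_zetaAV2 Z -> forall (s3 : C) (h : nat),
  5 + Rabs (Re s1) + Rabs (Re s2) <= Re s3 -> (1 <= h)%nat -> forall M, (2 * h <= M)%nat ->
  Cmod (Cminus (Z s1 s2 s3) (csum (fun k => Cmult (conv_coef s1 s2 k) (cpow (INR k) (Copp s3))) M)) <=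
  K * / INR h.
Proof.
  destruct (power_tail_le 2 ltac:(lra)) as [K [HK HT]].
  exists (2 * K). split; [lra|]. intros Z [_ HZ] s3 h Hs Hh M HM.
  assert (Hh1 : 1 <= INR h) by (apply (le_INR 1); auto).
  assert (Hih : 0 < / INR h) by (apply Rinv_0_lt_compat; lra).
  assert (HTh : forall a m, (h <= a)%nat -> rsum (fun i => Rpower (INR (a + i)) (- (2))) m <= K * / INR h).
  { intros [|a] m Ha; [lia|]. eapply Rle_trans; [apply HT|]. apply Rmult_le_compat_l; [lra|].
    assert (INR h <= INR (S a)) by (apply le_INR; auto).
    replace (1 - 2) with (- (1)) by ring. rewrite Rpower_Ropp, Rpower_1 by lra.
    apply Rinv_le_contravar; lra. }
  assert (E1 : Cmod (Cminus (Z s1 s2 s3) (csum (AV2_term s1 s2 s3) M)) <= K * / INR h).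
  { apply Rle_plus_epsilon. intros eps He.
    destruct (is_series_csum _ _ (HZ s1 s2 s3 ltac:(split;
       generalize (Rle_abs (- Re s1)) (Rle_abs (- Re s2)) (Rabs_pos (Re s1)) (Rabs_pos (Re s2));
       rewrite !Rabs_Ropp; lra)) eps He) as [N HN].
    specialize (HN (M + N)%nat ltac:(lia)). rewrite Cmod_minus_sym in HN.
    eapply Rle_trans; [apply (Cmod_triangle3 _ (csum (AV2_term s1 s2 s3) (M + N)))|].
    rewrite csum_split. replace (Cminus (Cplus _ _) (csum (AV2_term s1 s2 s3) M)) with
      (csum (fun i => AV2_term s1 s2 s3 (M + i)) N) by ring.
    rewrite <- csum_split.
    assert (Cmod (csum (fun i => AV2_term s1 s2 s3 (M + i)) N) <= K * / INR h); [|lra].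
    eapply Rle_trans; [|apply (HTh M N); lia]. apply csum_bound. intros i _.
    rewrite (AV2_term_csum _ _ _ _ (M + i)) by lia.
    rewrite (csum_ext _ (fun n => if (fun _ => true) n then AV2_summand s1 s2 s3 (M + i) n else RtoC 0)) by auto.
    apply (AV2_row_bound _ _ _ _ _ (fun _ => true)); auto; lia. }
  assert (E2 : Cmod (Cminus (csum (AV2_term s1 s2 s3) M)
    (csum (fun k => Cmult (conv_coef s1 s2 k) (cpow (INR k) (Copp s3))) M)) <= K * / INR h).
  { rewrite conv_coef_partial_sum, <- csum_minus.
    replace M with (h + (M - h))%nat at 1 by lia. rewrite csum_split.
    rewrite (csum_0 _ h).
    - rewrite Cplus_0_l. eapply Rle_trans; [|apply (HTh h (M - h)%nat); lia].
      apply csum_bound. intros i Hi.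
      rewrite (AV2_term_csum _ _ _ _ M) by lia. rewrite <- csum_minus.
      rewrite (csum_ext _ (fun n => if (fun n => negb (Nat.ltb (h + i + n) M)) n
        then AV2_summand s1 s2 s3 (h + i) n else RtoC 0)).
      + apply (AV2_row_bound _ _ _ _ _ (fun n => negb (Nat.ltb (h + i + n) M))); auto; lia.
      + intros n _. destruct (Nat.ltb (h + i + n) M); simpl; ring.
    - intros m Hm. rewrite (AV2_term_csum _ _ _ _ M) by lia. rewrite <- csum_minus.
      apply csum_0. intros n _. destruct (Nat.ltb_spec (m + n) M); [ring|].
      rewrite AV2_summand_out by lia. ring. }
  eapply Rle_trans; [apply (Cmod_triangle3 _ (csum (AV2_term s1 s2 s3) M))|]. lra.
Qed.

(** * The coefficients as weighted convolution sums *)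

Definition binom_weight (s : C) (u : R) : C := cpow (1 - u) (Copp s).

Lemma csum_rev (f : nat -> C) (n : nat) : csum f n = csum (fun i => f (n - 1 - i)%nat) n.
Proof.
  induction n; [reflexivity|]. rewrite (csum_shift (fun i => f (S n - 1 - i)%nat)).
  change (csum f (S n)) with (Cplus (csum f n) (f n)). rewrite IHn.
  replace (S n - 1 - 0)%nat with n by lia. rewrite Cplus_comm. f_equal.
  apply csum_ext. intros i Hi. f_equal. lia.
Qed.

(** Put [m = k - n] and factor [(k - n)^(-s1) = k^(-s1) (1 - n/k)^(-s1)]. As [n < k/2], the weight
    is only used on [[0, 1/2]], where it is smooth. *)
Lemma conv_coef_conv_sum (s1 s2 : C) (k : nat) : (1 <= k)%nat ->
  conv_coef s1 s2 k = Cmult (cpow (INR k) (Copp s1)) (conv_sum (binom_weight s1) s2 k).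
Proof.
  intros Hk. unfold conv_coef, conv_sum. rewrite sum_n_m_csum, <- csum_scal.
  generalize (Nat.div_mod_eq k 2) (Nat.mod_upper_bound k 2 ltac:(lia)).
  generalize (Nat.div_mod_eq (k - 1) 2) (Nat.mod_upper_bound (k - 1) 2 ltac:(lia)).
  set (h := ((k - 1) / 2)%nat). set (h' := (k / 2)%nat). intros E1 E2 E3 E4.
  replace (S (k - 1) - (h' + 1))%nat with h by lia.
  rewrite csum_rev. apply csum_ext. intros i Hi.
  assert (Hkr : 1 <= INR k) by (apply (le_INR 1); auto).
  replace (k - (h' + 1 + (h - 1 - i)))%nat with (S i) by lia.
  assert (Hm : INR (h' + 1 + (h - 1 - i)) = INR k * (1 - INR (S i) / INR k)).
  { replace (h' + 1 + (h - 1 - i))%nat with (k - S i)%nat by lia. rewrite minus_INR by lia. field. lra. }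
  assert (Hpos : 0 < 1 - INR (S i) / INR k).
  { assert (INR (S i) < INR k) by (apply lt_INR; lia).
    apply Rmult_lt_reg_l with (INR k); [lra|].
    replace (INR k * (1 - INR (S i) / INR k)) with (INR k - INR (S i)) by (field; lra). lra. }
  rewrite Hm, cpow_mult_base by lra. unfold binom_weight. ring.
Qed.

Lemma rder_binom_weight (s : C) (u : R) : u < 1 ->
  rder (binom_weight s) u (Cmult s (binom_weight (Cplus s (RtoC 1)) u)).
Proof.
  intros Hu. unfold binom_weight.
  replace (Cmult s (cpow (1 - u) (Copp (Cplus s 1)))) with
    (Cmult (RtoC (-1)) (Cmult (Copp s) (cpow (1 - u) (Cminus (Copp s) (RtoC 1))))).
  - apply (rder_comp (fun t => cpow t (Copp s)) (fun t => 1 - t)).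
    + apply rder_cpow. lra.
    + auto_derive; auto.
  - replace (Copp (Cplus s 1)) with (Cminus (Copp s) 1) by ring.
    replace (RtoC (-1)) with (Copp (RtoC 1)) by (apply C_ext; simpl; ring). ring.
Qed.

Lemma Cmod_binom_weight (s : C) (u : R) : 0 <= u <= 1 / 2 ->
  Cmod (binom_weight s u) <= Rpower 4 (Rabs (Re (Copp s))).
Proof.
  intros Hu. unfold binom_weight. rewrite Cmod_cpow.
  eapply Rle_trans; [apply (Rpower_comparable _ 1); lra|].
  replace (Rpower 1 (Re (Copp s))) with 1; [lra|]. unfold Rpower. rewrite ln_1, Rmult_0_r, exp_0. auto.
Qed.

Lemma conv_sum_le (s1 s2 : C) (k : nat) : (1 <= k)%nat ->
  Cmod (conv_sum (binom_weight s1) s2 k) <=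
  Rpower 4 (Rabs (Re (Copp s1))) * rsum (fun i => Rpower (INR (S i)) (- Re s2)) k.
Proof.
  intros Hk. unfold conv_sum. rewrite <- rsum_scal.
  assert (Hh : ((k - 1) / 2 <= k)%nat).
  { destruct (half_cases k Hk) as [[E _]|[E _]]; lia. }
  set (B := Rpower 4 (Rabs (Re (Copp s1)))). assert (HB : 0 < B) by apply Rpower_pos.
  apply Rle_trans with (rsum (fun i => B * Rpower (INR (S i)) (- Re s2)) ((k - 1) / 2)).
  - apply csum_bound. intros i Hi. rewrite Cmod_mult, Cmod_cpow, re_opp, Rmult_comm.
    apply Rmult_le_compat_r; [apply Rlt_le, Rpower_pos|].
    apply Cmod_binom_weight.
    assert (Hkr : 1 <= INR k) by (apply (le_INR 1); auto).
    assert (H2 : 2 * INR (S i) <= INR k).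
    { replace 2 with (INR 2) by reflexivity. rewrite <- mult_INR. apply le_INR.
      destruct (half_cases k Hk) as [[E _]|[E _]]; lia. }
    generalize (INR_S_pos i). intros. split; [apply Rmult_le_pos; [lra|apply Rlt_le, Rinv_0_lt_compat; lra]|].
    apply Rmult_le_reg_r with (INR k); [lra|]. unfold Rdiv. rewrite Rmult_assoc, Rinv_l; lra.
  - apply rsum_incr; auto. intros i. apply Rmult_le_pos; [lra|apply Rlt_le, Rpower_pos].
Qed.

Lemma conv_sum_bound (s1 s2 : C) (q : R) : q <= Re s2 -> q < 1 -> exists K, 0 < K /\ forall k, (1 <= k)%nat ->
  Cmod (conv_sum (binom_weight s1) s2 k) <= K * Rpower (INR k) (1 - q).
Proof.
  intros Hq1 Hq2. destruct (power_sum_le_upto q Hq2) as [K [HK HS]].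
  set (B := Rpower 4 (Rabs (Re (Copp s1)))). assert (HB : 0 < B) by apply Rpower_pos.
  exists (B * K). split; [nra|]. intros k Hk.
  eapply Rle_trans; [apply conv_sum_le; auto|]. fold B. rewrite Rmult_assoc.
  apply Rmult_le_compat_l; [lra|]. apply Rle_trans with (rsum (fun i => Rpower (INR (S i)) (- q)) k); [|apply HS; auto].
  apply rsum_le. intros i _. apply Rpower_le_r; [apply INR_S_pos|lra].
Qed.

Lemma half_term_bound (s1 s2 : C) : exists K, 0 <= K /\ forall k, (1 <= k)%nat ->
  Cmod (half_term (binom_weight s1) s2 k) <= K * Rpower (INR k) (- Re s2).
Proof.
  exists (/ 2 * (Rpower 4 (Rabs (- Re s2)) * Rpower 4 (Rabs (Re (Copp s1))))).
  assert (P1 := Rpower_pos 4 (Rabs (- Re s2))). assert (P2 := Rpower_pos 4 (Rabs (Re (Copp s1)))).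
  split; [nra|]. intros k Hk.
  assert (Hkr : 1 <= INR k) by (apply (le_INR 1); auto).
  assert (P3 := Rpower_pos (INR k) (- Re s2)).
  unfold half_term. destruct (Nat.even k).
  - rewrite !Cmod_mult, Cmod_R, Rabs_right, Cmod_cpow, re_opp, Rmult_assoc by lra.
    apply Rmult_le_compat_l; [lra|].
    apply Rle_trans with (Rpower 4 (Rabs (- Re s2)) * Rpower (INR k) (- Re s2) * Rpower 4 (Rabs (Re (Copp s1)))).
    + apply Rmult_le_compat; try apply Cmod_ge_0; [apply Rlt_le, Rpower_pos| |].
      * apply Rpower_comparable; lra.
      * apply Cmod_binom_weight; lra.
    + right; ring.
  - rewrite Cmod_0. apply Rmult_le_pos; [|lra]. nra.
Qed.

(** * Approximation of the continuation by Dirichlet polynomials *)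

Lemma holo3_cdiff (Z : C -> C -> C -> C) (s1 s2 s3 : C) :
  holo3_at Z s1 s2 s3 -> cdiff (fun w => Z s1 s2 w) s3.
Proof.
  intros (a1 & a2 & a3 & H). exists a3. intros eps He.
  destruct (H eps He) as [d [Hd K]]. exists d; split; auto. intros h Hh.
  specialize (K (RtoC 0) (RtoC 0) h). rewrite Cmod_0 in K. specialize (K Hd Hd Hh).
  replace (Cplus s1 (RtoC 0)) with s1 in K by ring.
  replace (Cplus s2 (RtoC 0)) with s2 in K by ring.
  replace (Cplus (Cmult a1 (RtoC 0)) (Cplus (Cmult a2 (RtoC 0)) (Cmult a3 h))) with (Cmult a3 h) in K by ring.
  rewrite !Rplus_0_l in K. exact K.
Qed.

(** [G M] is the partial sum with its two counterterms. [smooth_tail_bound] keeps it close to the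
    partial sum of length [N], uniformly in [M], and [limit_push_left] lets [G M] tend to [Z] for
    fixed [T], [N] and [t]. So the estimate passes to the limit and its constant depends on none of
    these three. *)
Lemma zetaAV2_approx (Z : C -> C -> C -> C) (s1 s2 : C) (sigma3 kap : R) :
  is_zetaAV2 Z -> Re s2 < 3 / 2 -> kap <= Re s2 -> kap <= 3 / 4 -> 1 < Re s1 + sigma3 + kap ->
  exists K T1, 0 < K /\ 1 <= T1 /\ forall T N t, T1 <= T -> 14 * T <= INR N <= 28 * T -> T / 2 <= t <= T ->
    Cmod (Cminus (Z s1 s2 (sigma3, t))
      (csum (fun k => Cmult (conv_coef s1 s2 k) (cpow (INR k) (Copp (sigma3, t)))) N)) <=
    K * Rpower T (1 - (Re s1 + sigma3) - kap).
Proof.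
  intros HZ Hs2 Hk1 Hk2 Hconv.
  (* Half of the room in [1 < a + kap], so that [1 < a - r + kap] still holds: the discs of radius
     [r] reach to the left of [sigma3]. *)
  set (a := Re s1 + sigma3) in *. set (r := (a + kap - 1) / 2).
  assert (Hr : 0 < r) by (unfold r; lra).
  set (ph := binom_weight s1).
  set (Bd := Rpower 4 (Rabs (Re (Copp s1)))).
  set (s11 := Cplus s1 (RtoC 1)). set (s12 := Cplus s11 (RtoC 1)).
  set (B := Bd + Cmod s1 * Rpower 4 (Rabs (Re (Copp s11))) +
    Cmod s1 * (Cmod s11 * Rpower 4 (Rabs (Re (Copp s12))))).
  destruct (smoothed_increment ph (fun u => Cmult s1 (binom_weight s11 u))
    (fun u => Cmult s1 (Cmult s11 (binom_weight s12 u))) s2 B kap) as (c & C2 & HC2 & Hinc); auto.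
  { intros t Ht. apply rder_binom_weight; lra. }
  { intros t Ht. apply rder_scal, rder_binom_weight; lra. }
  { intros t Ht. unfold B, Bd.
    assert (Q1 := Rpower_pos 4 (Rabs (Re (Copp s1)))).
    assert (Q2 := Rpower_pos 4 (Rabs (Re (Copp s11)))).
    assert (Q3 := Rpower_pos 4 (Rabs (Re (Copp s12)))).
    assert (Q4 := Cmod_ge_0 s1). assert (Q5 := Cmod_ge_0 s11).
    assert (0 <= Cmod s1 * Rpower 4 (Rabs (Re (Copp s11)))) by nra.
    assert (0 <= Cmod s1 * (Cmod s11 * Rpower 4 (Rabs (Re (Copp s12))))) by (apply Rmult_le_pos; nra).
    assert (E1 := Cmod_binom_weight s1 t Ht).
    assert (E2 := Cmod_binom_weight s11 t Ht).
    assert (E3 := Cmod_binom_weight s12 t Ht).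
    rewrite !Cmod_mult. split; [unfold ph; lra|split].
    - assert (Cmod s1 * Cmod (binom_weight s11 t) <= Cmod s1 * Rpower 4 (Rabs (Re (Copp s11))))
        by (apply Rmult_le_compat_l; auto). lra.
    - assert (Cmod s1 * (Cmod s11 * Cmod (binom_weight s12 t)) <= Cmod s1 * (Cmod s11 * Rpower 4 (Rabs (Re (Copp s12)))))
        by (apply Rmult_le_compat_l; auto; apply Rmult_le_compat_l; auto). lra. }
  destruct (conv_sum_bound s1 s2 kap Hk1 ltac:(lra)) as (CA & HCA & HA).
  destruct (half_term_bound s1 s2) as (C3 & HC3 & Htau).
  set (tau := half_term ph s2). set (At := fun k => Cplus (conv_sum ph s2 k) (tau k)).
  set (d := fun k => Cminus (Cminus (At (S k)) (At k)) (Cmult c (cpow (INR (S k)) (Copp s2)))).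
  set (C1 := CA + C3).
  assert (HAt : forall k, Cmod (At (S k)) <= C1 * Rpower (INR (S k)) (1 - kap)).
  { intros k. unfold At, C1. eapply Rle_trans; [apply Cmod_triangle|]. rewrite Rmult_plus_distr_r.
    apply Rplus_le_compat; [apply HA; lia|]. eapply Rle_trans; [apply Htau; lia|].
    apply Rmult_le_compat_l; auto. apply Rpower_le_r; [apply INR_S_pos|lra]. }
  assert (HdA : forall k, Cminus (At (S (S k))) (At (S k)) =
     Cplus (Cmult c (cpow (INR (S (S k))) (Copp s2))) (d (S k))) by (intros k; unfold d; ring).
  assert (Hd : forall k, Cmod (d (S k)) <= C2 * Rpower (INR (S (S k))) (- 1 - kap)).
  { intros k. apply (Hinc (S k)). lia. }
  assert (Htau' : forall k, Cmod (tau (S k)) <= C3 * Rpower (INR (S k)) (- Re s2)) by (intros k; apply Htau; lia).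
  assert (HC1 : 0 <= C1) by (unfold C1; lra).
  (* [|z| >= T / 4] and [N <= 28 * T] give [N / 112 <= |z|]. This instance yields the final estimate
     at [sigma3]; the next one, with [a - r], the uniform bound on the whole rectangle. *)
  destruct (smooth_tail_bound a kap (/ 112) C1 C2 C3 c s2 At d tau) as (Ka & HKa & Hta);
    try assumption; try lra.
  destruct (smooth_tail_bound (a - r) kap (/ 112) C1 C2 C3 c s2 At d tau) as (Kb & HKb & Htb);
    try assumption; try lra; [unfold r; lra|].
  clear Hinc HdA Hd Htau' Htau HA.
  destruct (AV2_partial_sums s1 s2) as (Ks & HKs & Hps).
  set (Amin := 10 + Rabs (Re s1) + Rabs (Re s2) + Rabs kap).
  (* [J] steps of length [r / 4] lead from an abscissa [A >= Amin] down to [sigma3]. Right of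
     [Amin], [AV2_partial_sums] applies and the counterterms are [O(1/M)]. *)
  destruct (INR_unbounded ((Amin - sigma3) / (r / 4))) as [J HJ].
  set (A := sigma3 + INR J * (r / 4)).
  assert (HAA : Amin <= A).
  { unfold A. assert ((Amin - sigma3) / (r / 4) * (r / 4) <= INR J * (r / 4)) by (apply Rmult_le_compat_r; lra).
    replace ((Amin - sigma3) / (r / 4) * (r / 4)) with (Amin - sigma3) in H by (field; lra). lra. }
  assert (HJ0 := pos_INR J).
  (* Dominates all deviations of [z] and [z'] from [i t] on the rectangle. For [T >= 4 * L + 4],
     both have modulus between [T / 4] and [T + L], and all points stay above the singular
     hyperplanes. *)
  set (L := Rabs sigma3 + Rabs A + 2 * r + Rabs (Re s1) + Rabs (Re s2) + Rabs (Im s1) + Rabs (Im s2) + INR J * r + r + 3).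
  assert (HL : 3 <= L).
  { unfold L. generalize (Rabs_pos sigma3) (Rabs_pos A) (Rabs_pos (Re s1)) (Rabs_pos (Re s2)) (Rabs_pos (Im s1)) (Rabs_pos (Im s2)).
    assert (0 <= INR J * r) by (apply Rmult_le_pos; lra). lra. }
  exists Ka, (4 * L + 4). split; auto. split; [lra|].
  intros T N t HT HN Ht.
  destruct N as [|n]; [simpl in HN; lra|].
  set (z := fun w => Cminus (Cplus w s1) (RtoC 1)).
  set (z' := fun w => Cminus (Cplus (z w) s2) (RtoC 1)).
  set (f := fun w k => Cmult (conv_coef s1 s2 k) (cpow (INR k) (Copp w))).
  set (G := fun M w => Cplus (Cplus (csum (f w) M) (Cmult (At (M - 1)%nat) (pow_prim (z w) (INR M))))
     (Cmult (Cdiv c (z w)) (pow_prim (z' w) (INR M)))).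
  assert (Hreg : forall w, sigma3 - r <= Re w <= A + r -> Rabs (Im w - t) <= INR J * r + r ->
    0 < Im (Cplus s1 w) /\ 0 < Im (Cplus (Cplus s1 s2) w) /\ T / 4 <= Cmod (z w) /\ T / 4 <= Cmod (z' w) /\
    2 + 6 * Cmod (z w) <= 14 * T /\ 2 + 6 * Cmod (z' w) <= 14 * T).
  { intros w Hw1 Hw2. unfold z', z.
    assert (HreW : Rabs (Re w) <= Rabs sigma3 + Rabs A + 2 * r).
    { apply Rabs_le. generalize (Rabs_pos sigma3) (Rabs_pos A) (Rle_abs A) (Rle_abs (- sigma3)) (Rle_abs sigma3).
      rewrite Rabs_Ropp. intros. lra. }
    assert (HimW : T / 2 - (INR J * r + r) <= Im w <= T + (INR J * r + r)).
    { generalize (Rle_abs (Im w - t)) (Rle_abs (- (Im w - t))). rewrite Rabs_Ropp. lra. }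
    set (z0 := Cminus (Cplus w s1) 1). set (z1 := Cminus (Cplus z0 s2) 1).
    assert (R0 : Re z0 = Re w + Re s1 - 1) by (unfold z0; rewrite Re_minus, re_plus; reflexivity).
    assert (I0 : Im z0 = Im w + Im s1) by (unfold z0; rewrite Im_minus, im_plus; simpl; ring).
    assert (R1 : Re z1 = Re w + Re s1 + Re s2 - 2) by (unfold z1; rewrite Re_minus, re_plus, R0; simpl; ring).
    assert (I1 : Im z1 = Im w + Im s1 + Im s2) by (unfold z1; rewrite Im_minus, im_plus, I0; simpl; ring).
    generalize (Rle_abs (Re w)) (Rle_abs (- Re w)) (Rle_abs (Re s1)) (Rle_abs (- Re s1))
      (Rle_abs (Re s2)) (Rle_abs (- Re s2)) (Rle_abs (Im s1)) (Rle_abs (- Im s1)) (Rle_abs (Im s2)) (Rle_abs (- Im s2)).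
    rewrite !Rabs_Ropp. intros.
    assert (A0 : Rabs (Re z0) + Rabs (Im z0) <= T + L).
    { assert (Rabs (Re z0) <= Rabs (Re w) + Rabs (Re s1) + 1) by (apply Rabs_le; lra).
      assert (Rabs (Im z0) <= T + (INR J * r + r) + Rabs (Im s1)) by (apply Rabs_le; unfold L in *; lra).
      unfold L. generalize (Rabs_pos (Re s2)) (Rabs_pos (Im s2)). lra. }
    assert (A1 : Rabs (Re z1) + Rabs (Im z1) <= T + L).
    { assert (Rabs (Re z1) <= Rabs (Re w) + Rabs (Re s1) + Rabs (Re s2) + 2) by (apply Rabs_le; lra).
      assert (Rabs (Im z1) <= T + (INR J * r + r) + Rabs (Im s1) + Rabs (Im s2)) by (apply Rabs_le; unfold L in *; lra).
      unfold L. lra. }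
    assert (M0 : T / 4 <= Im z0) by (unfold L in *; lra).
    assert (M1 : T / 4 <= Im z1) by (unfold L in *; lra).
    generalize (Cmod_le_Re_Im z0) (Cmod_le_Re_Im z1) (im_le_Cmod z0) (im_le_Cmod z1) (Rle_abs (Im z0)) (Rle_abs (Im z1)).
    intros. repeat split; try lra; rewrite ?im_plus; lra. }
  assert (HGd : forall M w, z w <> RtoC 0 -> z' w <> RtoC 0 -> cdiff (G M) w).
  { intros M w N0 N1.
    assert (Dz : cdiff z w).
    { unfold z. apply cdiff_minus; [|apply cdiff_const]. apply cdiff_plus; [apply cdiff_id|apply cdiff_const]. }
    assert (Dz' : cdiff z' w).
    { unfold z'. apply cdiff_minus; [|apply cdiff_const]. apply cdiff_plus; [exact Dz|apply cdiff_const]. }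
    assert (Dopp : forall F, cdiff F w -> cdiff (fun v => Copp (F v)) w).
    { intros F HF. apply cdiff_ext with (fun v => Cminus (RtoC 0) (F v)); [intros; ring|].
      apply cdiff_minus; [apply cdiff_const|auto]. }
    unfold G, pow_prim, Cdiv. apply cdiff_plus; [apply cdiff_plus|].
    - apply (cdiff_csum (fun k w => f w k)). intros i _. unfold f. apply cdiff_mult; [apply cdiff_const|].
      apply cdiff_cpow, Dopp, cdiff_id.
    - apply cdiff_mult; [apply cdiff_const|]. apply cdiff_mult; [apply cdiff_cpow, Dopp, Dz|apply cdiff_inv; auto].
    - apply cdiff_mult; [apply cdiff_mult; [apply cdiff_const|apply cdiff_inv; auto]|].
      apply cdiff_mult; [apply cdiff_cpow, Dopp, Dz'|apply cdiff_inv; auto]. }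
  assert (HZd : forall w, 0 < Im (Cplus s1 w) -> 0 < Im (Cplus (Cplus s1 s2) w) -> cdiff (fun w => Z s1 s2 w) w).
  { intros w N0 N1. apply holo3_cdiff, (proj1 HZ). intros l. split; intros E.
    - rewrite E in N0. simpl in N0. lra.
    - rewrite E in N1. simpl in N1. lra. }
  assert (Hnz : forall v, T / 4 <= Cmod v -> v <> RtoC 0) by (intros v Hv; apply Cmod_gt_0; lra).
  assert (Htail : forall m w, Cminus (G (S n + S (S m))%nat w) (csum (f w) (S n)) = Cplus (Cplus
      (csum (fun i => Cmult (Cminus (At (S n + i)%nat) (tau (S n + i)%nat))
         (cpow (INR (S n + i)) (Cminus (Copp (z w)) (RtoC 1)))) (S (S m)))
      (Cmult (At (S n + S m)%nat) (pow_prim (z w) (INR (S n + S (S m))))))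
      (Cmult (Cdiv c (z w)) (pow_prim (z' w) (INR (S n + S (S m)))))).
  { intros m w. unfold G. rewrite csum_split.
    replace (S n + S (S m) - 1)%nat with (S n + S m)%nat by lia.
    rewrite (csum_ext (fun i => f w (S n + i)%nat) (fun i => Cmult (Cminus (At (S n + i)%nat) (tau (S n + i)%nat))
         (cpow (INR (S n + i)) (Cminus (Copp (z w)) (RtoC 1))))).
    - ring.
    - intros i _. unfold f, At. rewrite conv_coef_conv_sum by lia. fold ph.
      replace (Cminus (Copp (z w)) (RtoC 1)) with (Cplus (Copp s1) (Copp w)) by (unfold z; ring).
      rewrite cpow_plus. ring. }
  assert (HN1 := INR_S_pos n).
  (* [B0] depends on [T], [N] and [t]. This is harmless: it only affects how large [M] must be for
     [G M] to be close to [Z]. *)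
  assert (Hrect : exists B0, forall w, sigma3 - r <= Re w <= A + r -> Rabs (Im w - t) <= INR J * r + r ->
    Cmod (Cminus (Z s1 s2 w) (csum (f w) (S n))) <= B0).
  { destruct (ccont_bounded_rect (fun w => Cminus (Z s1 s2 w) (csum (f w) (S n))) (sigma3 - r) (A + r)
      (t - (INR J * r + r)) (t + (INR J * r + r))) as [B0 HB0].
    - unfold A. assert (0 <= INR J * (r / 4)) by (apply Rmult_le_pos; lra). lra.
    - assert (0 <= INR J * r) by (apply Rmult_le_pos; lra). lra.
    - intros x y Hx Hy. apply cdiff_ccont.
      destruct (Hreg (x, y)) as (N0 & N1 & _); [simpl; lra|simpl; apply Rabs_le; lra|].
      apply cdiff_minus; [apply HZd; auto|].
      apply (cdiff_csum (fun k w => f w k)). intros i _. unfold f. apply cdiff_mult; [apply cdiff_const|].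
      apply cdiff_cpow. apply cdiff_ext with (fun v => Cminus (RtoC 0) v); [intros; ring|].
      apply cdiff_minus; [apply cdiff_const|apply cdiff_id].
    - exists B0. intros [x y] Hx Hy. apply HB0; [exact Hx|]. simpl in Hy.
      generalize (Rle_abs (y - t)) (Rle_abs (- (y - t))). rewrite Rabs_Ropp. lra. }
  destruct Hrect as [B0 HB0].
  apply Rle_plus_epsilon. intros eps Heps.
  destruct (limit_push_left (fun M w => Cminus (Z s1 s2 w) (G M w)) A r t (Rabs B0 + Kb) J (S n + 2)%nat Hr)
    with (eps := eps) as [M1 HM1]; auto.
  - generalize (Rabs_pos B0). lra.
  - intros M w HM. replace (A - INR J * (r / 4)) with sigma3 by (unfold A; ring). intros Hw1 Hw2.
    destruct (Hreg w Hw1 Hw2) as (N0 & N1 & N2 & N3 & N4 & N5). split.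
    + apply cdiff_minus; [apply HZd; auto|apply HGd; auto].
    + replace M with (S n + S (S (M - (S n + 2))))%nat by lia.
      set (m := (M - (S n + 2))%nat).
      replace (Cminus (Z s1 s2 w) _) with (Cminus (Cminus (Z s1 s2 w) (csum (f w) (S n)))
        (Cminus (G (S n + S (S m))%nat w) (csum (f w) (S n)))) by ring.
      eapply Rle_trans; [apply Cmod_minus_le|]. apply Rplus_le_compat.
      * eapply Rle_trans; [apply HB0; auto|apply Rle_abs].
      * rewrite Htail. eapply Rle_trans; [apply Htb|]; fold (z' w); try lra.
        -- unfold z. rewrite Re_minus, re_plus. simpl. unfold a. lra.
        -- rewrite <- (Rmult_1_r Kb) at 2. apply Rmult_le_compat_l; [lra|].
           apply Rpower_le_1; [auto|]. unfold r. lra.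
  - intros e He.
    set (Kt := Ks + C1 + Cmod c).
    assert (Hc0 := Cmod_ge_0 c).
    assert (HKt : 0 < Kt) by (unfold Kt; lra).
    destruct (INR_unbounded (Kt / e)) as [h Hh].
    exists (2 * S h + S (S n))%nat. intros M w HM Hw1 Hw2.
    destruct (Hreg w) as (N0 & N1 & N2 & N3 & N4 & N5).
    { unfold A in *. assert (0 <= INR J * (r / 4)) by (apply Rmult_le_pos; lra). lra. }
    { lra. }
    assert (Hh1 := INR_S_pos h).
    assert (Hih : 0 < / INR (S h)) by (apply Rinv_0_lt_compat; lra).
    assert (HKe : Kt * / INR (S h) <= e).
    { apply Rmult_le_reg_r with (INR (S h)); [lra|]. rewrite Rmult_assoc, Rinv_l, Rmult_1_r by lra.
      assert (Kt / e <= INR (S h)) by (rewrite S_INR; lra).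
      apply Rmult_le_reg_r with (/ e); [apply Rinv_0_lt_compat; auto|].
      replace (e * INR (S h) * / e) with (INR (S h)) by (field; lra). exact H. }
    eapply Rle_trans; [|exact HKe].
    assert (HhM : INR (S h) <= INR M) by (apply le_INR; lia).
    assert (HM1 : 1 <= INR M) by lra.
    assert (HMi : / INR M <= / INR (S h)) by (apply Rinv_le_contravar; lra).
    assert (Rz : Re (z w) = Re w + Re s1 - 1) by (unfold z; rewrite Re_minus, re_plus; reflexivity).
    assert (Rz' : Re (z' w) = Re w + Re s1 + Re s2 - 2) by (unfold z'; rewrite Re_minus, re_plus, Rz; simpl; ring).
    generalize (Rle_abs (Re s1)) (Rle_abs (- Re s1)) (Rle_abs (Re s2)) (Rle_abs (- Re s2)) (Rle_abs kap) (Rle_abs (- kap)).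
    rewrite !Rabs_Ropp. intros.
    replace (Cminus (Z s1 s2 w) (G M w)) with (Cminus (Cminus (Cminus (Z s1 s2 w) (csum (f w) M))
      (Cmult (At (M - 1)%nat) (pow_prim (z w) (INR M)))) (Cmult (Cdiv c (z w)) (pow_prim (z' w) (INR M))))
      by (unfold G; ring).
    unfold Kt. rewrite !Rmult_plus_distr_r.
    eapply Rle_trans; [apply Cmod_minus_le|]. apply Rplus_le_compat.
    + eapply Rle_trans; [apply Cmod_minus_le|]. apply Rplus_le_compat.
      * apply (Hps Z HZ w (S h)); try lia. unfold Amin in HAA. generalize (Rabs_pos kap). lra.
      * rewrite Cmod_mult. replace (M - 1)%nat with (S (M - 2)) by lia.
        apply Rle_trans with (C1 * Rpower (INR M) (1 - kap) * Rpower (INR M) (- (1) - (1 - kap))).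
        { apply Rmult_le_compat; try apply Cmod_ge_0.
          - eapply Rle_trans; [apply HAt|]. apply Rmult_le_compat_l; auto.
            apply Rpower_le_l; [|lra]. split; [generalize (INR_S_pos (M - 2)); lra|apply le_INR; lia].
          - apply Cmod_pow_prim_le_1; try lra. unfold Amin in HAA. lra. }
        rewrite Rmult_assoc, <- Rpower_plus. replace (1 - kap + (- (1) - (1 - kap))) with (- (1)) by ring.
        rewrite Rpower_Ropp, Rpower_1 by lra. apply Rmult_le_compat_l; auto.
    + rewrite Cmod_mult, Cmod_div by auto.
      apply Rmult_le_compat; try apply Cmod_ge_0.
      * apply Rmult_le_pos; auto. apply Rlt_le, Rinv_0_lt_compat; lra.
      * apply Rmult_le_reg_r with (Cmod (z w)); [lra|]. unfold Rdiv. rewrite Rmult_assoc, Rinv_l by lra. nra.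
      * apply Rle_trans with (Rpower (INR M) (- (1))).
        { apply Cmod_pow_prim_le_1; try lra. unfold Amin in HAA. generalize (Rabs_pos kap). lra. }
        rewrite Rpower_Ropp, Rpower_1 by lra. exact HMi.
  - set (m := M1). specialize (HM1 (S n + S (S m))%nat ltac:(unfold m; lia)).
    replace (A - INR J * (r / 4)) with sigma3 in HM1 by (unfold A; ring).
    set (w0 := (sigma3, t) : C) in *. cbn beta in HM1.
    assert (HA0 : 0 <= INR J * (r / 4)) by (apply Rmult_le_pos; lra).
    destruct (Hreg w0) as (N0 & N1 & N2 & N3 & N4 & N5).
    { simpl. unfold A. lra. }
    { simpl. rewrite Rminus_diag, Rabs_R0. assert (0 <= INR J * r) by (apply Rmult_le_pos; lra). lra. }
    change (csum _ (S n)) with (csum (f w0) (S n)).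
    replace (Cminus (Z s1 s2 w0) (csum (f w0) (S n))) with (Cplus (Cminus (G (S n + S (S m))%nat w0) (csum (f w0) (S n)))
      (Cminus (Z s1 s2 w0) (G (S n + S (S m))%nat w0))) by ring.
    eapply Rle_trans; [apply Cmod_triangle|]. apply Rplus_le_compat; [|exact HM1].
    rewrite Htail. eapply Rle_trans; [apply Hta|]; fold (z' w0); try lra.
    + unfold z, w0. rewrite Re_minus, re_plus. simpl. unfold a. lra.
    + apply Rmult_le_compat_l; [lra|]. apply Rpower_ge_l; lra.
Qed.

(** * Mean squares of Dirichlet polynomials *)

(** This is [k^(-it)]. Since [ln 0 = 0], index 0 has the frequency of index 1; the mean square
    estimate therefore asks for [b O = 0]. *)
Definition dir_phase (k : nat) (t : R) : C := cexp (Cmult (Cmult Ci (RtoC (- ln (INR k)))) (RtoC t)).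

Definition dir_poly (b : nat -> C) (N : nat) (t : R) : C :=
  csum (fun k => Cmult (b k) (dir_phase k t)) N.

Lemma Re_Ci_RtoC (x : R) : Re (Cmult Ci (RtoC x)) = 0.
Proof. simpl. ring. Qed.

Lemma Cmod_dir_phase (k : nat) (t : R) : Cmod (dir_phase k t) = 1.
Proof.
  unfold dir_phase. rewrite Cmod_cexp, re_scal_r, Re_Ci_RtoC, Rmult_0_l, exp_0. auto.
Qed.

Lemma cexp_conj (z : C) : Cconj (cexp z) = cexp (Cconj z).
Proof.
  apply C_ext; destruct z as [x y]; simpl; rewrite ?cos_neg, ?sin_neg; ring.
Qed.

Lemma dir_phase_conj_mult (k l : nat) (t : R) :
  Cmult (Cconj (dir_phase l t)) (dir_phase k t) =
  cexp (Cmult (Cmult Ci (RtoC (ln (INR l) - ln (INR k)))) (RtoC t)).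
Proof.
  unfold dir_phase. rewrite cexp_conj, <- cexp_plus. f_equal.
  apply C_ext; simpl; ring.
Qed.

Lemma rcont_plus (f g : R -> C) (x : R) : rcont f x -> rcont g x -> rcont (fun t => Cplus (f t) (g t)) x.
Proof.
  intros [A1 A2] [B1 B2]. split.
  - apply (continuous_plus (fun t => Re (f t)) (fun t => Re (g t))); auto.
  - apply (continuous_plus (fun t => Im (f t)) (fun t => Im (g t))); auto.
Qed.

Lemma rcont_csum (f : nat -> R -> C) (n : nat) (x : R) :
  (forall i, rcont (f i) x) -> rcont (fun t => csum (fun i => f i t) n) x.
Proof.
  intros H. induction n; simpl; [apply (rder_rcont _ _ _ (rder_const (RtoC 0) x))|].
  apply rcont_plus; auto.
Qed.

Lemma CInt_plus (f g : R -> C) (a b : R) : a <= b -> rcont_on f a b -> rcont_on g a b ->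
  CInt (fun t => Cplus (f t) (g t)) a b = Cplus (CInt f a b) (CInt g a b).
Proof.
  intros Hab Hf Hg.
  destruct (rcont_on_ex_RInt f a b Hab Hf) as [A1 A2].
  destruct (rcont_on_ex_RInt g a b Hab Hg) as [B1 B2].
  apply C_ext; rewrite ?re_plus, ?im_plus; simpl.
  - apply (RInt_plus (V := R_CompleteNormedModule) (fun t => Re (f t)) (fun t => Re (g t))); assumption.
  - apply (RInt_plus (V := R_CompleteNormedModule) (fun t => Im (f t)) (fun t => Im (g t))); assumption.
Qed.

Lemma CInt_csum (f : nat -> R -> C) (n : nat) (a b : R) : a <= b -> (forall i, rcont_on (f i) a b) ->
  CInt (fun t => csum (fun i => f i t) n) a b = csum (fun i => CInt (f i) a b) n.
Proof.
  intros Hab Hf. induction n; simpl.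
  - rewrite CInt_const. ring.
  - rewrite CInt_plus; [rewrite IHn; reflexivity|auto| |apply Hf].
    intros x Hx. apply rcont_csum. intros i. apply Hf, Hx.
Qed.

Lemma rcont_osc (beta z : C) (x : R) : rcont (fun t => Cmult beta (cexp (Cmult z (RtoC t)))) x.
Proof. eapply rder_rcont, rder_scal, rder_cexp_line. Qed.

Lemma CInt_osc_bound (beta : C) (om U V : R) : 0 < om -> U <= V ->
  Cmod (CInt (fun t => Cmult beta (cexp (Cmult (Cmult Ci (RtoC om)) (RtoC t)))) U V) <= 2 * Cmod beta / om.
Proof.
  intros Hom HUV.
  set (z := Cmult Ci (RtoC om)).
  assert (Hz : Cmod z = om) by (unfold z; rewrite Cmod_mult, Cmod_Ci, Cmod_R, Rabs_right; lra).
  assert (Hz0 : z <> RtoC 0) by (apply Cmod_gt_0; lra).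
  rewrite (CInt_derive (fun t => Cmult (Cdiv beta z) (cexp (Cmult z (RtoC t))))); auto.
  - eapply Rle_trans; [apply Cmod_minus_le|].
    rewrite !Cmod_mult, Cmod_div, Hz, !Cmod_cexp, !re_scal_r by auto.
    unfold z. rewrite Re_Ci_RtoC, !Rmult_0_l, exp_0. right. field. lra.
  - intros x _. replace (Cmult beta (cexp (Cmult z (RtoC x)))) with
      (Cmult (Cdiv beta z) (Cmult z (cexp (Cmult z (RtoC x))))) by (field; auto).
    apply rder_scal, rder_cexp_line.
  - intros x _. apply rcont_osc.
Qed.

Lemma continuous_Cmod_sqr (f : R -> C) (x : R) : rcont f x -> continuous (fun t => Cmod (f t) ^ 2) x.
Proof.
  intros [F1 F2].
  apply continuous_ext with (fun t => Re (f t) * Re (f t) + Im (f t) * Im (f t)).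
  { intros t. simpl. rewrite Rmult_1_r. symmetry. apply Cmod_sqr. }
  apply (continuous_plus (fun t => Re (f t) * Re (f t)) (fun t => Im (f t) * Im (f t)));
  [apply (continuous_mult (fun t => Re (f t)) (fun t => Re (f t)))
  |apply (continuous_mult (fun t => Im (f t)) (fun t => Im (f t)))]; auto.
Qed.

Lemma rcont_dir_poly (b : nat -> C) (N : nat) (x : R) : rcont (dir_poly b N) x.
Proof.
  unfold dir_poly. apply (rcont_csum (fun k t => Cmult (b k) (dir_phase k t))). intros i.
  apply rcont_osc.
Qed.

Lemma ex_RInt_Cmod_sqr (f : R -> C) (U V : R) : U <= V -> rcont_on f U V ->
  ex_RInt (fun t => Cmod (f t) ^ 2) U V.
Proof.
  intros H Hf. apply (ex_RInt_continuous (V := R_CompleteNormedModule)). intros x Hx.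
  rewrite Rmin_left, Rmax_right in Hx by lra. apply continuous_Cmod_sqr, Hf, Hx.
Qed.

(** Expanding [|X + Y|^2] with [Y] the last term organises the off-diagonal part by rows: each pair
    occurs once, with the larger index first, so the frequencies [ln N - ln k] have one sign. *)
Lemma RInt_dir_poly_step (b : nat -> C) (N : nat) (U V : R) : U <= V ->
  RInt (fun t => Cmod (dir_poly b (S N) t) ^ 2) U V =
  RInt (fun t => Cmod (dir_poly b N t) ^ 2) U V + (V - U) * Cmod (b N) ^ 2 +
  2 * Re (csum (fun k => CInt (fun t => Cmult (Cmult (Cconj (b N)) (b k))
     (cexp (Cmult (Cmult Ci (RtoC (ln (INR N) - ln (INR k)))) (RtoC t)))) U V) N).
Proof.
  intros HUV.
  set (cr := fun k t => Cmult (Cmult (Cconj (b N)) (b k))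
     (cexp (Cmult (Cmult Ci (RtoC (ln (INR N) - ln (INR k)))) (RtoC t)))).
  rewrite <- (CInt_csum cr) by (auto; intros i x _; apply rcont_osc).
  unfold CInt. cbn [Re fst].
  assert (Hex : ex_RInt (fun t => Re (csum (fun i => cr i t) N)) U V).
  { refine (proj1 (rcont_on_ex_RInt (fun t => csum (fun i => cr i t) N) U V HUV _)).
    intros x _. apply rcont_csum. intros i. apply rcont_osc. }
  assert (Hex2 : ex_RInt (fun t => Cmod (dir_poly b N t) ^ 2) U V).
  { apply ex_RInt_Cmod_sqr; auto. intros x _. apply rcont_dir_poly. }
  replace ((V - U) * Cmod (b N) ^ 2) with (RInt (fun _ => Cmod (b N) ^ 2) U V)
    by (rewrite RInt_const; unfold scal; simpl; unfold mult; simpl; ring).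
  rewrite <- (RInt_scal (V := R_CompleteNormedModule)) by exact Hex.
  unfold scal; simpl; unfold mult; simpl.
  rewrite <- (RInt_plus (V := R_CompleteNormedModule) (fun t => Cmod (dir_poly b N t) * (Cmod (dir_poly b N t) * 1)));
    [|exact Hex2|apply ex_RInt_const].
  rewrite <- (RInt_plus (V := R_CompleteNormedModule) (fun t => plus (Cmod (dir_poly b N t) * (Cmod (dir_poly b N t) * 1)) _)).
  - apply RInt_ext. intros t _. unfold plus; simpl.
    rewrite !Rmult_1_r.
    assert (E : csum (fun i => cr i t) N = Cmult (Cconj (Cmult (b N) (dir_phase N t))) (dir_poly b N t)).
    { unfold dir_poly. rewrite <- csum_scal. apply csum_ext. intros k _. unfold cr.
      rewrite <- dir_phase_conj_mult, Cmult_conj. ring. }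
    rewrite E. set (Y := Cmult (b N) (dir_phase N t)). set (X := dir_poly b N t).
    change (dir_poly b (S N) t) with (Cplus X Y).
    assert (EY : Cmod (b N) * Cmod (b N) = Cmod Y * Cmod Y).
    { unfold Y. rewrite Cmod_mult, Cmod_dir_phase. ring. }
    change (fst (Cmult (Cconj Y) X)) with (Re (Cmult (Cconj Y) X)).
    rewrite EY, !Cmod_sqr, re_plus, im_plus, re_mult, re_conj, im_conj. ring.
  - apply (ex_RInt_plus (V := R_CompleteNormedModule)); [exact Hex2|apply ex_RInt_const].
  - apply (ex_RInt_scal (V := R_CompleteNormedModule)). exact Hex.
Qed.

Lemma ln_ratio_ge (k l : R) : 0 < k -> k < l -> (l - k) / l <= ln l - ln k.
Proof.
  intros Hk Hl. rewrite <- ln_div by lra.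
  assert (H : ln (k / l) <= k / l - 1).
  { apply Rplus_le_reg_l with 1. replace (1 + (k / l - 1)) with (k / l) by ring.
    apply Rle_trans with (exp (ln (k / l))); [apply exp_ineq1_le|].
    right. apply exp_ln. apply Rdiv_lt_0_compat; lra. }
  rewrite !ln_div in * by lra. replace ((l - k) / l) with (1 - k / l) by (field; lra). lra.
Qed.

Lemma harmonic_le (n : nat) : rsum (fun i => / INR (S i)) (S n) <= 1 + ln (INR (S n)).
Proof.
  induction n.
  - simpl. rewrite ln_1, Rinv_1. lra.
  - change (rsum ?f (S (S n))) with (rsum f (S n) + f (S n)). cbn beta.
    generalize (log_step_bounds (INR (S n)) ltac:(generalize (INR_S_pos n); lra)).
    unfold log_step. rewrite <- S_INR. lra.
Qed.

Lemma rsum_rev (f : nat -> R) (n : nat) : rsum f n = rsum (fun i => f (n - 1 - i)%nat) n.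
Proof.
  induction n; [reflexivity|]. rewrite (rsum_shift (fun i => f (S n - 1 - i)%nat)).
  change (rsum f (S n)) with (rsum f n + f n). rewrite IHn.
  replace (S n - 1 - 0)%nat with n by lia. rewrite Rplus_comm. f_equal.
  apply rsum_ext. intros i Hi. f_equal. lia.
Qed.

(** From [/ ln (l/k) <= l / (l - k) = 1 + k / (l - k)]: the first part gives a power sum, the
    second, with [k^(1-p) <= l^(1-p)], a harmonic sum, which is the source of the logarithm. *)
Lemma off_diagonal_row (p : R) : 0 < p < 1 -> exists K, 0 < K /\ forall l, (1 <= l)%nat ->
  rsum (fun i => Rpower (INR (S i)) (- p) * / (ln (INR (S l)) - ln (INR (S i)))) l <=
  K * (1 + ln (INR (S l))) * Rpower (INR (S l)) (1 - p).
Proof.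
  intros Hp. destruct (power_sum_le_upto p ltac:(lra)) as [K [HK HS]].
  exists (K + 1). split; [lra|]. intros l Hl.
  set (x := INR (S l)). assert (Hx : 1 <= x) by apply INR_S_pos.
  assert (Hlx : 0 <= ln x) by (rewrite <- ln_1; apply ln_le; lra).
  assert (HP := Rpower_pos x (1 - p)).
  apply Rle_trans with (rsum (fun i => Rpower (INR (S i)) (- p) + Rpower x (1 - p) * / INR (S (l - 1 - i))) l).
  - apply rsum_le. intros i Hi. set (k := INR (S i)).
    assert (Hk : 1 <= k) by apply INR_S_pos.
    assert (Hd : INR (S (l - 1 - i)) = x - k).
    { unfold x, k. rewrite <- minus_INR by lia. f_equal. lia. }
    assert (Hxk : 1 <= x - k) by (rewrite <- Hd; apply INR_S_pos).
    rewrite Hd.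
    assert (H1 := ln_ratio_ge k x ltac:(lra) ltac:(lra)).
    assert (H0 : 0 < (x - k) / x) by (apply Rdiv_lt_0_compat; lra).
    apply Rle_trans with (Rpower k (- p) * / ((x - k) / x)).
    + apply Rmult_le_compat_l; [apply Rlt_le, Rpower_pos|]. apply Rinv_le_contravar; lra.
    + replace (/ ((x - k) / x)) with (1 + k * / (x - k)) by (field; lra).
      rewrite Rmult_plus_distr_l, Rmult_1_r. apply Rplus_le_compat_l.
      rewrite <- Rmult_assoc. apply Rmult_le_compat_r; [apply Rlt_le, Rinv_0_lt_compat; lra|].
      rewrite Rmult_comm, <- Rpower_Sr by lra. replace (- p + 1) with (1 - p) by ring.
      apply Rpower_le_l; lra.
  - rewrite rsum_plus, rsum_scal.
    assert (E1 : rsum (fun i => Rpower (INR (S i)) (- p)) l <= K * Rpower x (1 - p)) by (apply HS; lia).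
    assert (E2 : rsum (fun i => / INR (S (l - 1 - i))) l <= 1 + ln x).
    { rewrite <- (rsum_rev (fun i => / INR (S i))). destruct l as [|l]; [lia|].
      eapply Rle_trans; [apply harmonic_le|]. apply Rplus_le_compat_l. apply ln_le; [generalize (INR_S_pos l); lra|].
      apply le_INR; lia. }
    assert (Rpower x (1 - p) * rsum (fun i => / INR (S (l - 1 - i))) l <= Rpower x (1 - p) * (1 + ln x))
      by (apply Rmult_le_compat_l; lra).
    assert (K * Rpower x (1 - p) <= K * (1 + ln x) * Rpower x (1 - p)).
    { apply Rmult_le_compat_r; [lra|]. nra. }
    lra.
Qed.

(** Oscillating integrals are bounded independently of their interval, so nothing on the right
    depends on [U] and [V]. Taking absolute values of the off-diagonal terms loses a logarithm; it
    either appears in the final error term or is absorbed by a small power. *)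
Lemma mean_square_dir_poly (p Cb : R) : 1 / 2 < p < 1 -> 0 <= Cb -> exists K, 0 < K /\
  forall (b : nat -> C), b O = RtoC 0 -> (forall k, Cmod (b (S k)) <= Cb * Rpower (INR (S k)) (- p)) ->
  forall (N : nat) (U V : R), (1 <= N)%nat -> U <= V ->
  Rabs (RInt (fun t => Cmod (dir_poly b N t) ^ 2) U V - (V - U) * rsum (fun k => Cmod (b k) ^ 2) N) <=
  K * (1 + ln (INR N)) * Rpower (INR N) (2 - 2 * p).
Proof.
  intros Hp HCb.
  destruct (off_diagonal_row p ltac:(lra)) as [K1 [HK1 HO]].
  destruct (power_sum_le_upto (2 * p - 1) ltac:(lra)) as [K2 [HK2 HS]].
  exists (4 * Cb * Cb * K1 * K2 + 1). split.
  { assert (0 <= 4 * Cb * Cb * K1 * K2); [|lra]. repeat apply Rmult_le_pos; lra. }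
  intros b Hb0 Hb N U V HN HUV.
  assert (Hrow : forall l, Cmod (csum (fun k => CInt (fun t => Cmult (Cmult (Cconj (b (S l))) (b k))
     (cexp (Cmult (Cmult Ci (RtoC (ln (INR (S l)) - ln (INR k)))) (RtoC t)))) U V) (S l)) <=
     2 * Cb * Cb * K1 * (1 + ln (INR (S l))) * Rpower (INR (S l)) (- (2 * p - 1))).
  { intros l. rewrite csum_shift.
    rewrite Hb0. replace (CInt (fun t => Cmult (Cmult (Cconj (b (S l))) (RtoC 0)) _) U V) with (RtoC 0).
    2:{ symmetry. transitivity (CInt (fun _ => RtoC 0) U V); [|rewrite CInt_const; ring].
        unfold CInt; f_equal; apply RInt_ext; intros; [apply (f_equal Re)|apply (f_equal Im)]; ring. }
    rewrite Cplus_0_l.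
    set (x := INR (S l)). assert (Hx : 1 <= x) by apply INR_S_pos.
    assert (Hlx : 0 <= ln x) by (rewrite <- ln_1; apply ln_le; lra).
    apply Rle_trans with (rsum (fun i => (2 * Cb * Cb * Rpower x (- p)) *
      (Rpower (INR (S i)) (- p) * / (ln x - ln (INR (S i))))) l).
    - apply csum_bound. intros i Hi.
      assert (Hi1 := INR_S_pos i).
      assert (Hix : INR (S i) < x) by (apply lt_INR; lia).
      assert (Hom : 0 < ln x - ln (INR (S i))) by (generalize (ln_increasing (INR (S i)) x ltac:(lra) Hix); lra).
      eapply Rle_trans; [apply CInt_osc_bound; auto|].
      rewrite Cmod_mult, Cmod_conj.
      assert (HH : Cmod (b (S l)) * Cmod (b (S i)) <= (Cb * Rpower x (- p)) * (Cb * Rpower (INR (S i)) (- p))).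
      { apply Rmult_le_compat; try apply Cmod_ge_0; apply Hb. }
      apply Rle_trans with (2 * ((Cb * Rpower x (- p)) * (Cb * Rpower (INR (S i)) (- p))) / (ln x - ln (INR (S i)))).
      + apply Rmult_le_compat_r; [apply Rlt_le, Rinv_0_lt_compat, Hom|lra].
      + right. field. lra.
    - rewrite rsum_scal. assert (P0 := Rpower_pos x (- p)).
      destruct l as [|l].
      { simpl. rewrite Rmult_0_r. repeat apply Rmult_le_pos; try lra. apply Rlt_le, Rpower_pos. }
      apply Rle_trans with (2 * Cb * Cb * Rpower x (- p) * (K1 * (1 + ln x) * Rpower x (1 - p))).
      + apply Rmult_le_compat_l; [repeat apply Rmult_le_pos; lra|]. apply HO. lia.
      + right. replace (- (2 * p - 1)) with (- p + (1 - p)) by ring. rewrite Rpower_plus. ring. }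
  assert (Hind : forall M, (S M <= N)%nat -> Rabs (RInt (fun t => Cmod (dir_poly b (S M) t) ^ 2) U V -
     (V - U) * rsum (fun k => Cmod (b k) ^ 2) (S M)) <=
     4 * Cb * Cb * K1 * (1 + ln (INR N)) * rsum (fun l => Rpower (INR (S l)) (- (2 * p - 1))) M).
  { induction M; intros HM.
    - simpl rsum. rewrite RInt_dir_poly_step by auto. simpl csum. rewrite Hb0, Cmod_0.
      rewrite (RInt_ext _ (fun _ => 0)).
      2:{ intros t _. unfold dir_poly; simpl. rewrite Cmod_0. ring. }
      rewrite RInt_const. unfold scal; simpl; unfold mult; simpl.
      match goal with |- Rabs ?X <= _ => replace X with 0 by ring end. rewrite Rabs_R0. lra.
    - rewrite RInt_dir_poly_step by auto.
      change (rsum ?f (S (S M))) with (rsum f (S M) + f (S M)). cbn beta.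
      change (rsum ?f (S M)) with (rsum f M + f M) at 2. cbn beta.
      specialize (IHM ltac:(lia)).
      set (R0 := csum _ (S M)). set (I0 := RInt _ U V) in *. set (S0 := rsum (fun k => Cmod (b k) ^ 2) (S M)) in *.
      replace (I0 + (V - U) * Cmod (b (S M)) ^ 2 + 2 * Re R0 - (V - U) * (S0 + Cmod (b (S M)) ^ 2))
        with ((I0 - (V - U) * S0) + 2 * Re R0) by ring.
      eapply Rle_trans; [apply Rabs_triang|]. rewrite Rmult_plus_distr_l. apply Rplus_le_compat; [exact IHM|].
      rewrite Rabs_mult, (Rabs_right 2) by lra.
      assert (E1 := re_le_Cmod R0). assert (E2 := Hrow M). fold R0 in E2.
      assert (Hl : ln (INR (S M)) <= ln (INR N)).
      { apply ln_le; [generalize (INR_S_pos M); lra|]. apply le_INR; lia. }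
      assert (P0 := Rpower_pos (INR (S M)) (- (2 * p - 1))).
      apply Rle_trans with (2 * (2 * Cb * Cb * K1 * (1 + ln (INR (S M))) * Rpower (INR (S M)) (- (2 * p - 1)))); [lra|].
      apply Rle_trans with (4 * Cb * Cb * K1 * (1 + ln (INR (S M))) * Rpower (INR (S M)) (- (2 * p - 1))); [right; ring|].
      apply Rmult_le_compat_r; [lra|]. apply Rmult_le_compat_l; [|lra]. repeat apply Rmult_le_pos; lra. }
  destruct N as [|N]; [lia|].
  eapply Rle_trans; [apply Hind; lia|].
  assert (Hln : 0 <= ln (INR (S N))).
  { rewrite <- ln_1. apply ln_le; [lra|apply INR_S_pos]. }
  apply Rle_trans with (4 * Cb * Cb * K1 * (1 + ln (INR (S N))) * (K2 * Rpower (INR (S N)) (1 - (2 * p - 1)))).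
  - apply Rmult_le_compat_l; [repeat apply Rmult_le_pos; lra|]. apply HS; lia.
  - replace (1 - (2 * p - 1)) with (2 - 2 * p) by ring.
    assert (P0 := Rpower_pos (INR (S N)) (2 - 2 * p)).
    apply Rle_trans with ((4 * Cb * Cb * K1 * K2) * (1 + ln (INR (S N))) * Rpower (INR (S N)) (2 - 2 * p)); [right; ring|].
    apply Rmult_le_compat_r; [lra|]. apply Rmult_le_compat_r; lra.
Qed.

(** * The mean square of the double zeta-function *)

(** Halving [T] down to [[T1 / 2, T1]] produces errors that decrease geometrically with ratio [q],
    so their sum is of the order of the first, and the number of intervals does not enter. The
    constant satisfies [K + q * K' <= K']. *)
Lemma dyadic_bound (D g : R -> R) (T1 B K q gm : R) : 0 < T1 -> 0 <= q < 1 -> 0 <= K -> 0 < gm ->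
  (forall T, T1 / 2 <= T <= T1 -> Rabs (D T) <= B) ->
  (forall T, T1 / 2 <= T -> gm <= g T) ->
  (forall T, T1 <= T -> Rabs (D T - D (T / 2)) <= K * g T) ->
  (forall T, T1 <= T -> g (T / 2) <= q * g T) ->
  exists K', forall T, T1 <= T -> Rabs (D T) <= K' * g T.
Proof.
  intros HT1 Hq HK Hgm HB Hg HD Hgq.
  set (K' := Rabs B / gm + K / (1 - q)).
  assert (HBg : 0 <= Rabs B / gm) by (apply Rmult_le_pos; [apply Rabs_pos|apply Rlt_le, Rinv_0_lt_compat, Hgm]).
  assert (HKq : 0 <= K / (1 - q)) by (apply Rmult_le_pos; [auto|apply Rlt_le, Rinv_0_lt_compat; lra]).
  assert (Hind : forall n T, T1 / 2 <= T <= 2 ^ n * T1 -> Rabs (D T) <= K' * g T).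
  { induction n as [|n IH]; intros T HT.
    - simpl in HT. eapply Rle_trans; [apply HB; lra|]. eapply Rle_trans; [apply Rle_abs|].
      specialize (Hg T ltac:(lra)).
      apply Rle_trans with (Rabs B / gm * gm); [right; field; lra|].
      unfold K'. apply Rmult_le_compat; lra.
    - destruct (Rle_dec T T1) as [C|C].
      { apply IH. split; [lra|]. assert (1 <= 2 ^ n) by (apply pow_R1_Rle; lra). nra. }
      assert (IHT : Rabs (D (T / 2)) <= K' * g (T / 2)) by (apply IH; simpl in HT; lra).
      specialize (HD T ltac:(lra)). specialize (Hgq T ltac:(lra)). specialize (Hg T ltac:(lra)).
      replace (D T) with ((D T - D (T / 2)) + D (T / 2)) by ring.
      eapply Rle_trans; [apply Rabs_triang|].
      assert (E1 : K' * g (T / 2) <= K' * (q * g T)) by (apply Rmult_le_compat_l; unfold K'; lra).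
      assert (E2 : K <= K' * (1 - q)).
      { apply Rle_trans with (K / (1 - q) * (1 - q)); [right; field; lra|].
        apply Rmult_le_compat_r; unfold K'; lra. }
      assert (E3 : K * g T <= K' * (1 - q) * g T) by (apply Rmult_le_compat_r; lra).
      lra. }
  exists K'. intros T HT.
  destruct (INR_unbounded (T / T1)) as [n Hn].
  apply (Hind n). split; [lra|].
  assert (H2 : INR n <= 2 ^ n).
  { clear. induction n; [simpl; lra|]. rewrite S_INR. simpl.
    assert (1 <= 2 ^ n) by (apply pow_R1_Rle; lra). lra. }
  apply Rle_trans with (T / T1 * T1); [right; field; lra|]. apply Rmult_le_compat_r; lra.
Qed.

(** The bounds on finite blocks also prove convergence, by monotonicity; without it [Series] need
    not be the sum. *)
Lemma Series_tail_bound (f : nat -> R) (u : nat -> R) : (forall k, 0 <= f k) ->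
  (forall N m, (1 <= N)%nat -> rsum (fun i => f (N + i)%nat) m <= u N) ->
  forall N, (1 <= N)%nat -> Rabs (Series f - rsum f N) <= u N.
Proof.
  intros Hf Hu N HN.
  assert (Es : forall n, sum_n f n = rsum f (S n)).
  { induction n; [rewrite sum_O; simpl; ring|]. rewrite sum_Sn, IHn. reflexivity. }
  assert (Hinc : forall n m, (n <= m)%nat -> rsum f n <= rsum f m) by (intros; apply rsum_incr; auto).
  destruct (ex_finite_lim_seq_incr (sum_n f) (rsum f 1 + u 1%nat)) as [l Hl].
  - intros n. rewrite !Es. apply Hinc. lia.
  - intros n. rewrite Es. replace (S n) with (1 + n)%nat by lia. rewrite rsum_split.
    apply Rplus_le_compat_l, Hu. lia.
  - assert (El : Series f = l) by (unfold Series; rewrite (is_lim_seq_unique _ _ Hl); reflexivity).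
    rewrite El.
    assert (L1 : rsum f N <= l).
    { apply (is_lim_seq_le_loc (fun _ => rsum f N) (sum_n f) (Finite (rsum f N)) (Finite l)); auto.
      - exists N. intros n Hn. rewrite Es. apply Hinc. lia.
      - apply is_lim_seq_const. }
    assert (L2 : l <= rsum f N + u N).
    { apply (is_lim_seq_le_loc (sum_n f) (fun _ => rsum f N + u N) (Finite l) (Finite (rsum f N + u N))); auto.
      - exists N. intros n Hn. rewrite Es. replace (S n) with (N + (S n - N))%nat by lia.
        rewrite rsum_split. apply Rplus_le_compat_l, Hu, HN.
      - apply is_lim_seq_const. }
    rewrite Rabs_right; lra.
Qed.

Lemma cpow_vertical (k : nat) (sigma t : R) :
  cpow (INR k) (Copp (sigma, t)) = Cmult (cpow (INR k) (Copp (RtoC sigma))) (dir_phase k t).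
Proof.
  unfold dir_phase. rewrite !cpow_cexp, <- cexp_plus. f_equal. apply C_ext; simpl; ring.
Qed.

Lemma cpow_RtoC (x r : R) : cpow x (RtoC r) = RtoC (Rpower x r).
Proof.
  apply C_ext; simpl; rewrite Rmult_0_l, ?cos_0, ?sin_0; unfold Rpower; ring.
Qed.

Lemma ln_nonneg (x : R) : 1 <= x -> 0 <= ln x.
Proof. intros. rewrite <- ln_1. apply ln_le; lra. Qed.

Lemma ln_le_sub_1 (x : R) : 0 < x -> ln x <= x - 1.
Proof.
  intros Hx. generalize (exp_ineq1_le (ln x)). rewrite exp_ln by auto. lra.
Qed.

(** Pointwise, the difference of the squares is at most [eps * (2 |g| + eps)], and
    [2 |g| <= |g|^2 + 1] takes the place of the Cauchy-Schwarz inequality. Nothing essential is lost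
    when the mean square of [g] is of the order of [V - U] at most. *)
Lemma RInt_Cmod_sqr_close (f g : R -> C) (U V eps : R) : U <= V -> 0 <= eps ->
  rcont_on f U V -> rcont_on g U V ->
  (forall t, U <= t <= V -> Cmod (Cminus (f t) (g t)) <= eps) ->
  Rabs (RInt (fun t => Cmod (f t) ^ 2) U V - RInt (fun t => Cmod (g t) ^ 2) U V) <=
  eps * RInt (fun t => Cmod (g t) ^ 2) U V + (eps + eps * eps) * (V - U).
Proof.
  intros HUV He Hf Hg Hfg.
  assert (Ef := ex_RInt_Cmod_sqr f U V HUV Hf). assert (Eg := ex_RInt_Cmod_sqr g U V HUV Hg).
  assert (Hpt : forall t, U <= t <= V -> Rabs (Cmod (f t) ^ 2 - Cmod (g t) ^ 2) <= eps * Cmod (g t) ^ 2 + (eps + eps * eps)).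
  { intros t Ht. specialize (Hfg t Ht).
    assert (P1 := Cmod_ge_0 (f t)). assert (P2 := Cmod_ge_0 (g t)).
    assert (Q1 := Cmod_minus_ge (f t) (g t)). assert (Q2 := Cmod_minus_ge (g t) (f t)).
    rewrite Cmod_minus_sym in Q2.
    set (x := Cmod (f t)) in *. set (y := Cmod (g t)) in *.
    replace (x ^ 2 - y ^ 2) with ((x - y) * (x + y)) by ring.
    rewrite Rabs_mult. rewrite (Rabs_right (x + y)) by lra.
    assert (Rabs (x - y) <= eps) by (apply Rabs_le; lra).
    apply Rle_trans with (eps * (2 * y + eps)).
    - apply Rmult_le_compat; try lra. apply Rabs_pos.
    - assert (0 <= eps * ((y - 1) * (y - 1))) by (apply Rmult_le_pos; [auto|apply Rle_0_sqr]). simpl. nra. }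
  assert (Elin : forall al be, ex_RInt (fun t => al * Cmod (g t) ^ 2 + be) U V).
  { intros al be. apply (ex_RInt_plus (V := R_CompleteNormedModule) (fun t => al * Cmod (g t) ^ 2) (fun _ => be)).
    - apply (ex_RInt_scal (V := R_CompleteNormedModule) (fun t => Cmod (g t) ^ 2) U V al Eg).
    - apply ex_RInt_const. }
  assert (Rlin : forall al be, RInt (fun t => al * Cmod (g t) ^ 2 + be) U V =
    al * RInt (fun t => Cmod (g t) ^ 2) U V + be * (V - U)).
  { intros al be.
    rewrite (RInt_plus (V := R_CompleteNormedModule) (fun t => al * Cmod (g t) ^ 2) (fun _ => be)).
    - assert (R1 : RInt (fun t => al * Cmod (g t) ^ 2) U V = al * RInt (fun t => Cmod (g t) ^ 2) U V)
        by exact (RInt_scal (V := R_CompleteNormedModule) (fun t => Cmod (g t) ^ 2) U V al Eg).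
      rewrite R1, RInt_const. change (al * RInt (fun t => Cmod (g t) ^ 2) U V + (V - U) * be =
        al * RInt (fun t => Cmod (g t) ^ 2) U V + be * (V - U)). ring.
    - apply (ex_RInt_scal (V := R_CompleteNormedModule) (fun t => Cmod (g t) ^ 2) U V al Eg).
    - apply ex_RInt_const. }
  assert (U1 := RInt_le (fun t => Cmod (f t) ^ 2) (fun t => (1 + eps) * Cmod (g t) ^ 2 + (eps + eps * eps)) U V HUV Ef
    (Elin _ _) ltac:(intros t Ht; generalize (Rle_abs (Cmod (f t) ^ 2 - Cmod (g t) ^ 2)) (Hpt t ltac:(lra)); lra)).
  assert (U2 := RInt_le (fun t => (1 - eps) * Cmod (g t) ^ 2 + - (eps + eps * eps)) (fun t => Cmod (f t) ^ 2) U V HUV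
    (Elin _ _) Ef ltac:(intros t Ht; generalize (Rle_abs (- (Cmod (f t) ^ 2 - Cmod (g t) ^ 2))) (Hpt t ltac:(lra)); rewrite Rabs_Ropp; lra)).
  rewrite Rlin in U1, U2. apply Rabs_le. lra.
Qed.

(** The cases of the theorem differ only in the growth exponent [th] of the convolution sums and in
    the target [g]. The coefficients are [O(k^(-p))] with [p = a - th], so the off-diagonal terms
    give [T^(2-2p) log T]. The approximation error [T^(1-a-kap)] enters to the first power over a
    length [T], which gives [T^(2-a-kap)]. *)
Lemma zetaAV2_mean_square (Z : C -> C -> C -> C) (s1 s2 : C) (sigma3 kap th Ct : R)
    (g : R -> R) (T2 q gm Kg : R) :
  is_zetaAV2 Z -> Re s2 < 3 / 2 -> kap <= Re s2 -> kap <= 3 / 4 -> 1 < Re s1 + sigma3 + kap ->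
  1 / 2 < Re s1 + sigma3 - th < 1 -> 0 <= Ct ->
  (forall k, Cmod (conv_sum (binom_weight s1) s2 (S k)) <= Ct * Rpower (INR (S k)) th) ->
  (forall t, 2 <= t -> cdiff (fun w => Z s1 s2 w) (sigma3, t)) ->
  1 <= T2 -> 0 <= q < 1 -> 0 < gm -> 0 <= Kg ->
  (forall T, T2 <= T -> gm <= g T) ->
  (forall T, T2 <= T -> g (T / 2) <= q * g T) ->
  (forall T, T2 <= T -> (1 + ln T) * Rpower T (2 - 2 * (Re s1 + sigma3 - th)) +
     Rpower T (2 - (Re s1 + sigma3) - kap) <= Kg * g T) ->
  exists K T0, forall T, T0 <= T ->
    Cmod (Cminus (RtoC (RInt (fun t3 => Cmod (Z s1 s2 (sigma3, t3)) ^ 2) 2 T))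
      (Cmult (zetaAV2_sq s1 s2 (RtoC (2 * sigma3))) (RtoC T))) <= K * g T.
Proof.
  intros HZ Hs2 Hk1 Hk2 Hak Hp HCt Hco Hdiff HT2 Hq Hgm HKg Hg1 Hg2 Hg3.
  set (a := Re s1 + sigma3) in *. set (p := a - th) in *.
  set (b := fun k => Cmult (conv_coef s1 s2 k) (cpow (INR k) (Copp (RtoC sigma3)))).
  assert (Hb0 : b O = RtoC 0).
  { unfold b, conv_coef. rewrite sum_n_m_csum. simpl. ring. }
  assert (Hb : forall k, Cmod (b (S k)) <= Ct * Rpower (INR (S k)) (- p)).
  { intros k. unfold b. rewrite conv_coef_conv_sum by lia. rewrite !Cmod_mult, !Cmod_cpow, !re_opp.
    change (Re (RtoC sigma3)) with sigma3.
    replace (- p) with (th + (- Re s1) + (- sigma3)) by (unfold p, a; ring). rewrite !Rpower_plus.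
    assert (Q1 := Rpower_pos (INR (S k)) (- Re s1)). assert (Q2 := Rpower_pos (INR (S k)) (- sigma3)).
    specialize (Hco k).
    apply Rle_trans with ((Rpower (INR (S k)) (- Re s1)) * (Ct * Rpower (INR (S k)) th) * Rpower (INR (S k)) (- sigma3)).
    - apply Rmult_le_compat_r; [lra|]. apply Rmult_le_compat_l; lra.
    - right; ring. }
  destruct (mean_square_dir_poly p Ct Hp HCt) as (K1 & HK1 & HMS).
  destruct (zetaAV2_approx Z s1 s2 sigma3 kap HZ Hs2 Hk1 Hk2 Hak) as (Ka & T3 & HKa & HT3 & Happ).
  fold a in Happ.
  destruct (power_tail_le (2 * p) ltac:(lra)) as (Kt & HKt & HTt).
  set (fs := fun k => Cmod (b k) ^ 2).
  set (cc := Series fs).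
  set (Kc := Ct * Ct * Kt).
  assert (HKc : 0 <= Kc) by (unfold Kc; repeat apply Rmult_le_pos; lra).
  assert (Htail : forall N, (1 <= N)%nat -> Rabs (cc - rsum fs N) <= Kc * Rpower (INR N) (1 - 2 * p)).
  { apply (Series_tail_bound fs (fun N => Kc * Rpower (INR N) (1 - 2 * p))).
    - intros k. apply pow2_ge_0.
    - intros [|N] m HN; [lia|].
      apply Rle_trans with (rsum (fun i => Ct * Ct * Rpower (INR (S N + i)) (- (2 * p))) m).
      + apply rsum_le. intros i _. unfold fs.
        apply Rle_trans with ((Ct * Rpower (INR (S N + i)) (- p)) ^ 2).
        * apply pow_incr. split; [apply Cmod_ge_0|apply (Hb (N + i)%nat)].
        * right. replace (- (2 * p)) with (- p + - p) by ring. rewrite Rpower_plus. simpl. ring.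
      + rewrite rsum_scal. unfold Kc. rewrite (Rmult_assoc (Ct * Ct)). apply Rmult_le_compat_l; [nra|]. apply HTt. }
  set (F := fun t => Cmod (Z s1 s2 (sigma3, t)) ^ 2).
  assert (HFc : forall u v, 2 <= u -> rcont_on (fun t => Z s1 s2 (sigma3, t)) u v).
  { intros u v Hu t Ht. apply (rcont_vertical (fun w => Z s1 s2 w)), cdiff_ccont, Hdiff. lra. }
  assert (HFi : forall u v, 2 <= u -> u <= v -> ex_RInt F u v).
  { intros u v Hu Huv. apply (ex_RInt_Cmod_sqr (fun t => Z s1 s2 (sigma3, t))); auto. }
  assert (HFch : forall u v, 2 <= u -> u <= v -> RInt F 2 v = RInt F 2 u + RInt F u v).
  { intros u v Hu Huv. symmetry. apply (RInt_Chasles (V := R_CompleteNormedModule)); apply HFi; lra. }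
  assert (HF0 : forall u v, 2 <= u -> u <= v -> 0 <= RInt F u v).
  { intros u v Hu Huv. apply RInt_ge_0; auto. intros; apply pow2_ge_0. }
  (* Halving some [T >= T1] stays above [T2] and above the lower limit 2 of the integral. *)
  set (T1 := T3 + 2 * T2 + 4).
  set (Ktot := (1 + Ka) * (784 * K1 + Kc) + Ka * Rabs cc + (1 + Ka) * Ka).
  assert (Hcc0 := Rabs_pos cc).
  assert (HKtot : 0 <= Ktot).
  { unfold Ktot. assert (0 <= (1 + Ka) * (784 * K1 + Kc)) by (apply Rmult_le_pos; lra).
    assert (0 <= Ka * Rabs cc) by (apply Rmult_le_pos; lra).
    assert (0 <= (1 + Ka) * Ka) by (apply Rmult_le_pos; lra). lra. }
  assert (Hhalf : forall T, T1 <= T -> Rabs (RInt F (T / 2) T - cc * (T / 2)) <= Ktot * Kg * g T).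
  { intros T HT. unfold T1 in HT.
    destruct (nfloor_ex (14 * T) ltac:(lra)) as [n Hn].
    set (N := S n). assert (HN : 14 * T <= INR N <= 28 * T) by (unfold N; rewrite S_INR; lra).
    assert (HN1 : (1 <= N)%nat) by (unfold N; lia).
    set (X := (1 + ln T) * Rpower T (2 - 2 * p)). set (Y := Rpower T (2 - a - kap)).
    assert (HlT := ln_nonneg T ltac:(lra)).
    assert (HPX := Rpower_pos T (2 - 2 * p)).
    assert (HX0 : 0 < X) by (unfold X; apply Rmult_lt_0_compat; lra).
    assert (HY0 : 0 < Y) by apply Rpower_pos.
    set (eps := Ka * Rpower T (1 - a - kap)).
    assert (HepsT : eps * T = Ka * Y).
    { unfold eps, Y. replace (2 - a - kap) with (1 - a - kap + 1) by ring. rewrite Rpower_Sr by lra. ring. }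
    assert (Heps1 : eps <= Ka).
    { unfold eps. rewrite <- (Rmult_1_r Ka) at 2. apply Rmult_le_compat_l; [lra|]. apply Rpower_le_1; lra. }
    assert (Heps0 : 0 <= eps) by (unfold eps; apply Rmult_le_pos; [lra|apply Rlt_le, Rpower_pos]).
    set (SN := rsum fs N).
    set (IZ := RInt F (T / 2) T). set (ID := RInt (fun t => Cmod (dir_poly b N t) ^ 2) (T / 2) T).
    assert (H1 : Rabs (IZ - ID) <= eps * ID + (eps + eps * eps) * (T - T / 2)).
    { apply (RInt_Cmod_sqr_close (fun t => Z s1 s2 (sigma3, t)) (dir_poly b N)); auto; try lra.
      - apply HFc. lra.
      - intros t _. apply rcont_dir_poly.
      - intros t Ht. unfold dir_poly. rewrite (csum_ext _ (fun k => Cmult (conv_coef s1 s2 k) (cpow (INR k) (Copp (sigma3, t))))).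
        + apply (Happ T N t); lra.
        + intros k _. rewrite cpow_vertical. unfold b. ring. }
    assert (H2 : Rabs (ID - (T - T / 2) * SN) <= K1 * (1 + ln (INR N)) * Rpower (INR N) (2 - 2 * p)).
    { apply HMS; auto; lra. }
    assert (H3 := Htail N HN1). fold SN in H3.
    (* 784 is [28^2]: [N <= 28 * T] costs at most 28 in [1 + ln N], as [ln 28 <= 27], and at most 28
       in the power, as [2 - 2 * p < 1]. *)
    assert (F1 : K1 * (1 + ln (INR N)) * Rpower (INR N) (2 - 2 * p) <= 784 * K1 * X).
    { assert (E1 : 1 + ln (INR N) <= 28 * (1 + ln T)).
      { assert (ln (INR N) <= ln (28 * T)) by (apply ln_le; lra).
        rewrite ln_mult in H by lra. generalize (ln_le_sub_1 28 ltac:(lra)). lra. }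
      assert (E2 : Rpower (INR N) (2 - 2 * p) <= 28 * Rpower T (2 - 2 * p)).
      { apply Rle_trans with (Rpower (28 * T) (2 - 2 * p)); [apply Rpower_le_l; lra|].
        rewrite <- Rpower_mult_distr by lra. apply Rmult_le_compat_r; [lra|].
        rewrite <- (Rpower_1 28) at 2 by lra. apply Rpower_le_r; lra. }
      assert (HlN := ln_nonneg (INR N) ltac:(lra)).
      apply Rle_trans with (K1 * ((28 * (1 + ln T)) * (28 * Rpower T (2 - 2 * p)))); [|unfold X; right; ring].
      rewrite Rmult_assoc. apply Rmult_le_compat_l; [lra|].
      apply Rmult_le_compat; try lra. apply Rlt_le, Rpower_pos. }
    assert (F2 : T / 2 * (Kc * Rpower (INR N) (1 - 2 * p)) <= Kc * X).
    { assert (E1 : Rpower (INR N) (1 - 2 * p) <= Rpower T (1 - 2 * p)) by (apply Rpower_ge_l; lra).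
      assert (E2 : T * Rpower T (1 - 2 * p) <= X).
      { rewrite <- Rpower_Sr by lra. replace (1 - 2 * p + 1) with (2 - 2 * p) by ring. unfold X. nra. }
      assert (P1 := Rpower_pos (INR N) (1 - 2 * p)).
      apply Rle_trans with (Kc * (T * Rpower T (1 - 2 * p))).
      - rewrite <- !Rmult_assoc, (Rmult_comm _ Kc), !Rmult_assoc. apply Rmult_le_compat_l; auto.
        apply Rmult_le_compat; lra.
      - apply Rmult_le_compat_l; auto. }
    assert (H4 : Rabs (ID - T / 2 * cc) <= (784 * K1 + Kc) * X).
    { replace (ID - T / 2 * cc) with ((ID - (T - T / 2) * SN) - T / 2 * (cc - SN)) by field.
      eapply Rle_trans; [apply Rabs_triang|]. rewrite Rabs_Ropp, Rabs_mult, (Rabs_right (T / 2)) by lra.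
      rewrite Rmult_plus_distr_r. apply Rplus_le_compat; [lra|].
      eapply Rle_trans; [|exact F2]. apply Rmult_le_compat_l; lra. }
    assert (H5 : ID <= T / 2 * Rabs cc + (784 * K1 + Kc) * X).
    { generalize (Rle_abs (ID - T / 2 * cc)). assert (T / 2 * cc <= T / 2 * Rabs cc) by (apply Rmult_le_compat_l; [lra|apply Rle_abs]). lra. }
    assert (H6 : eps * ID <= Ka * Rabs cc * Y + Ka * (784 * K1 + Kc) * X).
    { apply Rle_trans with (eps * (T / 2 * Rabs cc + (784 * K1 + Kc) * X)); [apply Rmult_le_compat_l; auto|].
      rewrite Rmult_plus_distr_l. apply Rplus_le_compat.
      - apply Rle_trans with (eps * T * Rabs cc); [|rewrite HepsT; right; ring].
        rewrite <- Rmult_assoc. apply Rmult_le_compat_r; auto. apply Rmult_le_compat_l; lra.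
      - rewrite <- Rmult_assoc. apply Rmult_le_compat_r; [lra|]. apply Rmult_le_compat_r; lra. }
    assert (H7 : (eps + eps * eps) * (T - T / 2) <= (1 + Ka) * Ka * Y).
    { apply Rle_trans with ((1 + eps) * (eps * T)).
      - assert (0 <= (eps + eps * eps) * T) by (apply Rmult_le_pos; [nra|lra]). lra.
      - rewrite HepsT, Rmult_assoc. apply Rmult_le_compat_r; [nra|lra]. }
    assert (H8 : Rabs (IZ - cc * (T / 2)) <= Ktot * (X + Y)).
    { replace (IZ - cc * (T / 2)) with ((IZ - ID) + (ID - T / 2 * cc)) by ring.
      eapply Rle_trans; [apply Rabs_triang|].
      assert (0 <= (1 + Ka) * (784 * K1 + Kc) * Y) by (repeat apply Rmult_le_pos; lra).
      assert (0 <= Ka * Rabs cc * X) by (repeat apply Rmult_le_pos; lra).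
      assert (0 <= (1 + Ka) * Ka * X) by (repeat apply Rmult_le_pos; lra).
      unfold Ktot. lra. }
    eapply Rle_trans; [exact H8|]. rewrite Rmult_assoc. apply Rmult_le_compat_l; auto.
    apply Hg3. lra. }
  destruct (dyadic_bound (fun T => RInt F 2 T - cc * T) g T1 (RInt F 2 T1 + Rabs cc * T1) (Ktot * Kg) q gm)
    as [K HK]; auto; unfold T1 in *; try lra.
  - apply Rmult_le_pos; auto.
  - intros T HT. assert (E := HFch T (T3 + 2 * T2 + 4) ltac:(lra) ltac:(lra)).
    assert (P1 := HF0 T (T3 + 2 * T2 + 4) ltac:(lra) ltac:(lra)).
    assert (P2 := HF0 2 T ltac:(lra) ltac:(lra)).
    eapply Rle_trans; [apply Rabs_triang|]. rewrite Rabs_Ropp, Rabs_mult, (Rabs_right T), (Rabs_right (RInt F 2 T)) by lra.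
    apply Rplus_le_compat; [lra|]. apply Rmult_le_compat_l; lra.
  - intros T HT. apply Hg1. lra.
  - intros T HT. rewrite (HFch (T / 2) T) by lra.
    replace (_ - _) with (RInt F (T / 2) T - cc * (T / 2)) by field. apply Hhalf. lra.
  - intros T HT. apply Hg2. lra.
  - exists K, (T3 + 2 * T2 + 4). intros T HT.
    (* At the real argument [2 * sigma3] the terms are the squares [|b k|^2]: the imaginary series
       vanishes and the constant is the diagonal sum. *)
    assert (Esq : zetaAV2_sq s1 s2 (RtoC (2 * sigma3)) = RtoC cc).
    { assert (Et : forall k, AV2sq_term s1 s2 (RtoC (2 * sigma3)) k = RtoC (fs k)).
      { intros k. unfold AV2sq_term. fold (conv_coef s1 s2 k). unfold fs, b.
        assert (Ep : cpow (INR k) (Copp (RtoC (2 * sigma3))) =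
          RtoC (Cmod (cpow (INR k) (Copp (RtoC sigma3))) ^ 2)).
        { rewrite <- !RtoC_opp, !cpow_RtoC, Cmod_R, Rabs_right by (apply Rle_ge, Rlt_le, Rpower_pos).
          apply (f_equal RtoC). replace (- (2 * sigma3)) with (- sigma3 + - sigma3) by ring.
          rewrite Rpower_plus. simpl. ring. }
        rewrite Ep, <- RtoC_mult, <- Rpow_mult_distr, <- Cmod_mult. reflexivity. }
      apply C_ext; [apply Series_ext; intros k; rewrite Et; reflexivity|].
      transitivity (Series (fun k => 0 * fs k)); [|rewrite Series_scal_l; apply Rmult_0_l].
      apply Series_ext. intros k. rewrite Et. simpl. ring. }
    rewrite Esq, <- RtoC_mult, <- RtoC_minus, Cmod_R. apply (HK T HT).
Qed.

(** With [a = Re s1 + sigma3], the comparison of [Re s2] with [1/2 + a] decides whether the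
    off-diagonal terms with bounded convolution sums, [T^(2-2a) log T], exceed
    [T^(5/2 - a - Re s2)]. In the first case [th = 0] is the choice; otherwise there is room for a
    positive [th] and for absorbing the logarithm. *)
Theorem theorem1p3 :
  forall (Z : C -> C -> C -> C), is_zetaAV2 Z ->
  forall (s1 s2 : C) (sigma3 : R),
    0 <= Re s1 -> 0 <= Im s1 -> 0 < sigma3 ->
    Re s1 + sigma3 > 1/2 ->
    3/2 < Re s1 + Re s2 + sigma3 -> Re s1 + Re s2 + sigma3 <= 2 ->
    (forall t3 : R, 2 <= t3 ->
       Cplus s1 (sigma3, t3) <> RtoC 1 /\
       Cplus (Cplus s1 s2) (sigma3, t3) <> RtoC 2) ->
    let I := fun T : R => RInt (fun t3 : R => Cmod (Z s1 s2 (sigma3, t3)) ^ 2) 2 T in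
    let err := fun T : R => Cmod (Cminus (RtoC (I T))
                   (Cmult (zetaAV2_sq s1 s2 (RtoC (2 * sigma3))) (RtoC T))) in
    (Re s2 >= 1/2 + Re s1 + sigma3 ->
       exists K T0 : R, forall T : R, T0 <= T ->
         err T <= K * (Rpower T (2 - 2 * Re s1 - 2 * sigma3) * ln T)) /\
    (Re s2 < 1/2 + Re s1 + sigma3 -> Re s1 + Re s2 + sigma3 < 2 ->
       exists K T0 : R, forall T : R, T0 <= T ->
         err T <= K * Rpower T (5/2 - Re s1 - Re s2 - sigma3)) /\
    (Re s2 < 1/2 + Re s1 + sigma3 -> Re s1 + Re s2 + sigma3 = 2 ->
       exists K T0 : R, forall T : R, T0 <= T ->
         err T <= K * sqrt (T * ln T)).
Proof.
  intros Z HZ s1 s2 sigma3 H1 H2 H3 Ha Hx1 Hx2 Hreg I err.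
  assert (Hdiff : forall t, 2 <= t -> cdiff (fun w => Z s1 s2 w) (sigma3, t)).
  { intros t Ht. apply holo3_cdiff, (proj1 HZ). intros l. split; intros E.
    - assert (E2 := f_equal Im E). rewrite im_plus in E2. simpl in E2. lra.
    - destruct l as [|l].
      + destruct (Hreg t Ht) as [_ Hn]. apply Hn. rewrite E. f_equal. simpl. ring.
      + assert (E2 := f_equal Re E). rewrite !re_plus in E2. simpl in E2.
        generalize (INR_S_pos l). simpl. lra. }
  (* The value 3/4 just suffices. When it is the minimum, the approximation error is [T^(5/4 - a)]:
     it is within [T^(2 - 2a)] for [a <= 3/4] and within [T^(5/2 - a - Re s2)] for [Re s2 <= 5/4],
     and the two cases provide these bounds, as [a + Re s2 <= 2]. *)
  set (a := Re s1 + sigma3). set (kap := Rmin (Re s2) (3 / 4)).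
  assert (Hkap1 : kap <= Re s2) by apply Rmin_l.
  assert (Hkap2 : kap <= 3 / 4) by apply Rmin_r.
  assert (Hak : 1 < Re s1 + sigma3 + kap) by (unfold kap; apply Rmin_case; lra).
  assert (Hq : forall al, 1 / 4 <= al -> 0 <= Rpower 2 (- al) < 1).
  { intros al Hal. split; [apply Rlt_le, Rpower_pos|].
    rewrite <- (Rpower_O 2) by lra. apply Rpower_lt; lra. }
  assert (Hqs : forall al T, 0 < T -> Rpower (T / 2) al = Rpower 2 (- al) * Rpower T al).
  { intros al T HT. unfold Rdiv. rewrite <- Rpower_mult_distr by lra. rewrite Rmult_comm. f_equal.
    unfold Rpower. rewrite ln_Rinv by lra. f_equal. ring. }
  assert (Hln1 : forall T, 3 <= T -> 1 <= ln T).
  { intros T HT. rewrite <- (ln_exp 1). apply ln_le; [apply exp_pos|]. generalize exp_le_3. lra. }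
  assert (Hcase2 : Re s2 < 1 / 2 + Re s1 + sigma3 -> exists K T0, forall T, T0 <= T ->
     err T <= K * Rpower T (5 / 2 - Re s1 - Re s2 - sigma3)).
  { intros Hs.
    (* Lower limits for [th]: 0 and [1 - Re s2] for [conv_sum_bound] with [q = 1 - th], and [a - 1]
       for [p < 1]. At [th = hi] the exponent [2 - 2 * (a - th)] would reach [al]; staying below
       leaves the gap [de] for the logarithm, and gives [p > 1/2] because [3/2 < a + Re s2]. *)
    set (lo := Rmax 0 (Rmax (1 - Re s2) (a - 1))). set (hi := (1 / 2 + a - Re s2) / 2).
    assert (Hlohi : lo < hi) by (unfold lo, hi, a; repeat apply Rmax_case; lra).
    assert (L1 : 0 <= lo) by apply Rmax_l.
    assert (L2 : 1 - Re s2 <= lo) by (eapply Rle_trans; [apply Rmax_l|apply Rmax_r]).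
    assert (L3 : a - 1 <= lo) by (eapply Rle_trans; [apply Rmax_r|apply Rmax_r]).
    set (th := (lo + hi) / 2).
    assert (Hth : lo < th < hi) by (unfold th; lra).
    destruct (conv_sum_bound s1 s2 (1 - th) ltac:(lra) ltac:(lra)) as (Ct & HCt & Hco).
    set (al := 5 / 2 - Re s1 - Re s2 - sigma3).
    set (de := al - (2 - 2 * (a - th))).
    assert (Hde : 0 < de) by (unfold de, al, hi, a in *; lra).
    apply (zetaAV2_mean_square Z s1 s2 sigma3 kap th Ct (fun T => Rpower T al) 1 (Rpower 2 (- al)) 1 (2 + / de));
      auto; fold a; try lra.
    - unfold hi, a in *. lra.
    - intros k. replace th with (1 - (1 - th)) by ring. apply Hco. lia.
    - apply Hq. unfold al. lra.
    - assert (0 < / de) by (apply Rinv_0_lt_compat; auto). lra.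
    - intros T HT. apply Rpower_ge_1; auto. unfold al; lra.
    - intros T HT. rewrite Hqs by lra. lra.
    - intros T HT.
      assert (E1 : Rpower T (2 - a - kap) <= Rpower T al).
      { apply Rpower_le_r; auto. unfold al, a, kap in *. apply Rmin_case; lra. }
      assert (E2 : 1 + ln T <= (1 + / de) * Rpower T de).
      { assert (P1 : 1 <= Rpower T de) by (apply Rpower_ge_1; lra).
        assert (P2 : ln T <= / de * Rpower T de).
        { apply Rmult_le_reg_l with de; auto. rewrite <- Rmult_assoc, Rinv_r, Rmult_1_l by lra.
          generalize (ln_le_sub_1 (Rpower T de) (Rpower_pos _ _)). unfold Rpower at 1. rewrite ln_exp. lra. }
        lra. }
      assert (E3 : (1 + ln T) * Rpower T (2 - 2 * (a - th)) <= (1 + / de) * Rpower T al).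
      { replace al with (de + (2 - 2 * (a - th))) by (unfold de; ring). rewrite Rpower_plus, <- Rmult_assoc.
        apply Rmult_le_compat_r; [apply Rlt_le, Rpower_pos|exact E2]. }
      lra. }
  split; [|split].
  - intros Hs.
    assert (Ha34 : a <= 3 / 4) by (unfold a; lra).
    destruct (power_tail_le (Re s2) ltac:(lra)) as (K0 & HK0 & HT0).
    set (Ct := Rpower 4 (Rabs (Re (Copp s1))) * K0).
    set (al := 2 - 2 * Re s1 - 2 * sigma3).
    assert (Hal : 1 / 2 <= al) by (unfold al, a in *; lra).
    (* Here [Re s2 >= 1/2 + a > 1], so the convolution sums are bounded: [th = 0] and [p = a]. *)
    apply (zetaAV2_mean_square Z s1 s2 sigma3 kap 0 Ct (fun T => Rpower T al * ln T) 6 (Rpower 2 (- al)) 1 3);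
      auto; fold a; try lra.
    + unfold a in *; lra.
    + apply Rmult_le_pos; [apply Rlt_le, Rpower_pos|lra].
    + intros k. rewrite Rpower_O by (generalize (INR_S_pos k); lra). rewrite Rmult_1_r.
      eapply Rle_trans; [apply conv_sum_le; lia|]. unfold Ct.
      apply Rmult_le_compat_l; [apply Rlt_le, Rpower_pos|].
      eapply Rle_trans; [apply (HT0 O (S k))|]. simpl INR. unfold Rpower at 1. rewrite ln_1, Rmult_0_r, exp_0. lra.
    + apply Hq. lra.
    + intros T HT. assert (1 <= Rpower T al) by (apply Rpower_ge_1; lra).
      specialize (Hln1 T ltac:(lra)). nra.
    + intros T HT. rewrite Hqs, Rmult_assoc by lra.
      apply Rmult_le_compat_l; [apply Rlt_le, Rpower_pos|].
      apply Rmult_le_compat_l; [apply Rlt_le, Rpower_pos|]. apply ln_le; lra.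
    + intros T HT. specialize (Hln1 T ltac:(lra)).
      replace (2 - 2 * (a - 0)) with al by (unfold al, a; ring).
      assert (E1 : Rpower T (2 - a - kap) <= Rpower T al).
      { apply Rpower_le_r; [lra|]. unfold al, a, kap in *. apply Rmin_case; lra. }
      assert (P0 := Rpower_pos T al). nra.
  - intros Hs _. apply Hcase2, Hs.
  (* On the plane [a + Re s2 = 2] the exponent of the second case is 1/2, and [sqrt T] is at most
     [sqrt (T * ln T)] once [ln T >= 1]. *)
  - intros Hs Hx. destruct (Hcase2 Hs) as (K & T0 & HK).
    exists (Rabs K), (Rmax T0 3). intros T HT.
    assert (T0 <= T) by (eapply Rle_trans; [apply Rmax_l|exact HT]).
    assert (3 <= T) by (eapply Rle_trans; [apply Rmax_r|exact HT]).
    eapply Rle_trans; [apply HK; auto|].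
    replace (5 / 2 - Re s1 - Re s2 - sigma3) with (/ 2) by lra.
    rewrite Rpower_sqrt by lra. specialize (Hln1 T ltac:(lra)).
    apply Rle_trans with (Rabs K * sqrt T).
    + apply Rmult_le_compat_r; [apply sqrt_pos|apply Rle_abs].
    + apply Rmult_le_compat_l; [apply Rabs_pos|]. apply sqrt_le_1; nra.
Qed.
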